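(* There exist an integer $n\ge 1$ and a family $\{f_t\}$ of reduced complex analytic function germs $f_t\colon(\mathbb{C}^n,0)\to(\mathbb{C},0)$, depending holomorphically on a parameter $t$ in an open neighborhood of $0$ in $\mathbb{C}$, such that: (1) the family of hypersurface singularities $V_t=V(f_t)$ is topologically equisingular: for every $t$ there is a germ of homeomorphism $\varphi_t\colon(\mathbb{C}^n,0)\to(\mathbb{C}^n,0)$ with $f_t=f_0\circ\varphi_t$; (2) for every $t\neq 0$, the tangent cone $C(V(f_t),0)$ is not homeomorphic to $C(V(f_0),0)$; (3) for $t\ne 0$, if $X_1,\dots,X_r$ are the irreducible components of $C(V(f_t),0)$ and $Y_1,\dots,Y_s$ are the irreducible components of $C(V(f_0),0)$, there is no bijection $\sigma\colon\{1,\dots,r\}\to\{1,\dots,s\}$ such that $k_{V(f_t)}(X_i)=k_{V(f_0)}(Y_{\sigma(i)})$ for all $i\in\{1,\dots,r\}$.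
   Context: $V(f)$ denotes the zero set (germ) of $f$. For a reduced holomorphic germ $f\colon(\mathbb{C}^n,0)\to(\mathbb{C},0)$ (in particular not identically zero, without repeated irreducible factors), write $f=f_m+f_{m+1}+\cdots$ with $f_k$ homogeneous of degree $k$ and $f_m\neq 0$. The tangent cone of $V(f)$ at $0$ is $C(V(f),0)=V(f_m)\subset\mathbb{C}^n$. Decompose $f_m=h_1^{k_1}\cdots h_r^{k_r}$ into powers of pairwise non-associate irreducible polynomials; the irreducible components of $C(V(f),0)$ are the $V(h_i)$, and the relative multiplicity of $V(f)$ along $V(h_i)$ is $k_{V(f)}(V(h_i)):=k_i$. *)

(* Defs.v *)
From HB Require Import structures.
From mathcomp Require Import all_boot all_order all_algebra.
From mathcomp Require Import complex.
From mathcomp Require Import mpoly.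
From mathcomp Require Import all_classical reals topology normedtype sequences derive.
Import Order.TTheory GRing.Theory Num.Theory.
Import numFieldNormedType.Exports.

Set Implicit Arguments.
Unset Strict Implicit.
Unset Printing Implicit Defensive.

Local Open Scope classical_set_scope.
Local Open Scope ring_scope.

(* [R[i]] packaged as a [numClosedFieldType]: the norm, the topology and the
   normed module structures of MathComp-Analysis are inferred from there. *)
Definition Cplx (R : realType) : numClosedFieldType := R[i].

Notation Cn R n := 'rV[Cplx R]_n.
Notation Cpoly R n := {mpoly (Cplx R)[n]}.

Definition irreducible_elt (A : idomainType) (p : A) : Prop :=
  [/\ p != 0, p \isn't a GRing.unit &
      forall a b : A, p = a * b ->
        (a \is a GRing.unit) || (b \is a GRing.unit)].

Definition associated (A : idomainType) (p q : A) : Prop :=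
  exists2 u : A, u \is a GRing.unit & q = u * p.

Definition irreducible_decomposition (A : idomainType) (p : A) (r : nat)
    (h : 'I_r -> A) (k : 'I_r -> nat) : Prop :=
  [/\ forall i, irreducible_elt (h i),
      forall i j, i != j -> ~ associated (h i) (h j),
      forall i, (0 < k i)%N &
      p = \prod_(i < r) h i ^+ k i].

Definition homeomorphism (S T : topologicalType) (A : set S) (B : set T)
    (f : S -> T) (g : T -> S) : Prop :=
  [/\ set_fun A B f /\ set_fun B A g,
      (forall x, A x -> g (f x) = x) /\ (forall y, B y -> f (g y) = y),
      {within A, continuous f} & {within B, continuous g}].

Definition homeomorphic (S T : topologicalType) (A : set S) (B : set T) : Prop :=
  exists (f : S -> T) (g : T -> S), homeomorphism A B f g.

Section Germs.
Variables (R : realType) (n : nat).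
Local Notation C := (Cplx R).
Implicit Types (f g h : Cn R n -> C).

(* A germ at the origin is represented by a function on the whole of C^n; only
   its values near 0 are relevant. *)
Definition germ_eq f g : Prop := \forall z \near (0 : Cn R n), f z = g z.

(* [differentiable] is Frechet differentiability over the base field, which is
   complex here. *)
Definition holomorphic_germ f : Prop :=
  \forall z \near (0 : Cn R n), differentiable f z.

Definition unit_germ f : Prop :=
  exists2 g, holomorphic_germ g & germ_eq (fun z => f z * g z) (fun=> 1).

Definition irreducible_germ g : Prop :=
  [/\ holomorphic_germ g, ~ germ_eq g (fun=> 0), ~ unit_germ g &
      forall a b, holomorphic_germ a -> holomorphic_germ b ->
        germ_eq g (fun z => a z * b z) -> unit_germ a \/ unit_germ b].

Definition reduced_germ f : Prop :=
  [/\ holomorphic_germ f, f 0 = 0, ~ germ_eq f (fun=> 0) &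
      forall g h, irreducible_germ g -> holomorphic_germ h ->
        ~ germ_eq f (fun z => g z ^+ 2 * h z)].

Definition homeo_germ (phi : Cn R n -> Cn R n) : Prop :=
  phi 0 = 0 /\
  exists (U W : set (Cn R n)) (psi : Cn R n -> Cn R n),
    [/\ open U, U 0, open W & homeomorphism U W phi psi].

Definition peval (p : Cpoly R n) (z : Cn R n) : C :=
  p.@[fun i => z ord0 i].

Definition zero_set (p : Cpoly R n) : set (Cn R n) :=
  [set z | peval p z = 0].

Definition homogeneous_expansion f (P : nat -> Cpoly R n) : Prop :=
  (forall k, P k \is k.-homog) /\
  \forall z \near (0 : Cn R n), series (fun k => peval (P k) z) @ \oo --> f z.

Definition is_initial_form f (p : Cpoly R n) : Prop :=
  exists (P : nat -> Cpoly R n) (m : nat),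
    [/\ homogeneous_expansion f P, forall k, (k < m)%N -> P k = 0,
        P m != 0 & p = P m].

(* The homogeneous expansion of a nonzero holomorphic germ exists and is unique,
   hence so is its initial form f_m; the default value 0 is used only when there
   is none. *)
Definition initial_form f : Cpoly R n := xget 0 [set p | is_initial_form f p].

Definition tangent_cone f : set (Cn R n) := zero_set (initial_form f).

(* [X] enumerates the irreducible components of the tangent cone of V(f), and
   [k i] is the relative multiplicity of V(f) along [X i]. *)
Definition tangent_cone_components f (r : nat)
    (X : 'I_r -> set (Cn R n)) (k : 'I_r -> nat) : Prop :=
  exists2 h : 'I_r -> Cpoly R n,
    irreducible_decomposition (initial_form f) h k &
    forall i, X i = zero_set (h i).

(* Joint holomorphy in (t, z) on a neighbourhood of D x {0}. *)
Definition holomorphic_family (D : set C) (f : C -> Cn R n -> C) : Prop :=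
  forall t, D t -> \forall p \near ((t, 0) : C * Cn R n),
    differentiable (fun q : C * Cn R n => f q.1 q.2) p.

End Germs.

(* Main.v *)
(* On C^6 take [f_t = y^2 z + x^3 z2 + w^3 z3 + t x y w].

   Topological triviality: [f_t = f_0] composed with the shear that adds to
   (z, z2, z3) the vector [t x y w conj(s) / |s|^2], where s = (y^2, x^3, w^3).
   With m = max |s_i| one has |x y w| <= m^(7/6), so the shear is continuous.

   Reducedness: the derivatives of f_t in z and z2 are [y^2] and [x^3]; both vanish
   on the zeros of g if g^2 divides f_t. On the plane spanned by the x and y axes g would
   then have an isolated zero, against the maximum principle for 1/g.

   Multiplicities: the initial form is [y (y z + t x w)], in which y has
   multiplicity 2 exactly when t = 0; for t <> 0 it is squarefree.

   Topology of the cones: for t = 0 the cone is {y = 0} U {z = 0}, and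
   |y| - |z| changes sign across S0 = {y = z = 0}. For t <> 0 it is H U Q with
   H = {y = 0} and Q = {y z + t x w = 0}. Under a homeomorphism, the pull-back of
   |y| - |z| has constant sign on H and on Q, since its zeros are mapped to the
   complex 4-space S0, which cannot separate a complex 5-manifold. Hence S0 is
   the image of the intersection of H and Q, that is, of {y = 0, x w = 0}. There
   |x| - |w| changes sign across {y = x = w = 0}, a complex 3-space, which cannot
   separate S0.

   Dimension enters through [convex_separation]: if s changes sign on a convex
   open set of R^(N+1), then by Poincare-Miranda the zeros of s realize a full
   N-cube of values of Lipschitz functions of U; counting small cells shows that
   U cannot send these zeros into R^d with d < N. *)
Require Import Defs.
From mathcomp Require Import all_boot all_order all_algebra all_fingroup complex mpoly.
From mathcomp Require Import all_classical reals topology normedtype sequences derive.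
From mathcomp Require Import interval_inference lra ring zify.
Import Order.TTheory GRing.Theory Num.Theory.
Import numFieldNormedType.Exports Normc.
Set Implicit Arguments.
Unset Strict Implicit.
Unset Printing Implicit Defensive.
Local Open Scope classical_set_scope.
Local Open Scope ring_scope.

(** * A Freudenthal triangulation argument modulo 2 *)

(** The exponents meet two opposite constraints. The terms x^3 z2 and w^3 z3 must have degree above
    3, so as to stay out of the initial form, while 1/2 + 1/3 + 1/3 must exceed 1, so that x y w is
    negligible against (y^2, x^3, w^3) and the shear extends continuously by the identity where
    these all vanish. The cones must be told apart by an invariant of mere homeomorphisms. The one
    used is that a set of real codimension 2 does not separate; it is obtained by counting cells,
    without homology. For reducedness, the only fact needed from complex analysis is that a zero is
    never isolated in two variables. A maximum principle with a poor constant is enough for that,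
    since it is applied to 1/g near a zero of g, where any uniform bound is absurd. Such a principle
    follows from finite trapezoid sums, without integrals. *)

Lemma addrr_F2 (a : 'F_2) : a + a = 0.
Proof. by rewrite -mulr2n -mulr_natl pchar_Fp_0 ?mul0r. Qed.

Lemma addr_eq0_F2 (a b : 'F_2) : a + b = 0 -> a = b.
Proof.
by move=> ab; rewrite -[a]addr0 -(addrr_F2 b) addrA ab add0r.
Qed.

Lemma sum_invariant_F2 (T : finType) (h : T -> T) (c : pred T) (F : T -> 'F_2) :
  injective h -> (forall x, c (h x) = ~~ c x) -> (forall x, F (h x) = F x) ->
  \sum_x F x = 0.
Proof.
move=> hI ch Fh; rewrite (bigID c) /= [X in _ + X](reindex_inj hI) /=.
by under [X in _ + X]eq_big do [rewrite ch negbK|rewrite Fh]; rewrite addrr_F2.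
Qed.

(* The [j]-th vertex of the simplex of the Freudenthal triangulation of the
   cube based at [v] in which coordinate [x] is incremented at step [rho x]. *)
Definition simplex_vertex n m (v : {ffun 'I_n -> 'I_m.+1}) (rho : 'S_n)
    (j : nat) : {ffun 'I_n -> nat} :=
  [ffun x => (v x + (rho x < j))%N].

(** This is the cup product of the coboundaries of the labels, evaluated on the sum of all simplices
    of the grid. Labels are indexed by [nat], so that dropping the first one in the induction on the
    dimension is a mere shift. *)
Definition grid_jumps n m (l : nat -> {ffun 'I_n -> nat} -> 'F_2) : 'F_2 :=
  \sum_(p : {ffun 'I_n -> 'I_m.+1} * 'S_n) \prod_(i < n)
    (l i (simplex_vertex p.1 p.2 i.+1) + l i (simplex_vertex p.1 p.2 i)).

Section Step.
Variables (n m : nat) (l : nat -> {ffun 'I_n.+1 -> nat} -> 'F_2).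
Hypothesis l0 : forall (i : 'I_n.+1) (v : {ffun 'I_n.+1 -> nat}),
  v i = 0%N -> l i v = 0.
Hypothesis l1 : forall (i : 'I_n.+1) (v : {ffun 'I_n.+1 -> nat}),
  v i = m.+1 -> l i v = 1.
Let P := ({ffun 'I_n.+1 -> 'I_m.+1} * 'S_n.+1)%type.
Let w (p : P) j := simplex_vertex p.1 p.2 j.
Let d i u v := l i v + l i u.

(** The cochain whose coboundary is the summand of [grid_jumps]: label 0 cupped with the jumps of
    the other labels. *)
Let face (u : nat -> {ffun 'I_n.+1 -> nat}) : 'F_2 :=
  l 0%N (u 0%N) * \prod_(i < n) d i.+1 (u i) (u i.+1).
(** The edge from vertex j to vertex j + 1 is skipped. At j = n this is the face opposite to the
    last vertex; at j = 0 it is one of the two terms obtained by expanding the jump of label 0. *)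
Let E j (p : P) : 'F_2 := l 0%N (w p 0) * \prod_(i < n)
  (if (i < j)%N then d i.+1 (w p i) (w p i.+1) else d i.+1 (w p i.+1) (w p i.+2)).

(** The other simplex that contains the face opposite to vertex j + 1: increments number j and j + 1
    are exchanged. *)
Let swap j (p : P) : P :=
  (p.1, (p.2 * tperm (inord j) (inord j.+1))%g).

Let swap_w j k (p : P) : (j < n)%N -> k != j.+1 -> w (swap j p) k = w p k.
Proof.
move=> jn kj; apply/ffunP => x; rewrite !ffunE permM; congr (_ + nat_of_bool _)%N.
have ij : nat_of_ord (inord j : 'I_n.+1) = j by rewrite inordK // ltnW.
have ij1 : nat_of_ord (inord j.+1 : 'I_n.+1) = j.+1 by rewrite inordK.
case: tpermP => [->|->|//]; rewrite ij ij1 ?[in RHS]ltnS.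
- by rewrite ltn_neqAle eq_sym kj.
- by rewrite [in RHS]ltn_neqAle eq_sym kj.
Qed.

Let swap_inj j : injective (swap j).
Proof. by move=> [v r] [v' r'] [-> /mulIg ->]. Qed.

(** Mod 2 the two jumps of label j + 1 telescope to one from vertex j to vertex j + 2. Hence
    [E j p + E j.+1 p] depends only on the face opposite to vertex j + 1, and [swap j] pairs the
    simplices, of opposite parity, that share it. *)
Let E_succ j : (j < n)%N -> \sum_p E j p = \sum_p E j.+1 p.
Proof.
move=> jn; suff: \sum_p (E j p + E j.+1 p) = 0.
  by rewrite big_split /= => /addr_eq0_F2.
pose i0 := Ordinal jn.
pose F (p : P) := l 0%N (w p 0) * ((l j.+1 (w p j.+2)) *
  \prod_(i < n | i != i0) (if (i < j)%N then d i.+1 (w p i) (w p i.+1)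
    else d i.+1 (w p i.+1) (w p i.+2))).
pose G (p : P) := l 0%N (w p 0) * ((l j.+1 (w p j)) *
  \prod_(i < n | i != i0) (if (i < j)%N then d i.+1 (w p i) (w p i.+1)
    else d i.+1 (w p i.+1) (w p i.+2))).
have EFG p : E j p + E j.+1 p = F p + G p.
  rewrite /E /F /G -!mulrDr; congr (_ * _).
  rewrite (bigD1 i0) //= [X in _ + X](bigD1 i0) //= ltnn ltnSn.
  have -> : \prod_(i < n | i != i0) (if (i < j.+1)%N then d i.+1 (w p i) (w p i.+1)
      else d i.+1 (w p i.+1) (w p i.+2)) =
    \prod_(i < n | i != i0) (if (i < j)%N then d i.+1 (w p i) (w p i.+1)
      else d i.+1 (w p i.+1) (w p i.+2)).
    apply: eq_bigr => i; rewrite -val_eqE /= => ij.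
    by rewrite ltnS leq_eqVlt (negbTE ij).
  rewrite -!mulrDl; congr (_ * _).
  rewrite /d addrACA [l _ (w p j.+1) + l _ (w p j)]addrC -addrA.
  by rewrite addrA addrACA addrr_F2 addr0 ?addr0.
have prodE p : \prod_(i < n | i != i0) (if (i < j)%N
      then d i.+1 (w (swap j p) i) (w (swap j p) i.+1)
      else d i.+1 (w (swap j p) i.+1) (w (swap j p) i.+2)) =
    \prod_(i < n | i != i0) (if (i < j)%N then d i.+1 (w p i) (w p i.+1)
      else d i.+1 (w p i.+1) (w p i.+2)).
  apply: eq_bigr => i; rewrite -val_eqE /= => ij.
  case: ifPn => [ltij|nji]; rewrite ?swap_w ?eqSS // ?neq_ltn.
  - by rewrite ltnS ltnW.
  - by rewrite -leqNgt in nji; rewrite ltnS nji orbT.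
apply: (sum_invariant_F2 (h := swap j) (c := fun p => odd_perm p.2)) => [|p|p].
- exact: swap_inj.
- rewrite odd_permM odd_tperm -val_eqE /= !inordK ?ltnS // 1?ltnW //.
  by rewrite neq_ltn ltnSn addbT.
- by rewrite !EFG /F /G prodE !swap_w // ?neq_ltn ?ltnSn // orbT.
Qed.

Lemma grid_jumps_faces : grid_jumps m l =
  \sum_p face (fun j => w p j.+1) + \sum_p face (w p).
Proof.
have -> : \sum_p face (w p) = \sum_p E n p.
  by apply: eq_bigr => p _; congr (_ * _); apply: eq_bigr => i _; rewrite ltn_ord.
have -> : \sum_p E n p = \sum_p E 0 p.
  suff H j : (j <= n)%N -> \sum_p E j p = \sum_p E 0 p by exact: H.
  by elim: j => // j IH jn; rewrite -E_succ // IH // ltnW.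
rewrite -big_split /=; apply: eq_bigr => p _.
by rewrite big_ord_recl /= mulrDl.
Qed.

Let first (p : P) : 'I_n.+1 := (p.2^-1)%g ord0.

Let cyc : 'S_n.+1 := perm (@ord_pred_inj n.+1).

(** The neighbour across the face opposite to vertex 0: the base moves to vertex 1 and the first
    increment becomes the last. The wrap-around of [inZp] keeps this a bijection at the boundary of
    the grid; a wrapped face has a coordinate equal to 0 and contributes nothing. *)
Let shift (p : P) : P :=
  ([ffun x => if x == first p then inZp (p.1 x).+1 else p.1 x],
   (p.2 * cyc)%g).

Let shift_inj : injective shift.
Proof.
move=> [v r] [v' r'] [/ffunP vv' /mulIg rr']; subst r'; congr (_, _).
apply/ffunP => x; move: (vv' x); rewrite !ffunE /first /=.
case: ifP => // _ /(congr1 val) /= /eqP.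
rewrite -[(v x).+1]addn1 -[(v' x).+1]addn1 eqn_modDr !modn_small //.
by move/eqP/val_inj.
Qed.

Let cycE i : cyc i = (if i == ord0 then n else i.-1) :> nat.
Proof.
rewrite permE /= -val_eqE /= addnS /=; have := ltn_ord i.
case: (nat_of_ord i) => [|k] kn /=; first by rewrite add0n modn_small.
by rewrite addSnnS modnDr modn_small // ltnW.
Qed.

Let shift_w (p : P) j : (j <= n)%N -> (p.1 (first p) < m)%N ->
  w (shift p) j = w p j.+1.
Proof.
move=> jn pm; apply/ffunP => x; rewrite !ffunE /= permM cycE.
have -> : (p.2 x == ord0) = (x == first p).
  by rewrite /first (can2_eq (permK _) (permKV _)).
case: (eqVneq x (first p)) => [->|xf].
  rewrite /first permKV /= modn_small ?ltnS // ltnNge jn addn0.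
  by rewrite addn1.
have : p.2 x != ord0 by rewrite (can2_eq (permK _) (permKV _)).
rewrite -val_eqE /= -lt0n; case: (nat_of_ord (p.2 x)) => //= k _.
Qed.

(** Inside the grid, the faces opposite to first and last vertices cancel. On a boundary facet where
    coordinate i is constant, so is label i: for i > 0 its jump vanishes, and for i = 0 it is the
    factor 0 or 1. Only the facet where coordinate 0 is m + 1 survives. *)
Lemma grid_jumps_boundary : grid_jumps m l =
  \sum_(p : P | (p.1 ord0 == ord_max) && (p.2 ord0 == ord0))
     \prod_(i < n) d i.+1 (w p i.+1) (w p i.+2).
Proof.
have l0' (i : 'I_n) (v : {ffun 'I_n.+1 -> nat}) : v (lift ord0 i) = 0%N -> l i.+1 v = 0.
  by move/l0; rewrite lift0.
have l1' (i : 'I_n) (v : {ffun 'I_n.+1 -> nat}) : v (lift ord0 i) = m.+1 -> l i.+1 v = 1.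
  by move/l1; rewrite lift0.
rewrite grid_jumps_faces [X in _ + X](reindex_inj shift_inj) /= -big_split /=.
rewrite [RHS]big_mkcond /=; apply: eq_bigr => p _.
have [pm|pm] := ltnP (p.1 (first p)) m.
  have -> : face (w (shift p)) = face (fun j => w p j.+1).
    rewrite /face !shift_w //; congr (_ * _); apply: eq_bigr => i _.
    by rewrite !shift_w // ltnW.
  rewrite addrr_F2; case: ifP => // /andP[/eqP p0 /eqP r0].
  by move: pm; rewrite /first -r0 permK p0 ltnn.
have {}pm : p.1 (first p) = ord_max.
  by apply/val_inj/anti_leq; rewrite pm -ltnS ltn_ord.
have -> : face (w (shift p)) = 0.
  have z k : (k <= n)%N -> w (shift p) k (first p) = 0%N.
    move=> kn; rewrite !ffunE /= eqxx pm /= modnn permM cycE.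
    by rewrite /first permKV /= ltnNge kn.
  rewrite /face; case: (unliftP ord0 (first p)) => [i fi|fi].
    by rewrite (bigD1 i) //= /d !l0' ?addr0 ?mul0r ?mulr0 // -fi z // ltnW.
  by rewrite (l0 (i := ord0)) ?mul0r // -fi z.
rewrite addr0.
have o k : w p k.+1 (first p) = m.+1.
  by rewrite !ffunE pm /first permKV /= addn1.
have fp : (p.2 ord0 == ord0) = (first p == ord0).
  by rewrite /first -[in RHS](inj_eq (@perm_inj _ p.2)) permKV eq_sym.
rewrite fp; case: (unliftP ord0 (first p)) => [i fi|fi].
  by rewrite fi andbF /face (bigD1 i) //= /d !l1' -?fi // addrr_F2 mul0r mulr0.
by rewrite -fi pm !eqxx /= /face (l1 (i := ord0)) -?fi // mul1r.
Qed.
End Step.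

(** The facet that survives in [grid_jumps_boundary] is a grid of one dimension less, on which the
    labels other than the first satisfy the same boundary conditions. *)
Lemma grid_jumps_one n m (l : nat -> {ffun 'I_n -> nat} -> 'F_2) :
  (forall (i : 'I_n) (v : {ffun 'I_n -> nat}), v i = 0%N -> l i v = 0) ->
  (forall (i : 'I_n) (v : {ffun 'I_n -> nat}), v i = m.+1 -> l i v = 1) ->
  grid_jumps m l = 1.
Proof.
elim: n l => [|n IH] l l0 l1.
  rewrite /grid_jumps (eq_bigr (fun=> 1)) => [|p _]; last by rewrite big_ord0.
  rewrite sumr_const card_prod card_ffun !card_ord.
  have -> : #|{: 'S_0}| = 0`! by rewrite -card_Sn; apply: eq_card.
  by rewrite mulr1n.
rewrite grid_jumps_boundary //.
pose ext T (t : T) (u : {ffun 'I_n -> T}) :=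
  [ffun x : 'I_n.+1 => if unlift ord0 x is Some y then u y else t].
have ext0 T (t : T) u : ext T t u ord0 = t by rewrite ffunE unlift_none.
have extS T (t : T) u i : ext T t u (lift ord0 i) = u i by rewrite ffunE liftK.
rewrite -[RHS](IH (fun i u => l i.+1 (ext _ m.+1 u))); first last.
- by move=> i v vi; rewrite -lift0 l1 // extS.
- by move=> i v vi; rewrite -lift0 l0 // extS.
pose h (p : {ffun 'I_n -> 'I_m.+1} * 'S_n) :=
  (ext _ ord_max p.1, lift_perm ord0 ord0 p.2).
rewrite (reindex h) /=; last first.
  (* Deleting an index and its image from a permutation inverts [lift_perm]. *)
  pose ulsf i (s : 'S_n.+1) k := odflt k (unlift (s i) (s (lift i k))).
  have ulsfK i (s : 'S_n.+1) k : lift (s i) (ulsf i s k) = s (lift i k).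
    rewrite /ulsf; have:= neq_lift i k.
    by rewrite -(can_eq (permK s)) => /unlift_some[] ? ? ->.
  have inj_ulsf : injective (ulsf ord0 _).
    move=> s; apply: can_inj (ulsf (s ord0) s^-1%g) _ => k'.
    by rewrite {1}/ulsf ulsfK !permK liftK.
  exists (fun p : {ffun 'I_n.+1 -> 'I_m.+1} * 'S_n.+1 =>
    ([ffun y : 'I_n => p.1 (lift ord0 y)], perm (inj_ulsf p.2))).
    move=> [v s] _; congr (_, _); first by apply/ffunP => y; rewrite ffunE extS.
    by apply/permP=> k'; rewrite permE /ulsf lift_perm_lift lift_perm_id liftK.
  move=> [v s] /andP[/eqP /= v0 /eqP /= s0]; congr (_, _).
    apply/ffunP => x; case: (unliftP ord0 x) => [y|] ->.
      by rewrite extS ffunE.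
    by rewrite ext0 v0.
  apply/permP=> k; case: (unliftP ord0 k) => [k'|] ->; rewrite ?lift_perm_id //.
  by rewrite lift_perm_lift -[X in lift X _]s0 permE ulsfK.
apply: eq_big => [p|p _]; first by rewrite /h ext0 lift_perm_id !eqxx.
have wE j : simplex_vertex (h p).1 (h p).2 j.+1 =
    ext _ m.+1 (simplex_vertex p.1 p.2 j).
  apply/ffunP => x; rewrite ffunE /h /=; case: (unliftP ord0 x) => [y|] ->.
    by rewrite !extS lift_perm_lift lift0 ltnS ffunE.
  by rewrite !ext0 lift_perm_id addn1.
by apply: eq_bigr => i _; rewrite !wE.
Qed.

(* A discrete form of the Poincare-Miranda theorem. *)
Lemma grid_cell_all_labels n m (l : 'I_n -> {ffun 'I_n -> nat} -> bool) :
  (forall i (v : {ffun 'I_n -> nat}), v i = 0%N -> ~~ l i v) ->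
  (forall i (v : {ffun 'I_n -> nat}), v i = m.+1 -> l i v) ->
  exists v : {ffun 'I_n -> nat},
    (forall x, v x <= m)%N /\ forall i, exists u u' : {ffun 'I_n -> nat},
      [/\ forall x, (v x <= u x <= (v x).+1)%N,
          forall x, (v x <= u' x <= (v x).+1)%N, ~~ l i u & l i u'].
Proof.
move=> l0 l1.
pose L (i : nat) v : 'F_2 := if insub i is Some j then (l j v)%:R else 0.
have LE (i : 'I_n) v : L i v = (l i v)%:R by rewrite /L valK.
have := @grid_jumps_one n m L; rewrite /grid_jumps => H.
case: (pickP (fun p : {ffun 'I_n -> 'I_m.+1} * 'S_n => \prod_(i < n)
    (L i (simplex_vertex p.1 p.2 i.+1) + L i (simplex_vertex p.1 p.2 i)) != 0)).
  move=> [v r] /= /prodf_neq0 nz; exists [ffun x => nat_of_ord (v x)].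
  split=> [x|i]; first by rewrite ffunE -ltnS.
  have sv j x : ([ffun x => nat_of_ord (v x)] x <= simplex_vertex v r j x
      <= ([ffun x => nat_of_ord (v x)] x).+1)%N.
    by rewrite !ffunE leq_addr /=; case: (_ < _)%N; rewrite ?addn0 ?addn1.
  have := nz i isT; rewrite !LE; case E1: (l i _); case E2: (l i _).
  - by rewrite addrr_F2 eqxx.
  - by move=> _; exists (simplex_vertex v r i), (simplex_vertex v r i.+1); split; rewrite ?E2 //; exact: sv.
  - by move=> _; exists (simplex_vertex v r i.+1), (simplex_vertex v r i); split; rewrite ?E1 //; exact: sv.
  - by rewrite addr0 eqxx.
move=> z; have : (1 : 'F_2) = 0.
  rewrite -H => [|i v vi|i v vi]; last 2 first.
  - by rewrite LE (negbTE (l0 _ _ vi)).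
  - by rewrite LE (l1 _ _ vi).
  by apply: big1 => p _; apply/eqP; rewrite -[_ == _]negbK z.
by move/eqP; rewrite oner_eq0.
Qed.

(** * Separation and dimension *)

Lemma mx_entry_le_norm (K : numDomainType) m n (x : 'M[K]_(m, n)) i j :
  `|x i j| <= `|x|.
Proof.
rewrite [leRHS]/Num.norm /= mx_normE.
by rewrite -[leLHS]nngE num_le; exact: (le_bigmax _ _ (i, j)).
Qed.

Lemma mx_norm_lt (K : numDomainType) m n (x : 'M[K]_(m, n)) e :
  0 < e -> (forall i j, `|x i j| < e) -> `|x| < e.
Proof.
move=> e0 xe; rewrite [ltLHS]/Num.norm /= mx_normE.
move: e0 (e0) xe => /ltW/nonnegP[{}e] e0 xe.
rewrite num_lt; apply/bigmax_ltP; split=> [|[i j] _]; first by rewrite -num_lt.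
by rewrite -num_lt /=; exact: xe.
Qed.

Lemma exists_invS_lt (R : realType) (e : R) :
  0 < e -> exists n0, forall n, (n0 <= n)%N -> n.+1%:R^-1 < e.
Proof.
move=> e0; have [n0 _ H] := near_infty_natSinv_lt (PosNum e0).
by exists n0.
Qed.

Section ContinuousOn.
Variables (R : realType) (V : normedModType R).
Implicit Types (A : set V) (f g : V -> R).

Definition continuous_on A f := forall p, A p -> forall e : R, 0 < e ->
  exists2 d : R, 0 < d & forall q, A q -> `|q - p| < d -> `|f q - f p| < e.

Lemma compact_cluster_seq A (u : nat -> V) : compact A -> (forall n, A (u n)) ->
  exists2 p, A p & forall (e : R) n0, 0 < e ->
    exists2 n, (n0 <= n)%N & `|u n - p| < e.
Proof.
move=> cA uA; have [|p [Ap clp]] := cA (u @ \oo) _.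
  by exists 0%N => // n _; exact: uA.
exists p => // e n0 e0; have [|_ [[n n0n <-] /= H]] :=
  clp (u @` [set n | (n0 <= n)%N]) (ball p e) _ (nbhsx_ballx _ _ e0).
  by exists n0 => // n /= n0n; exists n.
by exists n => //; move: H; rewrite -ball_normE /= distrC.
Qed.

Lemma continuous_onB A f g :
  continuous_on A f -> continuous_on A g -> continuous_on A (fun x => f x - g x).
Proof.
move=> cf cg p Ap e e0; have e2 : 0 < e / 2 by rewrite divr_gt0.
have [d d0 Hd] := cf p Ap _ e2; have [d' d'0 Hd'] := cg p Ap _ e2.
exists (Num.min d d') => [|q Aq]; first by rewrite lt_min d0.
rewrite lt_min => /andP[/(Hd _ Aq) H1 /(Hd' _ Aq) H2].
have -> : f q - g q - (f p - g p) = (f q - f p) - (g q - g p) by ring.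
by rewrite (splitr e) (le_lt_trans (ler_normB _ _)) // ltrD.
Qed.

Lemma continuous_on_cst A c : continuous_on A (fun=> c).
Proof. by move=> p _ e e0; exists 1 => // q _ _; rewrite subrr normr0. Qed.

Lemma continuous_on_bounded A f : compact A -> continuous_on A f ->
  exists B : nat, forall p, A p -> `|f p| <= B%:R.
Proof.
move=> cA cf; apply: contrapT => nB.
have /choice[u Hu] : forall n : nat, exists p, A p /\ n%:R < `|f p|.
  move=> n; apply: contrapT => H; apply: nB; exists n => p Ap.
  by rewrite leNgt; apply/negP => ?; apply: H; exists p.
have [p Ap clp] := compact_cluster_seq cA (fun n => (Hu n).1).
have [d d0 Hd] := cf p Ap 1 ltr01.
have [n + /(Hd _ (Hu n).1)] := clp d (Num.truncn (`|f p| + 1)).+1 d0.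
rewrite -(@ler_nat R) => nt; have := truncnS_gt (`|f p| + 1).
have := (Hu n).2; have := ler_normD (f (u n) - f p) (f p); rewrite subrK.
by move: nt; lra.
Qed.
End ContinuousOn.

(** * The Poincare-Miranda theorem on the unit cube *)

Section Cube.
Variables (R : realType).

Definition cube N : set 'rV[R]_N := [set p | forall i, 0 <= p ord0 i <= 1].

Lemma cube_compact N : compact (@cube N).
Proof.
have := @rV_compact R N (fun=> `[0, 1]%classic) (fun=> @segment_compact R 0 1).
suff -> : [set v : 'rV[R]_N | forall i, `[0, 1]%classic (v ord0 i)] = @cube N by [].
by apply/seteqP; split=> p Hp i; have := Hp i; rewrite /= in_itv.
Qed.

(** In the grid of mesh 1 / (m + 1), some cell has, for every i, vertices where [f i] is positive
    and vertices where it is not. A cluster point of these cells is a common zero. *)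
Lemma poincare_miranda N (f : 'I_N -> 'rV[R]_N -> R) :
  (forall i, continuous_on (@cube N) (f i)) ->
  (forall i p, cube p -> p ord0 i = 0 -> f i p < 0) ->
  (forall i p, cube p -> p ord0 i = 1 -> 0 < f i p) ->
  exists2 p, cube p & forall i, f i p = 0.
Proof.
move=> cf f0 f1.
have /choice[u Hu] : forall m : nat, exists p : 'rV[R]_N, cube p /\
    forall i, exists q q' : 'rV[R]_N, [/\ cube q, cube q',
      `|q - p| <= m.+1%:R^-1, `|q' - p| <= m.+1%:R^-1 & f i q <= 0 < f i q'].
  (* The clamping by [minn] keeps [pt v] in the cube for every [v], since the labels must be defined
     outside the grid too. *)
  move=> m; pose pt (v : {ffun 'I_N -> nat}) : 'rV[R]_N :=
    \row_i ((minn (v i) m.+1)%:R / m.+1%:R).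
  have m0 : 0 < m.+1%:R :> R by [].
  have ptc v : cube (pt v).
    move=> i; rewrite mxE divr_ge0 //= ler_pdivrMr // mul1r ler_nat.
    exact: geq_minr.
  have [i v vi|i v vi|v [vm Hv]] :=
      @grid_cell_all_labels N m (fun i v => 0 < f i (pt v)).
  - by rewrite -leNgt ltW // f0 // mxE vi min0n mul0r.
  - by rewrite f1 // mxE vi minnn divff.
  have near_pt (w : {ffun 'I_N -> nat}) :
      (forall x, (v x <= w x <= (v x).+1)%N) -> `|pt w - pt v| <= m.+1%:R^-1.
    move=> vw; rewrite leNgt; apply/negP => H.
    have : `|pt w - pt v| < `|pt w - pt v|; last by rewrite ltxx.
    apply: mx_norm_lt => [|i j]; first by rewrite (le_lt_trans _ H).
    apply: le_lt_trans H; rewrite !mxE -mulrBl normrM normfV normr_nat.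
    rewrite ler_piMl // ?invr_ge0 //.
    have /andP[v1 v2] := vw j; have v3 := vm j.
    rewrite -natrB; last by rewrite leq_min geq_minr (leq_trans (geq_minl _ _)).
    rewrite normr_nat -[1]/(1%:R) ler_nat; lia.
  exists (pt v); split=> // i; have [w [w' [vw vw' nw w'0]]] := Hv i.
  exists (pt w), (pt w'); split=> //; try exact: near_pt.
  by rewrite leNgt nw w'0.
have [p cp clp] := compact_cluster_seq (@cube_compact N) (fun n => (Hu n).1).
exists p => // i; apply: contrapT => /eqP fp.
have [d d0 Hd] := cf i p cp `|f i p| ltac:(by rewrite normr_gt0).
have d2 : 0 < d / 2 by rewrite divr_gt0.
have [n0 Hn0] := exists_invS_lt d2.
have [n /Hn0 nd np] := clp (d / 2) n0 d2.
have [q [q' [cq cq' qp q'p /andP[fq fq']]]] := (Hu n).2 i.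
have close r : `|r - u n| <= n.+1%:R^-1 -> `|r - p| < d.
  move=> rn; rewrite (splitr d) -(subrK (u n) r) -addrA.
  by rewrite (le_lt_trans (ler_normD _ _)) // ltrD // (le_lt_trans rn).
have := Hd q cq (close q qp); have := Hd q' cq' (close q' q'p).
rewrite !ltr_distl; have [fp0|fp0] := ger0P (f i p); lra.
Qed.


(** * Lipschitz coordinates and the counting of cells *)

Section Separation.
Variables (N : nat) (I : finType) (U : I -> 'rV[R]_N.+1 -> R).
Let Q := @cube N.+1.
Hypothesis cU : forall j, continuous_on Q (U j).
Hypothesis injU : forall p q, Q p -> Q q -> (forall j, U j p = U j q) -> p = q.

Let dist p q : R := \sum_j `|U j p - U j q|.

Let dist_ge0 p q : 0 <= dist p q.
Proof. by apply: sumr_ge0. Qed.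

Let dist_trans p q r : dist p r <= dist p q + dist q r.
Proof.
rewrite -big_split /=; apply: ler_sum => j _.
have -> : U j p - U j r = (U j p - U j q) + (U j q - U j r) by ring.
exact: ler_normD.
Qed.

Let distC p q : dist p q = dist q p.
Proof. by apply: eq_bigr => j _; rewrite distrC. Qed.

(** Uniform continuity, for the tolerance 1/4, of the inverse of the injective map [U] on the
    compact cube. *)
Let dist_separates : exists2 d : R, 0 < d & forall p q, Q p -> Q q -> dist p q < d ->
  forall i, `|p ord0 i - q ord0 i| < 1 / 4.
Proof.
apply: contrapT => nd.
have /choice[u Hu] : forall n : nat, exists pq : 'rV[R]_N.+1 * 'rV[R]_N.+1,
    (Q `*` Q) pq /\ (dist pq.1 pq.2 < n.+1%:R^-1 /\ 1 / 4 <= `|pq.1 - pq.2|).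
  move=> n; apply: contrapT => H; apply: nd; exists n.+1%:R^-1 => // p q Qp Qq pq i.
  rewrite ltNge; apply/negP => Hi; apply: H; exists (p, q); split=> //; split=> //=.
  by apply: le_trans Hi _; have := mx_entry_le_norm (p - q) ord0 i; rewrite !mxE.
have [[p q] [/= Qp Qq] clp] := compact_cluster_seq
  (compact_setX (@cube_compact N.+1) (@cube_compact N.+1)) (fun n => (Hu n).1).
have pq : p = q.
  apply: injU => // j; apply/eqP; rewrite -subr_eq0 -normr_le0 leNgt; apply/negP => e0.
  set e := `|_| in e0; have e3 : 0 < e / 3 by rewrite divr_gt0.
  have [d d0 Hd] := cU j Qp e3; have [d' d'0 Hd'] := cU j Qq e3.
  have dm : 0 < Num.min d d' by rewrite lt_min d0.
  have [n0 Hn0] := exists_invS_lt e3; have [n /Hn0 ne unp] := clp _ n0 dm.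
  have [[Q1 Q2] [dn _]] := Hu n.
  have un1 : `|(u n).1 - p| < Num.min d d' by apply: le_lt_trans unp; rewrite [leRHS]/Num.norm /= le_max lexx.
  have un2 : `|(u n).2 - q| < Num.min d d' by apply: le_lt_trans unp; rewrite [leRHS]/Num.norm /= le_max lexx orbT.
  move: un1 un2; rewrite !lt_min => /andP[/(Hd _ Q1) H1 _] /andP[_ /(Hd' _ Q2) H2].
  have H3 : `|U j (u n).1 - U j (u n).2| < e / 3.
    apply: le_lt_trans (lt_trans dn ne).
    by rewrite /dist (bigD1 j) //= lerDl sumr_ge0.
  suff : e < e by rewrite ltxx.
  rewrite {1}/e; have -> : U j p - U j q = (U j (u n).1 - U j (u n).2) -
    (U j (u n).1 - U j p) + (U j (u n).2 - U j q) by ring.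
  rewrite (le_lt_trans (ler_normD _ _)) //.
  have := ler_normB (U j (u n).1 - U j (u n).2) (U j (u n).1 - U j p); lra.
have e8 : 0 < 1 / 8 :> R by rewrite divr_gt0.
have [n _ unp] := clp (1 / 8) 0%N e8; have [_ [_]] := Hu n.
apply/negP; rewrite -ltNge.
have un1 : `|(u n).1 - p| < 1 / 8 by apply: le_lt_trans unp; rewrite [leRHS]/Num.norm /= le_max lexx.
have un2 : `|(u n).2 - q| < 1 / 8 by apply: le_lt_trans unp; rewrite [leRHS]/Num.norm /= le_max lexx orbT.
have -> : (u n).1 - (u n).2 = ((u n).1 - p) - ((u n).2 - q).
  by rewrite pq opprB addrA subrK.
by apply: le_lt_trans (ler_normB _ _) _; lra.
Qed.

(* Inf-convolution replaces the coordinates, viewed as functions of the point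
   [U p], by Lipschitz ones. *)
Let lipschitz_coordinates : exists (L : nat) (G : 'I_N.+1 -> 'rV[R]_N.+1 -> R),
  (forall i p, Q p -> p ord0 i - 1 / 4 <= G i p <= p ord0 i) /\
  (forall i p q, Q p -> Q q -> `|G i p - G i q| <= L%:R * dist p q).
Proof.
have [d d0 Hd] := dist_separates.
(* As L d >= 1, a point q with [dist p q >= d] cannot bring the infimum below 1, hence not below the
   coordinate of p; a nearer point lowers it by at most 1/4. *)
pose L := (Num.truncn d^-1).+1.
have Ld x : d <= x -> 1 <= L%:R * x.
  move=> dx; rewrite -[leLHS](mulVf (lt0r_neq0 d0)).
  by rewrite ler_pM // ?invr_ge0 ?ltW // truncnS_gt.
pose S i p := [set q ord0 i + L%:R * dist p q | q in Q].
have S0 i p : lbound (S i p) 0.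
  move=> _ [q Qq <-]; have /andP[q0 _] := Qq i.
  by rewrite addr_ge0 // mulr_ge0.
have Sp i p q : Q q -> inf (S i p) <= q ord0 i + L%:R * dist p q.
  by move=> Qq; apply: ge_inf; [exists 0; exact: S0|exists q].
have dpp p : dist p p = 0 by apply: big1 => j _; rewrite subrr normr0.
exists L, (fun i p => inf (S i p)); split=> [i p Qp|].
  apply/andP; split; last by rewrite (le_trans (Sp i p p Qp)) // dpp mulr0 addr0.
  apply: lb_le_inf => [|_ [q Qq <-]]; first by exists (p ord0 i + L%:R * dist p p), p.
  have /andP[q0 q1] := Qq i; have /andP[p0 p1] := Qp i.
  have [pq|/Ld pq] := ltP (dist p q) d; last by lra.
  have := Hd p q Qp Qq pq i; rewrite ltr_norml => /andP[_ H].
  by have := mulr_ge0 (ler0n R L) (dist_ge0 p q); lra.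
have H i p q : Q p -> Q q -> inf (S i p) - inf (S i q) <= L%:R * dist p q.
  move=> Qp Qq; rewrite lerBlDl -lerBlDr.
  apply: lb_le_inf => [|_ [r Qr <-]]; first by exists (p ord0 i + L%:R * dist q p), p.
  rewrite lerBlDr (le_trans (Sp i p r Qr)) // -addrA lerD2l -mulrDr addrC.
  by rewrite ler_wpM2l.
by move=> i p q Qp Qq; rewrite ler_norml lerNl opprB H // distC H.
Qed.

Let near_dist p : Q p -> forall e : R, 0 < e ->
  exists2 d : R, 0 < d & forall q, Q q -> `|q - p| < d -> dist q p < e.
Proof.
move=> Qp e e0; pose c : R := #|I|.+1%:R.
have ec : 0 < e / c by rewrite divr_gt0.
have /choice[d Hd] : forall j, exists d : R,
    0 < d /\ forall q, Q q -> `|q - p| < d -> `|U j q - U j p| < e / c.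
  by move=> j; have [d d0 Hd] := cU j Qp ec; exists d.
exists (\big[Num.min/1]_j d j).
  by apply/bigmin_gtP; split=> // j _; have [] := Hd j.
move=> q Qq /bigmin_gtP[_ qp].
apply: (@le_lt_trans _ _ (\sum_(j : I) e / c)).
  by apply: ler_sum => j _; rewrite ltW // (Hd j).2 // qp.
rewrite sumr_const -mulr_natr -mulrA -[ltRHS]mulr1 ltr_pM2l //.
by rewrite mulrC ltr_pdivrMr // mul1r ltr_nat.
Qed.

(** On the zeros of s, the last N functions G take all values in [3/8, 5/8]^N. If [U] sent these
    zeros into a space of dimension #|J| < N, then among sufficiently many prescribed values two
    would come from images in one small cell, against the Lipschitz bound. *)
Lemma cube_separation (s : 'rV[R]_N.+1 -> R) (J : {set I}) :
  (#|J| < N)%N -> continuous_on Q s ->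
  (forall p, Q p -> p ord0 ord0 = 0 -> s p < 0) ->
  (forall p, Q p -> p ord0 ord0 = 1 -> 0 < s p) ->
  ~ (forall p, Q p -> s p = 0 -> forall j, j \notin J -> U j p = 0).
Proof.
move=> JN cs s0 s1 sJ; have [L [G [G1 G2]]] := lipschitz_coordinates.
have cG i : continuous_on Q (G i).
  move=> p Qp e e0; have L0 : 0 < L.+1%:R :> R by [].
  have [d d0 Hd] := near_dist Qp (divr_gt0 e0 L0).
  exists d => // q Qq qp; apply: le_lt_trans (G2 i q p Qq Qp) _.
  have := Hd q Qq qp; rewrite ltr_pdivlMr // mulrC; apply: le_lt_trans.
  by rewrite ler_wpM2r ?dist_ge0 // ler_nat.
(* The interval [3/8, 5/8] lies strictly between the values of G on opposite faces, which are at
   most 0 and at least 3/4. *)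
have hit (c : 'I_N -> R) : (forall i, 3 / 8 <= c i <= 5 / 8) ->
    exists p, [/\ Q p, s p = 0 & forall i, G (lift ord0 i) p = c i].
  move=> c38.
  pose f i p := if unlift ord0 i is Some k then G i p - c k else s p.
  have fl i p : f (lift ord0 i) p = G (lift ord0 i) p - c i by rewrite /f liftK.
  have f0 p : f ord0 p = s p by rewrite /f unlift_none.
  have [i|i p Qp pi|i p Qp pi|p Qp fp] := @poincare_miranda _ f.
  - rewrite /f; case: unliftP => // k _.
    by apply: continuous_onB => //; exact: continuous_on_cst.
  - case: (unliftP ord0 i) pi => [k|] -> pi; last by rewrite f0 s0.
    rewrite fl; have /andP[_] := G1 (lift ord0 k) p Qp.
    by have /andP[c3 _] := c38 k; rewrite pi; lra.
  - case: (unliftP ord0 i) pi => [k|] -> pi; last by rewrite f0 s1.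
    rewrite fl; have /andP[+ _] := G1 (lift ord0 k) p Qp.
    by have /andP[_ c5] := c38 k; rewrite pi; lra.
  exists p; split=> [//||i]; first by rewrite -f0.
  by apply/eqP; rewrite -subr_eq0 -fl fp.
have /choice[b Hb] : forall j, exists B : nat, forall p, Q p -> `|U j p| <= B%:R.
  by move=> j; apply: (continuous_on_bounded (@cube_compact N.+1)).
pose B := (\max_j b j)%N.
have HB j p : Q p -> `|U j p| <= B%:R.
  by move=> Qp; apply: le_trans (Hb j p Qp) _; rewrite ler_nat leq_bigmax.
(* The values [c a] form a grid of spacing 1 / (4 m'). In cells of side 1 / m with m = 8 k m',
   values of G differ by at most L #|I| / m < 1 / (8 m'), so a cell holds at most one of the chosen
   zeros. An axis meets at most K <= C m' cells, hence there are at most C^D m'^D < m'^(D + 1) <=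
   m'^N cells. *)
pose k := (L * #|I|).+1; pose C := (16 * B * k).+1; pose D := #|J|.
pose m' := (C ^ D).+1; pose m := (8 * k * m')%N.
pose c (a : {ffun 'I_N -> 'I_m'}) i : R := 3 / 8 + (a i)%:R / (4 * m')%:R.
have m'0 : 0 < m'%:R :> R by rewrite ltr0n.
have c38 a i : 3 / 8 <= c a i <= 5 / 8.
  rewrite /c lerDl divr_ge0 //=.
  have -> : 5 / 8 = 3 / 8 + 1 / 4 :> R by field.
  rewrite lerD2l ler_pdivrMr ?ltr0n // natrM.
  have : (a i)%:R <= m'%:R :> R by rewrite ler_nat ltnW.
  lra.
have /choice[p Hp] : forall a, exists p,
    [/\ Q p, s p = 0 & forall i, G (lift ord0 i) p = c a i].
  by move=> a; apply: hit => i; exact: c38.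
pose K := (2 * B * m).+1.
pose cell a : {ffun {j | j \in J} -> 'I_K} :=
  [ffun j => inord (Num.truncn ((U (val j) (p a) + B%:R) * m%:R))].
have m0 : 0 < m%:R :> R by rewrite ltr0n !muln_gt0.
have cell_inj : injective cell.
  move=> a a' /ffunP cc; have [Qp sp Gp] := Hp a; have [Qp' sp' Gp'] := Hp a'.
  have Uc j : `|U j (p a) - U j (p a')| <= m%:R^-1.
    have [jJ|jJ] := boolP (j \in J); last first.
      by rewrite (sJ _ Qp) // (sJ _ Qp') // subrr normr0 invr_ge0 ltW.
    have := cc (exist _ j jJ); rewrite !ffunE /= => /(congr1 val) /=.
    have bnd q : Q q -> 0 <= (U j q + B%:R) * m%:R < K%:R.
      have -> : K%:R = 2 * B%:R * m%:R + 1 :> R by rewrite -[K]addn1 !(natrD, natrM).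
      move=> /(HB j); set Br : R := B%:R; rewrite ler_norml => /andP[h1 h2].
      rewrite mulr_ge0 ?(ltW m0) //=; last by lra.
      apply: (@le_lt_trans _ _ (2 * Br * m%:R)); last by rewrite ltrDl.
      by rewrite ler_pM2r //; lra.
    have /andP[x0 xK] := bnd _ Qp; have /andP[y0 yK] := bnd _ Qp'.
    rewrite !inordK ?truncn_lt_nat // => tt.
    have := truncn_itv x0; have := truncn_itv y0; rewrite tt => /andP[y1 y2] /andP[x1 x2].
    rewrite -[leRHS]mul1r ler_pdivlMr // -(ger0_norm (ltW m0)) -normrM.
    have -> : (U j (p a) - U j (p a')) * m%:R =
        (U j (p a) + B%:R) * m%:R - (U j (p a') + B%:R) * m%:R by ring.
    move: x1 x2 y1 y2; rewrite -[_.+1]addn1 natrD ler_norml.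
    by move=> x1 x2 y1 y2; apply/andP; split; lra.
  apply/ffunP => i; apply/val_inj => /=; apply/eqP; rewrite -[_ == _]negbK; apply/negP => ai.
  have := G2 (lift ord0 i) _ _ Qp Qp'; rewrite Gp Gp' /c; apply/negP; rewrite -ltNge.
  apply: (@le_lt_trans _ _ (k%:R / m%:R)).
    rewrite -[k]addn1 natrD mulrDl ler_wpDr ?mul1r ?invr_ge0 //.
    rewrite natrM -mulrA ler_wpM2l //.
    apply: le_trans (ler_sum _ (fun j _ => Uc j)) _.
    by rewrite sumr_const mulr_natl.
  have -> : k%:R / m%:R = (2 * (4 * m')%:R)^-1 :> R.
    rewrite /m !natrM -natrM; field; rewrite -?natrM ?pnatr_eq0 //.
  rewrite opprD addrACA subrr add0r -mulrBl normrM [X in _ < _ * X]ger0_norm ?invr_ge0 //.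
  rewrite invfM ltr_pM2r ?invr_gt0 ?ltr0n //.
  apply: (@lt_le_trans _ _ 1); first by rewrite invf_lt1 ?ltr0n // ltr1n.
  case: (ltngtP (a i) (a' i)) ai => // aa _.
    by rewrite distrC -natrB ?(ltnW aa) // normr_nat ler1n subn_gt0.
  by rewrite -natrB ?(ltnW aa) // normr_nat ler1n subn_gt0.
have := leq_card cell cell_inj; rewrite !card_ffun !card_ord card_sig.
have -> : #|[pred x | x \in J]| = D by apply: eq_card.
apply/negP; rewrite -ltnNge.
apply: (@leq_ltn_trans ((C * m') ^ D)).
  have KC : (K <= C * m')%N by rewrite /K /m /C; nia.
  by case: (D) => // D'; rewrite leq_exp2r.
rewrite expnMn; apply: (@leq_trans (m' ^ D.+1)); last by rewrite leq_pexp2l.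
by rewrite expnS ltn_pmul2r ?expn_gt0.
Qed.
End Separation.

(** A thin box around the segment from a to b, whose end faces are small enough for s to keep its
    sign on them, reduces this to the cube. Convexity keeps the box in [Omega]. *)
Lemma convex_separation N (I : finType) (U : I -> 'rV[R]_N.+1 -> R)
    (Omega : set 'rV[R]_N.+1) (s : 'rV[R]_N.+1 -> R) (J : {set I}) :
  open Omega ->
  (forall a b (t : R), Omega a -> Omega b -> 0 <= t <= 1 -> Omega (a + t *: (b - a))) ->
  (forall j, continuous_on Omega (U j)) -> continuous_on Omega s ->
  (forall p q, Omega p -> Omega q -> (forall j, U j p = U j q) -> p = q) ->
  (#|J| < N)%N ->
  (forall p, Omega p -> s p = 0 -> forall j, j \notin J -> U j p = 0) ->
  forall a b, Omega a -> Omega b -> s a < 0 -> 0 < s b -> False.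
Proof.
move=> oO cvO cU cs injU JN sJ.
have nearby a : Omega a -> s a != 0 -> exists2 e : R, 0 < e &
    forall q, `|q - a| < e -> Omega q /\ `|s q - s a| < `|s a|.
  move=> Oa sa; have [d d0 Hd] := cs a Oa `|s a| ltac:(by rewrite normr_gt0).
  have [e /= e0 He] := (nbhs_ballP _ _).1 (oO a Oa).
  exists (Num.min d e) => [|q]; first by rewrite lt_min d0.
  rewrite lt_min => /andP[qd qe].
  have Oq : Omega q by apply: He; rewrite -ball_normE /= distrC.
  by split=> //; exact: Hd.
(* The box gets no thickness in direction 0, so the segment itself must move in that direction for
   the parametrization to be injective; otherwise b is displaced slightly. *)
suff main a b : Omega a -> Omega b -> s a < 0 -> 0 < s b ->
    a ord0 ord0 != b ord0 ord0 -> False.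
  move=> a b Oa Ob sa sb; have [ab|] := eqVneq (a ord0 ord0) (b ord0 ord0); last exact: main.
  have [e e0 He] := nearby b Ob (lt0r_neq0 sb).
  pose b' := b + (e / 2) *: delta_mx ord0 ord0.
  have [|Ob' sb'] := He b'.
    apply: mx_norm_lt => // i j; rewrite /b' addrC addKr !mxE.
    rewrite normrM ger0_norm; last by rewrite divr_ge0 ?ltW.
    case: (_ && _); rewrite ?normr1 ?normr0 ?mulr0 // mulr1 ltr_pdivrMr //.
    by rewrite ltr_pMr // ltr1n.
  apply: (main a b') => //.
    by move: sb'; rewrite ltr_distl (gtr0_norm sb) subrr => /andP[].
  by rewrite !mxE ab !eqxx mulr1 -subr_eq0 opprD addrA subrr add0r oppr_eq0 mulf_neq0 ?lt0r_neq0.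
move=> Oa Ob sa sb ab.
have [e1 e10 H1] := nearby a Oa (ltr0_neq0 sa).
have [e2 e20 H2] := nearby b Ob (lt0r_neq0 sb).
pose e := Num.min e1 e2; have e0 : 0 < e by rewrite lt_min e10.
pose err (p : 'rV[R]_N.+1) : 'rV[R]_N.+1 :=
  \row_i (if i == ord0 then 0 else e * (p ord0 i - 1 / 2)).
pose T (p : 'rV[R]_N.+1) := a + p ord0 ord0 *: (b - a) + err p.
have err_lt (p : 'rV[R]_N.+1) : cube p -> `|err p| < e.
  move=> cp; apply: mx_norm_lt => // i j; rewrite mxE; case: ifP => _.
    by rewrite normr0.
  rewrite normrM gtr0_norm // -[ltRHS]mulr1 ltr_pM2l // ltr_norml.
  by have /andP[p0 p1] := cp j; apply/andP; split; lra.
have errS c p : `|c + err p - c| = `|err p| by rewrite addrC addKr.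
have Ta (p : 'rV[R]_N.+1) : cube p -> Omega (a + err p) /\ s (a + err p) < 0.
  move=> /err_lt; rewrite -(errS a) lt_min => /andP[/H1[Oq sq] _]; split=> //.
  by move: sq; rewrite ltr_distl (ltr0_norm sa) subrr => /andP[].
have Tb (p : 'rV[R]_N.+1) : cube p -> Omega (b + err p) /\ 0 < s (b + err p).
  move=> /err_lt; rewrite -(errS b) lt_min => /andP[_ /H2[Oq sq]]; split=> //.
  by move: sq; rewrite ltr_distl (gtr0_norm sb) subrr => /andP[].
have TE p : T p = (a + err p) + p ord0 ord0 *: ((b + err p) - (a + err p)).
  by rewrite opprD addrACA subrr addr0 addrAC.
have TO p : cube p -> Omega (T p).
  move=> cp; rewrite TE; apply: cvO; last exact: cp.
  - exact: (Ta p cp).1.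
  - exact: (Tb p cp).1.
have cT f : continuous_on Omega f -> continuous_on (@cube N.+1) (f \o T).
  move=> cf p cp e' e'0; have [d d0 Hd] := cf _ (TO p cp) _ e'0.
  pose M := `|b - a| + e; have M0 : 0 < M by rewrite ltr_wpDl.
  exists (d / M) => [|q cq qp]; first exact: divr_gt0.
  apply: Hd; first exact: TO.
  have -> : T q - T p = (q - p) ord0 ord0 *: (b - a) + (err q - err p).
    by apply/rowP => i; rewrite !mxE; ring.
  apply: le_lt_trans (ler_normD _ _) _.
  have : `|q - p| * M < d by rewrite -ltr_pdivlMr.
  apply: le_lt_trans; rewrite mulrDr lerD //.
    by rewrite normrZ ler_wpM2r // mx_entry_le_norm.
  rewrite leNgt; apply/negP => H.
  suff : `|err q - err p| < `|err q - err p| by rewrite ltxx.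
  apply: mx_norm_lt => [|i j]; first by apply: le_lt_trans H; rewrite mulr_ge0 // ltW.
  apply: le_lt_trans H; rewrite !mxE; case: ifP => _.
    by rewrite subrr normr0 mulr_ge0 // ltW.
  rewrite -mulrBr opprB addrA subrK normrM gtr0_norm // mulrC ler_wpM2r ?(ltW e0) //.
  by have := mx_entry_le_norm (q - p) ord0 j; rewrite !mxE.
have injT p q : T p = T q -> p = q.
  move=> /rowP Tpq.
  have p0 : p ord0 ord0 = q ord0 ord0.
    have := Tpq ord0; rewrite !mxE eqxx !addr0 => /addrI /mulIf; apply.
    by rewrite subr_eq0 eq_sym.
  apply/rowP => i; have := Tpq i; rewrite !mxE p0 => /addrI.
  case: ifP => [/eqP -> //|_] /(mulfI (lt0r_neq0 e0)).
  by move/addIr.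
apply: (@cube_separation N I (fun j => U j \o T) _ _ (s \o T) J) => //=.
- by move=> j; apply: cT.
- by move=> p q cp cq /injU /injT; apply; exact: TO.
- exact: cT.
- by move=> p cp p0; rewrite TE p0 scale0r addr0; exact: (Ta p cp).2.
- move=> p cp p1; rewrite TE p1 scale1r addrC subrK; exact: (Tb p cp).2.
- by move=> p cp; apply: sJ; exact: TO.
Qed.
End Cube.

(** * One complex variable *)

Section ComplexModulus.
Variable R : realType.
Implicit Types z w : R[i].
Local Open Scope complex_scope.

Lemma normcE' z : `|z| = (normc z)%:C.
Proof. by rewrite normc_def; case: z. Qed.

Lemma normc_ge0 z : 0 <= normc z.
Proof. by case: z => a b /=; rewrite sqrtr_ge0. Qed.

Lemma normc_eq0 z : (normc z == 0) = (z == 0).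
Proof. by apply/eqP/eqP => [/eq0_normc//|->]; rewrite normc0. Qed.

Lemma normc_gt0 z : (0 < normc z) = (z != 0).
Proof. by rewrite lt0r normc_eq0 normc_ge0 andbT. Qed.

Lemma Re_le_normc z : `|complex.Re z| <= normc z.
Proof. by case: z => a b /=; rewrite -sqrtr_sqr ler_wsqrtr // lerDl sqr_ge0. Qed.

Lemma Im_le_normc z : `|complex.Im z| <= normc z.
Proof. by case: z => a b /=; rewrite -sqrtr_sqr ler_wsqrtr // lerDr sqr_ge0. Qed.

Lemma normcR (a : R) : normc a%:C = `|a|.
Proof. by rewrite /= expr0n addr0 sqrtr_sqr. Qed.

Lemma normcD z w : normc (z + w) <= normc z + normc w.
Proof. by rewrite -lecR rmorphD /= -!normcE'; exact: ler_normD. Qed.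

Lemma normcN' z : normc (- z) = normc z.
Proof. by case: z => a b /=; rewrite !sqrrN. Qed.

Lemma normcB z w : normc (z - w) <= normc z + normc w.
Proof. by rewrite -(normcN' w); exact: normcD. Qed.

Lemma normc_dist z w : normc (z - w) = normc (w - z).
Proof. by rewrite -normcN' opprB. Qed.

Lemma normci : normc ('i : R[i]) = 1.
Proof. by rewrite /= expr0n expr1n add0r sqrtr1. Qed.

Lemma normc_nat n : normc (n%:R : R[i]) = n%:R.
Proof. by rewrite -(rmorph_nat (real_complex R)) normcR normr_nat. Qed.

Lemma normc_le_ReIm z : normc z <= `|complex.Re z| + `|complex.Im z|.
Proof.
rewrite [in leLHS](complexE z); apply: le_trans (normcD _ _) _.
by rewrite normcM normci mul1r !normcR.
Qed.
End ComplexModulus.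

(** * Goursat's lemma and a weak maximum principle by trapezoid sums *)

Section DiscreteGoursat.
Variable R : realType.
Local Open Scope complex_scope.
Local Notation C := R[i].
Implicit Types (G H F : C -> C) (p v a z : C).

(** The trapezoid mean with 2^n steps. The recursion by halving makes the subdivision of a square an
    exact identity between finite sums ([square_sumS]), which is what Goursat's argument needs from
    an integral. *)
Fixpoint segment_mean n G p v : C :=
  if n is n'.+1 then
    (segment_mean n' G p (v / 2) + segment_mean n' G (p + v / 2) (v / 2)) / 2
  else (G p + G (p + v)) / 2.

(** Serves for upper bounds of the modulus and for lower bounds of an imaginary part, both stable
    under midpoints. *)
Lemma segment_mean_ind (P : C -> Prop) n G p v :
  (forall w w', P w -> P w' -> P ((w + w') / 2)) ->
  (forall s : R, 0 <= s <= 1 -> P (G (p + s%:C * v))) -> P (segment_mean n G p v).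
Proof.
move=> Pmid; elim: n p v => [|n IH] p v PG /=.
  apply: (Pmid); first by have := PG 0; rewrite mul0r addr0; apply; rewrite lexx ler01.
  by have := PG 1; rewrite mul1r; apply; rewrite lexx ler01.
apply: (Pmid); apply: IH => s /andP[s0 s1].
  have -> : p + s%:C * (v / 2) = p + (s / 2)%:C * v.
    by rewrite rmorphM /= fmorphV rmorph_nat; field.
  by apply: PG; apply/andP; split; lra.
have -> : p + v / 2 + s%:C * (v / 2) = p + ((1 + s) / 2)%:C * v.
  by rewrite rmorphM /= fmorphV rmorph_nat rmorphD rmorph1; field.
by apply: PG; apply/andP; split; lra.
Qed.

Lemma segment_mean_affine n (b c p v : C) :
  segment_mean n (fun z => b + c * z) p v = b + c * (p + v / 2).
Proof. by elim: n p v => [|n IH] p v /=; rewrite ?IH; field. Qed.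

Lemma segment_meanD n G H p v :
  segment_mean n (fun z => G z + H z) p v = segment_mean n G p v + segment_mean n H p v.
Proof. by elim: n p v => [|n IH] p v /=; rewrite ?IH; field. Qed.

Lemma segment_meanM n c G p v :
  segment_mean n (fun z => c * G z) p v = c * segment_mean n G p v.
Proof. by elim: n p v => [|n IH] p v /=; rewrite ?IH; field. Qed.

Lemma eq_segment_mean n G H p v : G =1 H -> segment_mean n G p v = segment_mean n H p v.
Proof. by move=> GH; elim: n p v => [|n IH] p v /=; rewrite ?IH ?GH. Qed.

(* Trapezoid rule for the integral of [G] along the boundary of the square with
   corners [a], [a + v], [a + v + 'i v], [a + 'i v], with [2 ^ n] steps per side. *)
Definition square_sum n G a v : C :=
  v * segment_mean n G a v + 'i * v * segment_mean n G (a + v) ('i * v)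
  - v * segment_mean n G (a + 'i * v) v - 'i * v * segment_mean n G a ('i * v).

Lemma square_sumS n G a v : square_sum n.+1 G a v =
  square_sum n G a (v / 2) + square_sum n G (a + v / 2) (v / 2) +
  square_sum n G (a + 'i * (v / 2)) (v / 2) +
  square_sum n G (a + v / 2 + 'i * (v / 2)) (v / 2).
Proof.
rewrite /square_sum /=.
have -> : 'i * v / 2 = 'i * (v / 2) by rewrite mulrA.
have -> : a + v / 2 + v / 2 = a + v by field.
have -> : a + 'i * (v / 2) + 'i * (v / 2) = a + 'i * v by field.
have -> : a + v / 2 + 'i * (v / 2) + v / 2 = a + v + 'i * (v / 2) by field.
have -> : a + v / 2 + 'i * (v / 2) + 'i * (v / 2) = a + 'i * v + v / 2 by field.
have -> : a + 'i * (v / 2) + v / 2 = a + v / 2 + 'i * (v / 2) by ring.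
by field.
Qed.

Lemma square_sumD n G H a v :
  square_sum n (fun z => G z + H z) a v = square_sum n G a v + square_sum n H a v.
Proof. by rewrite /square_sum !segment_meanD; ring. Qed.

Lemma square_sumM n c G a v :
  square_sum n (fun z => c * G z) a v = c * square_sum n G a v.
Proof. by rewrite /square_sum !segment_meanM; ring. Qed.

Lemma eq_square_sum n G H a v : G =1 H -> square_sum n G a v = square_sum n H a v.
Proof. by move=> GH; rewrite /square_sum !(eq_segment_mean _ _ _ GH). Qed.

Lemma square_sum_affine n (b c a v : C) :
  square_sum n (fun z => b + c * z) a v = 0.
Proof. by rewrite /square_sum !segment_mean_affine; field. Qed.

Lemma segment_mean_le n G p v (M : R) :
  (forall s : R, 0 <= s <= 1 -> normc (G (p + s%:C * v)) <= M) ->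
  normc (segment_mean n G p v) <= M.
Proof.
move=> GM; apply: (segment_mean_ind (P := fun w => normc w <= M)) => // w w' wM w'M.
rewrite normcM normcV.
by have := normcD w w'; rewrite normc_nat ler_pdivrMr //; lra.
Qed.

Lemma square_sum_le n G a (l M : R) : 0 <= l ->
  (forall s t : R, 0 <= s <= 1 -> 0 <= t <= 1 ->
     [|| s == 0, s == 1, t == 0 | t == 1] ->
     normc (G (a + (s%:C + 'i * t%:C) * l%:C)) <= M) ->
  normc (square_sum n G a l%:C) <= 4 * l * M.
Proof.
move=> l0 GM.
have I0 : 0 <= (0 : R) <= 1 by rewrite lexx ler01.
have I1 : 0 <= (1 : R) <= 1 by rewrite lexx ler01.
have H1 : normc (segment_mean n G a l%:C) <= M.
  apply: segment_mean_le => s s01; have := GM s 0 s01 I0; rewrite eqxx !orbT.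
  by rewrite rmorph0 mulr0 addr0; apply.
have H2 : normc (segment_mean n G (a + l%:C) ('i * l%:C)) <= M.
  apply: segment_mean_le => s s01; have := GM 1 s I1 s01; rewrite eqxx !orbT.
  rewrite rmorph1; have -> : a + (1 + 'i * s%:C) * l%:C = a + l%:C + s%:C * ('i * l%:C) by ring.
  by apply.
have H3 : normc (segment_mean n G (a + 'i * l%:C) l%:C) <= M.
  apply: segment_mean_le => s s01; have := GM s 1 s01 I1; rewrite eqxx !orbT.
  rewrite rmorph1; have -> : a + (s%:C + 'i * 1) * l%:C = a + 'i * l%:C + s%:C * l%:C by ring.
  by apply.
have H4 : normc (segment_mean n G a ('i * l%:C)) <= M.
  apply: segment_mean_le => s s01; have := GM 0 s I0 s01; rewrite eqxx.
  rewrite rmorph0; have -> : a + (0 + 'i * s%:C) * l%:C = a + s%:C * ('i * l%:C) by ring.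
  by apply.
have sq (x w : C) : normc x = l -> normc w <= M -> normc (x * w) <= l * M.
  by move=> xl wM; rewrite normcM xl ler_wpM2l.
have ll : normc l%:C = l by rewrite normcR ger0_norm.
have il : normc ('i * l%:C) = l by rewrite normcM normci mul1r ll.
have K1 := sq _ _ ll H1; have K2 := sq _ _ il H2.
have K3 := sq _ _ ll H3; have K4 := sq _ _ il H4.
rewrite /square_sum; apply: le_trans (normcB _ _) _.
have := normcB (l%:C * segment_mean n G a l%:C +
  'i * l%:C * segment_mean n G (a + l%:C) ('i * l%:C))
  (l%:C * segment_mean n G (a + 'i * l%:C) l%:C).
have := normcD (l%:C * segment_mean n G a l%:C)
  ('i * l%:C * segment_mean n G (a + l%:C) ('i * l%:C)).
lra.
Qed.

Definition complex_diff G p := exists c : C, forall e : R, 0 < e ->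
  exists2 d : R, 0 < d & forall z, normc (z - p) < d ->
    normc (G z - G p - c * (z - p)) <= e * normc (z - p).

Definition square a (l : R) : set C :=
  [set a + (s%:C + 'i * t%:C) * l%:C | s in `[0, 1] & t in `[0, 1]]%classic.

Lemma nested_halving (x r : nat -> R) :
  (forall n, x n <= x n.+1 <= x n + r n.+1) -> (forall n, r n = 2 * r n.+1) ->
  exists y : R, forall n, x n <= y <= x n + r n.
Proof.
move=> xr r2.
have H n m : x n <= x (n + m)%N <= x n + r n - r (n + m)%N.
  elim: m => [|m /andP[IH1 IH2]]; first by rewrite addn0 addrK lexx.
  rewrite addnS; have /andP[h1 h2] := xr (n + m)%N; have := r2 (n + m)%N.
  by move=> h3; apply/andP; split; lra.
have r0 n : 0 <= r n.
  by have /andP[h1 h2] := xr n; have := r2 n; lra.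
exists (sup (range x)) => n; apply/andP; split.
  apply: ub_le_sup; last by exists n.
  by exists (x 0%N + r 0%N) => _ [m _ <-]; have := H 0%N m; have := r0 m; rewrite add0n; lra.
apply: ge_sup => [|_ [m _ <-]]; first by exists (x 0%N), 0%N.
have [nm|/ltnW mn] := leqP n m.
  by have := H n (m - n)%N; rewrite subnKC //; have := r0 m; lra.
by have := H m (n - m)%N; rewrite subnKC //; have := r0 n; lra.
Qed.

(** If the bound fails for arbitrarily large n, it also fails so on one of the four quarters. The
    nested quarters shrink to a point p; near p, G differs from an affine function, whose sums
    vanish, by too little for the failure to persist. *)
Lemma goursat G a (l : R) : 0 < l -> (forall z, square a l z -> complex_diff G z) ->
  forall e : R, 0 < e -> exists n0, forall n, (n0 <= n)%N ->
    normc (square_sum n G a l%:C) <= e * l ^+ 2.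
Proof.
move=> l0 dG e e0; apply: contrapT => nG.
pose bad a (l : R) := forall n0, exists2 n, (n0 <= n)%N &
  e * l ^+ 2 < normc (square_sum n G a l%:C).
have bad0 : bad a l.
  move=> n0; apply: contrapT => H; apply: nG; exists n0 => n n0n.
  by rewrite leNgt; apply/negP => ?; apply: H; exists n.
have half b (r : R) : 0 < r -> bad b r -> exists s t : bool,
    bad (b + ((s : nat)%:R + 'i * (t : nat)%:R) * (r / 2)%:C) (r / 2).
  move=> r0 br; apply: contrapT => H.
  have good (s t : bool) : exists n0, forall n, (n0 <= n)%N -> normc (square_sum n G
      (b + ((s : nat)%:R + 'i * (t : nat)%:R) * (r / 2)%:C) (r / 2)%:C)
      <= e * (r / 2) ^+ 2.
    apply: contrapT => Hst; apply: H; exists s, t => n0.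
    apply: contrapT => H'; apply: Hst; exists n0 => n n0n.
    by rewrite leNgt; apply/negP => ?; apply: H'; exists n.
  have [n1 H1] := good false false; have [n2 H2] := good true false.
  have [n3 H3] := good false true; have [n4 H4] := good true true.
  (* Passing to quarters lowers the level by one, whence the successor in the threshold. *)
  have [[//|n] nn] := br (n1 + n2 + n3 + n4).+1; apply/negP; rewrite -leNgt.
  move: H1 H2 H3 H4 => /(_ n) H1 /(_ n) H2 /(_ n) H3 /(_ n) H4.
  have {}H1 := H1 ltac:(lia); have {}H2 := H2 ltac:(lia).
  have {}H3 := H3 ltac:(lia); have {}H4 := H4 ltac:(lia).
  have rE : (r / 2)%:C = r%:C / 2 :> C by rewrite rmorphM fmorphV /= rmorph_nat.
  have E1 : b + (0%:R + 'i * 0%:R) * (r / 2)%:C = b by ring.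
  have E2 : b + (1%:R + 'i * 0%:R) * (r / 2)%:C = b + (r / 2)%:C by ring.
  have E3 : b + (0%:R + 'i * 1%:R) * (r / 2)%:C = b + 'i * (r / 2)%:C by ring.
  have E4 : b + (1%:R + 'i * 1%:R) * (r / 2)%:C = b + (r / 2)%:C + 'i * (r / 2)%:C by ring.
  rewrite E1 in H1; rewrite E2 in H2; rewrite E3 in H3; rewrite E4 in H4.
  rewrite square_sumS -rE.
  have K1 := normcD (square_sum n G b (r / 2)%:C + square_sum n G (b + (r / 2)%:C) (r / 2)%:C +
    square_sum n G (b + 'i * (r / 2)%:C) (r / 2)%:C)
    (square_sum n G (b + (r / 2)%:C + 'i * (r / 2)%:C) (r / 2)%:C).
  have K2 := normcD (square_sum n G b (r / 2)%:C + square_sum n G (b + (r / 2)%:C) (r / 2)%:C)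
    (square_sum n G (b + 'i * (r / 2)%:C) (r / 2)%:C).
  have K3 := normcD (square_sum n G b (r / 2)%:C) (square_sum n G (b + (r / 2)%:C) (r / 2)%:C).
  have -> : e * r ^+ 2 = 4 * (e * (r / 2) ^+ 2) by field.
  lra.
pose r n : R := l / 2 ^+ n.
have r0 n : 0 < r n by rewrite divr_gt0 // exprn_gt0.
have r2 n : r n = 2 * r n.+1 by rewrite /r exprS; field.
have rS n : r n.+1 = r n / 2 by rewrite (r2 n); field.
have /choice[f Hf] : forall q : nat * C, exists st : bool * bool, bad q.2 (r q.1) ->
    bad (q.2 + ((st.1 : nat)%:R + 'i * (st.2 : nat)%:R) * (r q.1.+1)%:C) (r q.1.+1).
  move=> [n b] /=; have [/half|nb] := pselect (bad b (r n)); last by exists (true, true).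
  by move=> /(_ (r0 n)) [s [t st]]; exists (s, t); rewrite rS.
pose A := fix A n := if n is n'.+1 then
  A n' + (((f (n', A n')).1 : nat)%:R + 'i * ((f (n', A n')).2 : nat)%:R) * (r n)%:C
  else a.
have badA n : bad (A n) (r n).
  elim: n => [|n IH]; first by rewrite /r expr0 divr1.
  exact: (Hf (n, A n)).
have ReIm (u v w : R) : complex.Re ((u%:C + 'i * v%:C) * w%:C) = u * w /\
    complex.Im ((u%:C + 'i * v%:C) * w%:C) = v * w.
  by rewrite /= !(mul0r, mulr0, mul1r, addr0, subr0, add0r, oppr0).
have bnat (b : bool) : ((b : nat)%:R : C) = (b : nat)%:R%:C by rewrite rmorph_nat.
have [x Hx] : exists x, forall n, complex.Re (A n) <= x <= complex.Re (A n) + r n.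
  apply: nested_halving => // n; rewrite /= raddfD /= -/(A n) !bnat (ReIm _ _ _).1.
  by have := r0 n.+1; case: (f _).1 => /= r1; apply/andP; split; lra.
have [y Hy] : exists y, forall n, complex.Im (A n) <= y <= complex.Im (A n) + r n.
  apply: nested_halving => // n; rewrite /= raddfD /= -/(A n) !bnat (ReIm _ _ _).2.
  by have := r0 n.+1; case: (f _).2 => /= r1; apply/andP; split; lra.
pose p := x +i* y.
have pA n : exists s t : R, [/\ 0 <= s <= 1, 0 <= t <= 1 &
    p = A n + (s%:C + 'i * t%:C) * (r n)%:C].
  exists ((x - complex.Re (A n)) / r n), ((y - complex.Im (A n)) / r n).
  have /andP[x1 x2] := Hx n; have /andP[y1 y2] := Hy n; have rn := r0 n; split.
  - by rewrite divr_ge0 ?subr_ge0 ?(ltW rn) //= ler_pdivrMr // mul1r; lra.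
  - by rewrite divr_ge0 ?subr_ge0 ?(ltW rn) //= ler_pdivrMr // mul1r; lra.
  apply/eqP; rewrite eq_complex !raddfD /= !(mul0r, mulr0, mul1r, addr0, subr0, add0r, oppr0).
  by rewrite !divfK ?lt0r_neq0 // !subrKC !eqxx.
have [|c dc] := dG p.
  have [s [t [s01 t01 ->]]] := pA 0%N; rewrite /r expr0 divr1.
  by exists s; rewrite ?in_itv //=; exists t; rewrite ?in_itv.
have e8 : 0 < e / 8 by rewrite divr_gt0.
have [d d0 Hd] := dc _ e8.
have [n rn] : exists n, 2 * r n < d.
  pose n := Num.truncn (d^-1 * (2 * l)); exists n.
  rewrite /r mulrA ltr_pdivrMr ?exprn_gt0 // -ltr_pdivrMl //.
  apply: lt_le_trans (truncnS_gt _) _.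
  by rewrite -natrX ler_nat ltn_expl.
have [m _] := badA n 0%N; apply/negP; rewrite -leNgt.
have -> : square_sum m G (A n) (r n)%:C =
    square_sum m (fun z => G z - G p - c * (z - p)) (A n) (r n)%:C.
  rewrite -[RHS]add0r -(square_sum_affine m (G p - c * p) c (A n) (r n)%:C).
  by rewrite -square_sumD; apply: eq_square_sum => z; ring.
(* The perimeter is 4 r n and the points of the square are within 2 r n of p, whence the choice of e
   / 8. *)
have -> : e * r n ^+ 2 = 4 * r n * (e / 8 * (2 * r n)) by field.
apply: square_sum_le => [|s t /andP[s0 s1] /andP[t0 t1] _]; first exact: ltW.
set z := A n + (s%:C + 'i * t%:C) * (r n)%:C; suff zp : normc (z - p) <= 2 * r n.
  apply: le_trans (Hd z _) _; first exact: le_lt_trans rn.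
  by rewrite ler_wpM2l ?(ltW e8).
have [s' [t' [/andP[s'0 s'1] /andP[t'0 t'1] ->]]] := pA n.
have -> : z - (A n + (s'%:C + 'i * t'%:C) * (r n)%:C) =
    ((s - s')%:C + 'i * (t - t')%:C) * (r n)%:C by rewrite /z !rmorphB /=; ring.
rewrite normcM normcR gtr0_norm // ler_wpM2r ?(ltW (r0 n)) //.
apply: le_trans (normcD _ _) _; rewrite normcM normci mul1r !normcR.
have : `|s - s'| <= 1 by rewrite ler_norml; apply/andP; split; lra.
have : `|t - t'| <= 1 by rewrite ler_norml; apply/andP; split; lra.
lra.
Qed.

(* Goursat's lemma applied to [(F z - F 0) ^ 2 / z], which is differentiable at
   0, avoids the removable singularity of [(F z - F 0) / z]. *)
Lemma weak_maximum_principle F (M : R) :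
  complex_diff F 0 ->
  (forall z, square (- 1 - 'i) 2 z -> z != 0 ->
     complex_diff (fun z => (F z - F 0) ^+ 2 / z) z) ->
  (forall s t : R, 0 <= s <= 1 -> 0 <= t <= 1 ->
     [|| s == 0, s == 1, t == 0 | t == 1] ->
     normc (F (- 1 - 'i + (s%:C + 'i * t%:C) * 2%:C)) <= M) ->
  normc (F 0) <= 5 * M.
Proof.
move=> [c dF0] dF FM; set F0 := F 0.
pose G z := (F z - F0) ^+ 2 / z.
(* The default value of the division by 0 is the right one: (F z - F 0)^2 / z tends to 0 at 0. *)
have G0 : G 0 = 0 by rewrite /G invr0 mulr0.
have dG z : square (- 1 - 'i) 2 z -> complex_diff G z.
  have [->|] := eqVneq z 0; last by move=> z0 sz; exact: dF.
  move=> _; exists (c ^+ 2) => e e0.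
  pose k := 2 * normc c + 1; have k0 : 0 < k by rewrite ltr_wpDl // mulr_ge0 ?normc_ge0.
  pose e' := Num.min (e / k) 1.
  have e'0 : 0 < e' by rewrite lt_min divr_gt0 ?ltr01.
  have [d d0 Hd] := dF0 e' e'0; exists d => // w.
  move=> /Hd; rewrite !subr0 => wH.
  have [->|w0] := eqVneq w 0; first by rewrite G0 mulr0 !subr0 normc0 mulr0.
  have -> : G w - G 0 - c ^+ 2 * w = (F w - F0 - c * w) * ((F w - F0 - c * w) + 2 * c * w) / w.
    by rewrite G0 subr0 /G; field.
  set u := F w - F0 - c * w; rewrite -/F0 -/u in wH.
  have w0' : 0 < normc w by rewrite normc_gt0.
  rewrite normcM normcV ler_pdivrMr // normcM.
  have u2 : normc (u + 2 * c * w) <= k * normc w.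
    apply: le_trans (normcD _ _) _; rewrite !normcM normc_nat.
    have : e' * normc w <= 1 * normc w by rewrite ler_wpM2r ?normc_ge0 // ge_min lexx orbT.
    by rewrite /k; lra.
  apply: le_trans (ler_pM (normc_ge0 _) (normc_ge0 _) wH u2) _.
  have : e' * (k * normc w ^+ 2) <= e / k * (k * normc w ^+ 2).
    by rewrite ler_wpM2r ?ge_min ?lexx // mulr_ge0 ?(ltW k0) ?sqr_ge0.
  have -> : e / k * (k * normc w ^+ 2) = e * normc w * normc w by field; exact: lt0r_neq0.
  by apply: le_trans; rewrite le_eqVlt; apply/orP; left; apply/eqP; ring.
have M0 : 0 <= M.
  by apply: le_trans (FM 0 0 _ _ _); rewrite ?normc_ge0 ?eqxx ?lexx ?ler01.
(* If X > 5 M, expanding the square in G bounds 4 X^2 by X^2 / 25 + 8 M^2 + 16 X M, which is at most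
   (1/25 + 8/25 + 16/5) X^2 < 4 X^2. *)
rewrite leNgt; apply/negP => FM5; set X := normc F0 in FM5.
have X0 : 0 < X by apply: le_lt_trans FM5; rewrite mulr_ge0.
have e0 : 0 < X ^+ 2 / 100 by rewrite divr_gt0 ?exprn_gt0.
have l0 : 0 < 2 :> R by [].
have [n /(_ n (leqnn n)) Sn] := goursat l0 dG e0.
pose S H := square_sum n H (- 1 - 'i) 2%:C.
have SG : S G = S (fun z => F z ^+ 2 / z) - 2 * F0 * S (fun z => F z / z)
    + F0 ^+ 2 * S (fun z => z^-1).
  rewrite -mulNr /S -!square_sumM -!square_sumD; apply: eq_square_sum => z.
  by rewrite /G; ring.
have zE (s t : R) : - 1 - 'i + (s%:C + 'i * t%:C) * 2%:C = (2 * s - 1) +i* (2 * t - 1) :> C.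
  apply/eqP; rewrite eq_complex /= !(mul0r, mulr0, mul1r, addr0, subr0, add0r, oppr0).
  by apply/andP; split; apply/eqP; ring.
have z1 (s t : R) : [|| s == 0, s == 1, t == 0 | t == 1] ->
    normc (- 1 - 'i + (s%:C + 'i * t%:C) * 2%:C)^-1 <= 1.
  rewrite zE normcV => H; rewrite invf_le1.
    case/or4P: H => /eqP ->.
    - by apply: le_trans (Re_le_normc _); rewrite /= mulr0 sub0r normrN normr1.
    - by apply: le_trans (Re_le_normc _); rewrite /= ler_normr; apply/orP; left; lra.
    - by apply: le_trans (Im_le_normc _); rewrite /= mulr0 sub0r normrN normr1.
    - by apply: le_trans (Im_le_normc _); rewrite /= ler_normr; apply/orP; left; lra.
  rewrite normc_gt0 eq_complex /=; apply/negP => /andP[/eqP h1 /eqP h2].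
  by case/or4P: H => /eqP st; move: h1 h2; rewrite st; lra.
have S1 : normc (S (fun z => F z ^+ 2 / z)) <= 4 * 2 * M ^+ 2.
  apply: square_sum_le => // s t s01 t01 st; rewrite normcM -[leRHS]mulr1.
  rewrite ler_pM ?normc_ge0 //; last exact: z1.
  by rewrite normcM -expr2 lerXn2r ?nnegrE ?normc_ge0 // FM.
have S2 : normc (S (fun z => F z / z)) <= 4 * 2 * M.
  apply: square_sum_le => // s t s01 t01 st; rewrite normcM -[leRHS]mulr1.
  by rewrite ler_pM ?normc_ge0 ?FM //; exact: z1.
(* The sums approximate 2 pi i. On each of the four sides the integrand has imaginary part 2 / ((2 s
   - 1)^2 + 1) >= 1, so the bound 4 is valid at every level. *)
have S3 : 4 <= normc (S (fun z => z^-1)).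
  apply: le_trans (Im_le_normc _); rewrite ler_normr; apply/orP; left.
  have side (k p v : C) : (forall s : R, 0 <= s <= 1 ->
      1 <= complex.Im (k * (p + s%:C * v)^-1)) ->
      1 <= complex.Im (k * segment_mean n (fun z => z^-1) p v).
    move=> H; apply: (segment_mean_ind (P := fun w => 1 <= complex.Im (k * w))) => // w w'.
    have -> : k * ((w + w') / 2) = (k * w + k * w') * (2^-1)%:C.
      by rewrite fmorphV /= rmorph_nat; field.
    have ImM (u : C) (r : R) : complex.Im (u * r%:C) = complex.Im u * r.
      by case: u => x y /=; ring.
    by rewrite ImM raddfD /=; lra.
  have inv (x y : R) : (x +i* y)^-1 =
      (x / (x ^+ 2 + y ^+ 2)) +i* (- (y / (x ^+ 2 + y ^+ 2))) :> C by [].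
  have q (s : R) : 0 <= s <= 1 -> 1 <= 2 / ((2 * s - 1) ^+ 2 + 1).
    move=> /andP[s0 s1]; have x0 : 0 <= (2 * s - 1) ^+ 2 by exact: sqr_ge0.
    rewrite ler_pdivlMr; last by lra.
    by have := mulr_ge0 s0 (_ : 0 <= 1 - s); rewrite expr2; nra.
  have K1 := side 2%:C (- 1 - 'i) 2%:C.
  have K2 := side ('i * 2%:C) (- 1 - 'i + 2%:C) ('i * 2%:C).
  have K3 := side (- 2%:C) (- 1 - 'i + 'i * 2%:C) 2%:C.
  have K4 := side (- ('i * 2%:C)) (- 1 - 'i) ('i * 2%:C).
  have -> : S (fun z => z^-1) =
      2%:C * segment_mean n (fun z => z^-1) (- 1 - 'i) 2%:C +
      'i * 2%:C * segment_mean n (fun z => z^-1) (- 1 - 'i + 2%:C) ('i * 2%:C) +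
      - 2%:C * segment_mean n (fun z => z^-1) (- 1 - 'i + 'i * 2%:C) 2%:C +
      - ('i * 2%:C) * segment_mean n (fun z => z^-1) (- 1 - 'i) ('i * 2%:C).
    by rewrite /S /square_sum; ring.
  rewrite !(raddfD (@complex.Im R : Rcomplex R -> R)).
  have {}K1 := K1 _; have {}K2 := K2 _; have {}K3 := K3 _; have {}K4 := K4 _.
  suff H : forall s : R, 0 <= s <= 1 ->
      [/\ complex.Im (2%:C * (- 1 - 'i + s%:C * 2%:C)^-1) = 2 / ((2 * s - 1) ^+ 2 + 1),
          complex.Im ('i * 2%:C * (- 1 - 'i + 2%:C + s%:C * ('i * 2%:C))^-1) = 2 / ((2 * s - 1) ^+ 2 + 1),
          complex.Im (- 2%:C * (- 1 - 'i + 'i * 2%:C + s%:C * 2%:C)^-1) = 2 / ((2 * s - 1) ^+ 2 + 1) &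
          complex.Im (- ('i * 2%:C) * (- 1 - 'i + s%:C * ('i * 2%:C))^-1) = 2 / ((2 * s - 1) ^+ 2 + 1)].
    have {}K1 := K1 (fun s s01 => ltac:(by have [-> _ _ _] := H s s01; exact: q)).
    have {}K2 := K2 (fun s s01 => ltac:(by have [_ -> _ _] := H s s01; exact: q)).
    have {}K3 := K3 (fun s s01 => ltac:(by have [_ _ -> _] := H s s01; exact: q)).
    have {}K4 := K4 (fun s s01 => ltac:(by have [_ _ _ ->] := H s s01; exact: q)).
    lra.
  move=> s s01; have nz : (2 * s - 1) ^+ 2 + 1 != 0 by rewrite lt0r_neq0 // ltr_wpDl ?sqr_ge0.
  have E1 : - 1 - 'i + s%:C * 2%:C = (2 * s - 1) +i* (- 1) :> C.
    apply/eqP; rewrite eq_complex /= !(mul0r, mulr0, mul1r, addr0, subr0, add0r, oppr0).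
    by apply/andP; split; apply/eqP; ring.
  have E2 : - 1 - 'i + 2%:C + s%:C * ('i * 2%:C) = 1 +i* (2 * s - 1) :> C.
    apply/eqP; rewrite eq_complex /= !(mul0r, mulr0, mul1r, addr0, subr0, add0r, oppr0).
    by apply/andP; split; apply/eqP; ring.
  have E3 : - 1 - 'i + 'i * 2%:C + s%:C * 2%:C = (2 * s - 1) +i* 1 :> C.
    apply/eqP; rewrite eq_complex /= !(mul0r, mulr0, mul1r, addr0, subr0, add0r, oppr0).
    by apply/andP; split; apply/eqP; ring.
  have E4 : - 1 - 'i + s%:C * ('i * 2%:C) = (- 1) +i* (2 * s - 1) :> C.
    apply/eqP; rewrite eq_complex /= !(mul0r, mulr0, mul1r, addr0, subr0, add0r, oppr0).
    by apply/andP; split; apply/eqP; ring.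
  rewrite E1 E2 E3 E4 !inv /= sqrrN !expr1n [1 + _]addrC; set D := _ + 1 in nz *.
  by split; field.
have T1 := normcB (S (fun z => F z ^+ 2 / z)) (2 * F0 * S (fun z => F z / z)).
have T2 : normc (F0 ^+ 2 * S (fun z => z^-1)) <= normc (S G) +
   (normc (S (fun z => F z ^+ 2 / z)) + normc (2 * F0 * S (fun z => F z / z))).
  have -> : F0 ^+ 2 * S (fun z => z^-1) = S G -
    (S (fun z => F z ^+ 2 / z) - 2 * F0 * S (fun z => F z / z)) by rewrite SG; ring.
  by apply: le_trans (normcB _ _) _; rewrite lerD2l.
rewrite normcM (normcM F0 F0) -/X in T2; rewrite !normcM normc_nat -/X in T2.
have T3 : 4 * X ^+ 2 <= X * X * normc (S (fun z => z^-1)).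
  by rewrite mulrC -expr2 ler_wpM2l // sqr_ge0.
have T4 : 2 * X * normc (S (fun z => F z / z)) <= 2 * X * (4 * 2 * M).
  by rewrite ler_wpM2l // mulr_ge0 // ltW.
have T5 : M ^+ 2 <= X ^+ 2 / 25.
  by rewrite ler_pdivlMr // -[25]/(25%:R) (_ : 25%:R = 5 ^+ 2) -?exprMn ?lerXn2r ?nnegrE ?mulr_ge0 ?(ltW X0) //; lra.
have T6 : X * M <= X * (X / 5) by rewrite ler_wpM2l ?(ltW X0) //; lra.
move: Sn; rewrite -/(S G) => Sn.
have X2 : 0 < X ^+ 2 by rewrite exprn_gt0.
suff : (0 : R) < 0 by rewrite ltxx.
by rewrite !expr2 in Sn T2 T3 T4 T5 T6 X2 S1 *; nra.
Qed.
End DiscreteGoursat.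

(** * Neighbourhoods in complex spaces through real radii *)

Section ComplexTopology.
Variable R : realType.
Local Open Scope complex_scope.
Local Notation K := (Cplx R).

Lemma norm_lt_normc (z : K) (d : R) : (`|z| < (d%:C : K)) = (normc (z : R[i]) < d).
Proof. by rewrite -ltcR -normcE'. Qed.

Lemma pos_complex (e : K) : 0 < e -> exists2 d : R, 0 < d & e = d%:C.
Proof.
case: e => a b; rewrite ltcE /= => /andP[/eqP -> a0]; exists a => //.
Qed.

Lemma nearC_P (p : K) (P : set K) : (\forall z \near p, P z) <->
  exists2 d : R, 0 < d & forall z : K, normc (z - p : R[i]) < d -> P z.
Proof.
split=> [/nbhs_ballP[e /= /pos_complex[d d0 ->] He]|[d d0 Hd]].
  by exists d => // z zp; apply: He; rewrite -ball_normE /= distrC norm_lt_normc.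
apply/nbhs_ballP; exists (d%:C : K) => [/=|z]; first by rewrite ltcR.
by rewrite -ball_normE /= distrC norm_lt_normc; exact: Hd.
Qed.

Lemma near_rV_P n (v : 'rV[K]_n) (P : set 'rV[K]_n) : (\forall u \near v, P u) <->
  exists2 d : R, 0 < d & forall u : 'rV[K]_n,
    (forall i, normc (u ord0 i - v ord0 i : R[i]) < d) -> P u.
Proof.
split=> [/nbhs_ballP[e /= /pos_complex[d d0 ->] He]|[d d0 Hd]].
  exists d => // u uv; apply: He; rewrite -ball_normE /= distrC.
  apply: mx_norm_lt => [|i j]; first by rewrite ltcR.
  by rewrite !mxE ord1 norm_lt_normc.
apply/nbhs_ballP; exists (d%:C : K) => [/=|u]; first by rewrite ltcR.
rewrite -ball_normE /= distrC => uv; apply: Hd => i; rewrite -norm_lt_normc.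
by apply: le_lt_trans uv; have := mx_entry_le_norm (u - v) ord0 i; rewrite !mxE.
Qed.

Lemma cvg_rV_P n (v : 'rV[K]_n) (f : 'rV[K]_n -> K) : {for v, continuous f} ->
  forall e : R, 0 < e -> exists2 d : R, 0 < d & forall u : 'rV[K]_n,
    (forall i, normc (u ord0 i - v ord0 i : R[i]) < d) ->
    normc (f u - f v : R[i]) < e.
Proof.
move=> cf e e0; apply/(near_rV_P v (fun u => normc (f u - f v : R[i]) < e)).
by apply: (cf [set z | normc (z - f v : R[i]) < e]); apply/nearC_P; exists e.
Qed.

Lemma derivable_complex_diff (f : K -> K) (p : K) : derivable f p 1 ->
  complex_diff (f : R[i] -> R[i]) p.
Proof.
move=> /cvg_ex[/= c fc]; exists c => e e0.
have /nearC_P[d d0 Hd] : \forall h \near (0 : K), h != 0 ->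
    normc (h^-1 *: ((f \o shift p) (h *: (1 : K)) - f p) - c : R[i]) < e.
  have : nbhs (nbhs (c : K)) (fun z : K => normc (z - c : R[i]) < e).
    by apply/nearC_P; exists e.
  by move/fc.
exists d => // z zp; have [->|z0] := eqVneq z p.
  by rewrite !subrr mulr0 subrr normc0 mulr0.
have zp0 : (z - p : K) != 0 by rewrite subr_eq0.
have := Hd (z - p); rewrite subr0 => /(_ zp zp0) /ltW.
rewrite /= [(z - p) *: _]mulr1 subrK => H.
have -> : f z - f p - c * (z - p) = ((z - p)^-1 *: (f z - f p) - c) * (z - p) :> R[i].
  by rewrite mulrBl; congr (_ - _); rewrite mulrAC mulVf // mul1r.
by rewrite normcM ler_wpM2r // normc_ge0.
Qed.
End ComplexTopology.

Section DifferentiableFunctions.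
Variables (K : numFieldType) (V : normedModType K).
Implicit Types f g : V -> K.

Lemma differentiable_add f g x : differentiable f x -> differentiable g x ->
  differentiable (fun v => f v + g v) x.
Proof. exact: differentiableD. Qed.

Lemma differentiable_mul f g x : differentiable f x -> differentiable g x ->
  differentiable (fun v => f v * g v) x.
Proof. exact: differentiableM. Qed.

Lemma differentiable_exp f n x : differentiable f x ->
  differentiable (fun v => f v ^+ n) x.
Proof.
move=> df; elim: n => [|n IH]; first exact: differentiable_cst.
by under eq_fun do rewrite exprS; exact: differentiable_mul.
Qed.
End DifferentiableFunctions.

Lemma normc_inv_le (R : realType) (a b : R[i]) (m : nat) : 0 < normc b / 2 ->
  normc (a - b) < normc b / 2 -> ((Num.truncn (normc b / 2)^-1).+1 <= m)%N ->
  normc a^-1 <= m%:R.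
Proof.
move=> b0 ab bm; have ba : normc b / 2 < normc a.
  have := normcB a (a - b); have -> : a - (a - b) = b by ring.
  lra.
apply: (@le_trans _ _ (normc b / 2)^-1).
  by rewrite normcV lef_pV2 ?posrE ?(lt_trans b0 ba) //; exact: ltW.
by apply: le_trans (ltW (truncnS_gt _)) _; rewrite ler_nat.
Qed.

(** * Zeros on a complex plane are not isolated *)

Section IsolatedZero.
Variables (R : realType) (n : nat).
Local Open Scope complex_scope.
Local Notation K := (Cplx R).
Variables (g : 'rV[K]_n -> K) (e1 e2 : 'rV[K]_n).
Hypothesis e1_le : forall i, normc (e1 ord0 i : R[i]) <= 1.
Hypothesis e2_le : forall i, normc (e2 ord0 i : R[i]) <= 1.
Let P (u v : K) : 'rV[K]_n := u *: e1 + v *: e2.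
Variable d0 : R.
Hypothesis d0_gt0 : 0 < d0.
Hypothesis dg : forall v : 'rV[K]_n, (forall i, normc (v ord0 i : R[i]) < d0) -> differentiable g v.
Hypothesis g_neq0 : forall u v : K, normc (u : R[i]) < d0 -> normc (v : R[i]) < d0 ->
  (u != 0) || (v != 0) -> g (P u v) != 0.

Let d04 : d0 / 4 < d0. Proof. by have := d0_gt0; lra. Qed.
Let d034 : d0 / 4 + d0 / 2 < d0. Proof. by have := d0_gt0; lra. Qed.
Let r := d0 / 8.
Let r0 : 0 < r. Proof. by rewrite divr_gt0. Qed.
Let zeta (s t : R) : R[i] := - 1 - 'i + (s%:C + 'i * t%:C) * 2%:C.

Let zetaE s t : zeta s t = (2 * s - 1) +i* (2 * t - 1).
Proof.
apply/eqP; rewrite eq_complex /= !(mul0r, mulr0, mul1r, addr0, subr0, add0r, oppr0).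
by apply/andP; split; apply/eqP; ring.
Qed.

Let zeta_le s t : 0 <= s <= 1 -> 0 <= t <= 1 -> normc (zeta s t) <= 2.
Proof.
move=> /andP[s0 s1] /andP[t0 t1]; rewrite zetaE.
apply: le_trans (normc_le_ReIm _) _ => /=.
have : `|2 * s - 1| <= 1 by rewrite ler_norml; apply/andP; split; lra.
have : `|2 * t - 1| <= 1 by rewrite ler_norml; apply/andP; split; lra.
lra.
Qed.

Let P_dist (u v u' v' : K) i : normc (P u v ord0 i - P u' v' ord0 i : R[i]) <=
  normc (u - u' : R[i]) + normc (v - v' : R[i]).
Proof.
rewrite !mxE.
have -> : u * e1 ord0 i + v * e2 ord0 i - (u' * e1 ord0 i + v' * e2 ord0 i) =
  (u - u') * e1 ord0 i + (v - v') * e2 ord0 i :> R[i] by ring.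
apply: le_trans (normcD _ _) _; rewrite !normcM lerD //.
  by rewrite ler_piMr ?normc_ge0.
by rewrite ler_piMr ?normc_ge0.
Qed.

Let P_small (u v : K) i : normc (P u v ord0 i : R[i]) <= normc (u : R[i]) + normc (v : R[i]).
Proof.
have := P_dist u v 0 0 i; rewrite !subr0.
have -> : P 0 0 ord0 i = 0 by rewrite /P !scale0r addr0 mxE.
by rewrite subr0.
Qed.

Let rz_le (s t : R) : 0 <= s <= 1 -> 0 <= t <= 1 ->
  normc (r%:C * zeta s t) <= d0 / 4.
Proof.
move=> s01 t01; rewrite normcM normcR gtr0_norm //.
have -> : d0 / 4 = r * 2 by rewrite /r; field.
by rewrite ler_wpM2l ?zeta_le // ltW.
Qed.

(** For h = 0 the boundary of the square avoids the origin, so g has no zero on it. By compactness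
    this persists, with a uniform bound for 1 / g, when h is small. *)
Let g_lower_bound : exists2 M : R, 0 <= M & exists2 d : R, 0 < d &
  forall h : R, 0 < h < d -> forall s t : R, 0 <= s <= 1 -> 0 <= t <= 1 ->
    [|| s == 0, s == 1, t == 0 | t == 1] ->
    normc ((g (P (r%:C * zeta s t) h%:C))^-1 : R[i]) <= M.
Proof.
apply: contrapT => nM.
have /choice[u Hu] : forall m : nat, exists q : 'rV[R]_2 * R, cube q.1 /\
    [/\ [|| q.1 ord0 ord0 == 0, q.1 ord0 ord0 == 1, q.1 ord0 ord_max == 0
       | q.1 ord0 ord_max == 1], 0 < q.2 < m.+1%:R^-1 &
     m%:R < normc ((g (P (r%:C * zeta (q.1 ord0 ord0) (q.1 ord0 ord_max)) q.2%:C))^-1 : R[i])].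
  move=> m; apply: contrapT => H; apply: nM; exists m%:R => //.
  exists m.+1%:R^-1 => // h h0 s t s01 t01 st; rewrite leNgt; apply/negP => gm.
  apply: H; exists (\row_i (if i == ord0 then s else t), h).
  rewrite /= !mxE /=; split=> // i; rewrite mxE.
  by case: ifP.
have [p cp clp] := compact_cluster_seq (@cube_compact R 2) (fun m => (Hu m).1).
set s := p ord0 ord0 in clp; set t := p ord0 ord_max in clp.
have z0 : zeta s t != 0.
  rewrite zetaE eq_complex /=; apply/negP => /andP[/eqP s1 /eqP t1].
  have half : 0 < 1 / 2 :> R by rewrite divr_gt0.
  have [m _ um] := clp _ 0%N half; have [_ [st _ _]] := Hu m.
  have us := le_lt_trans (mx_entry_le_norm ((u m).1 - p) ord0 ord0) um.
  have ut := le_lt_trans (mx_entry_le_norm ((u m).1 - p) ord0 ord_max) um.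
  move: us ut st; rewrite !mxE -/s -/t !ltr_norml => /andP[a1 a2] /andP[b1 b2].
  by case/or4P => /eqP h; rewrite h in a1 a2 b1 b2; lra.
have s01 := cp ord0; have t01 := cp ord_max; rewrite -/s -/t in s01 t01.
have rz := rz_le s01 t01.
pose v := P (r%:C * zeta s t) 0.
have gv : g v != 0.
  apply: g_neq0; rewrite ?normc0 //; first by exact: le_lt_trans rz d04.
  by rewrite mulf_neq0 // fmorph_eq0 lt0r_neq0.
have cg : {for v, continuous g}.
  apply: differentiable_continuous; apply: dg => i.
  by apply: le_lt_trans (P_small _ _ i) _; rewrite normc0 addr0; exact: le_lt_trans rz d04.
have e0 : 0 < normc (g v : R[i]) / 2 by rewrite divr_gt0 // normc_gt0.
have [d dp Hd] := cvg_rV_P cg e0.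
have d2 : 0 < d / 2 by rewrite divr_gt0.
have dr : 0 < d / (8 * r) by rewrite divr_gt0 // mulr_gt0.
have [n1 Hn1] := exists_invS_lt d2.
pose n2 := (Num.truncn (normc (g v : R[i]) / 2)^-1).+1.
have [m mn um] := clp _ (n1 + n2)%N dr; have [c [st /andP[h0 h1] gm]] := Hu m.
set s' := (u m).1 ord0 ord0 in st gm; set t' := (u m).1 ord0 ord_max in st gm.
set h := (u m).2 in h0 h1 gm.
have us := le_lt_trans (mx_entry_le_norm ((u m).1 - p) ord0 ord0) um.
have ut := le_lt_trans (mx_entry_le_norm ((u m).1 - p) ord0 ord_max) um.
rewrite !mxE -/s -/t -/s' -/t' in us ut.
have hd : h < d / 2 by apply: lt_trans h1 (Hn1 m _); apply: leq_trans mn; exact: leq_addr.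
have close : normc (g (P (r%:C * zeta s' t') h%:C) - g v : R[i]) < normc (g v : R[i]) / 2.
  apply: Hd => i; apply: le_lt_trans (P_dist _ _ _ _ i) _.
  rewrite subr0 -mulrBr normcM !normcR !gtr0_norm //.
  have zz : normc (zeta s' t' - zeta s t) <= 2 * (`|s' - s| + `|t' - t|).
    have -> : zeta s' t' - zeta s t = ((s' - s)%:C + 'i * (t' - t)%:C) * 2%:C.
      by rewrite /zeta !rmorphB /=; ring.
    rewrite normcM normcR ger0_norm // mulrC ler_wpM2l //.
    by apply: le_trans (normcD _ _) _; rewrite normcM normci mul1r !normcR.
  have : r * normc (zeta s' t' - zeta s t) <= r * (2 * (`|s' - s| + `|t' - t|)).
    by rewrite ler_wpM2l // ltW.
  have : r * `|s' - s| < d / 8.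
    by move: us; rewrite ltr_pdivlMr ?mulr_gt0 //; lra.
  have : r * `|t' - t| < d / 8.
    by move: ut; rewrite ltr_pdivlMr ?mulr_gt0 //; lra.
  by rewrite mulrDr; lra.
have nm : ((Num.truncn (normc (g v : R[i]) / 2)^-1).+1 <= m)%N.
  by apply: leq_trans mn; exact: leq_addl.
have := normc_inv_le e0 close nm; apply/negP; rewrite -ltNge; exact: gm.
Qed.

(* On the lines [v = h], the functions [1 / g] would be bounded on a square, uniformly in [h],
   by their values on its boundary. *)
Lemma no_isolated_zero : g 0 != 0.
Proof.
apply/negP => /eqP g0; have [M M0 [d dp HM]] := g_lower_bound.
have cg : {for 0, continuous g}.
  by apply: differentiable_continuous; apply: dg => i; rewrite mxE normc0.
have M5 : 0 < (5 * M + 1)^-1 by rewrite invr_gt0 ltr_wpDl // mulr_ge0.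
have [d' d'p Hd'] := cvg_rV_P cg M5.
pose h := Num.min (Num.min d d') d0 / 2.
have min0 : 0 < Num.min (Num.min d d') d0 by rewrite !lt_min dp d'p d0_gt0.
have h0 : 0 < h by rewrite divr_gt0.
have [hd hd' hd0] : [/\ h < d, h < d' & h < d0].
  have : h < Num.min (Num.min d d') d0 by rewrite ltr_pdivrMr // ltr_pMr // ltr1n.
  by rewrite !lt_min => /andP[/andP[]].
have nh : normc (h%:C) = h by rewrite normcR gtr0_norm.
have h0' : (h%:C : K) != 0 by rewrite fmorph_eq0 lt0r_neq0.
pose F (z : K) : K := (g (P (r%:C * z) h%:C))^-1.
have hd4 : h <= d0 / 2 by rewrite ler_pM2r ?invr_gt0 // ge_min lexx orbT.
have dF (z : K) : square (- 1 - 'i) 2 (z : R[i]) -> differentiable F z.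
  move=> [s /=]; rewrite in_itv /= => s01 [t]; rewrite /= in_itv /= => t01 <-.
  have rz := rz_le s01 t01; rewrite -/(zeta s t).
  apply: differentiableV; last first.
    apply: g_neq0; rewrite ?nh ?h0' ?orbT //; exact: le_lt_trans rz d04.
  apply: differentiable_comp.
    apply: differentiableD; last exact: differentiable_cst.
    apply: differentiableZl; apply: differentiable_mul; first exact: differentiable_cst.
    exact/derivable1_diffP/derivable_id.
  apply: dg => i; apply: le_lt_trans (P_small _ _ i) _; rewrite nh.
  by exact: le_lt_trans (lerD rz hd4) d034.
have s0 : square (- 1 - 'i) 2 (0 : R[i]).
  exists (1 / 2); first by rewrite /= in_itv /=; apply/andP; split; lra.
  exists (1 / 2); first by rewrite /= in_itv /=; apply/andP; split; lra.
  rewrite -/(zeta _ _) zetaE; apply/eqP; rewrite eq_complex /=.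
  by apply/andP; split; apply/eqP; field.
have F5 : normc (F 0 : R[i]) <= 5 * M.
  apply: weak_maximum_principle.
  - by apply: derivable_complex_diff; apply/derivable1_diffP; exact: dF.
  - move=> z sz z0; apply: (@derivable_complex_diff R (fun z : K => (F z - F 0) ^+ 2 / z)).
    apply/derivable1_diffP; apply: differentiable_mul.
      apply: differentiable_exp; apply: differentiableB; last exact: differentiable_cst.
      exact: dF.
    by apply: differentiableV => //; exact/derivable1_diffP/derivable_id.
  - by move=> s t s01 t01 st; apply: HM => //; rewrite h0.
have gh : normc (g (P 0 h%:C) : R[i]) < (5 * M + 1)^-1.
  have := Hd' (P 0 h%:C); rewrite g0 subr0; apply=> i.
  by rewrite [X in _ - X]mxE subr0; apply: le_lt_trans (P_small _ _ i) _; rewrite normc0 add0r nh.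
have gnz : g (P 0 h%:C) != 0 by apply: g_neq0; rewrite ?normc0 ?nh ?h0' ?orbT.
move: F5; rewrite /F mulr0 normcV; apply/negP; rewrite -ltNge.
apply: (@lt_trans _ _ (5 * M + 1)); first by rewrite ltrDl.
rewrite -[ltLHS]invrK ltf_pV2 // ?posrE ?normc_gt0 //.
Qed.
End IsolatedZero.

(** * The family *)

Definition cx : 'I_6 := @Ordinal 6 0 isT.
Definition cw : 'I_6 := @Ordinal 6 1 isT.
Definition cy : 'I_6 := @Ordinal 6 2 isT.
Definition cz : 'I_6 := @Ordinal 6 3 isT.
Definition cz2 : 'I_6 := @Ordinal 6 4 isT.
Definition cz3 : 'I_6 := @Ordinal 6 5 isT.

Definition family (R : realType) (t : Cplx R) (v : Cn R 6) : Cplx R :=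
  v ord0 cy ^+ 2 * v ord0 cz + v ord0 cx ^+ 3 * v ord0 cz2
  + v ord0 cw ^+ 3 * v ord0 cz3 + t * (v ord0 cy * v ord0 cx * v ord0 cw).

Section FamilyHolomorphic.
Variable R : realType.
Local Notation K := (Cplx R).

Lemma family_holomorphic (q : K * Cn R 6) :
  differentiable (fun q : K * Cn R 6 => family q.1 q.2) q.
Proof.
have d1 : differentiable (fun q : K * Cn R 6 => q.1) q.
  by apply: (@linear_differentiable _ _ _ fst) => x; exact: cvg_fst.
have d2 i : differentiable (fun q : K * Cn R 6 => q.2 ord0 i) q.
  apply: (@differentiable_comp _ _ _ _ (fun q : K * Cn R 6 => q.2) (fun v => v ord0 i)).
    by apply: (@linear_differentiable _ _ _ snd) => x; exact: cvg_snd.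
  exact: differentiable_coord.
exact: (differentiable_add (differentiable_add (differentiable_add
  (differentiable_mul (differentiable_exp 2 (d2 cy)) (d2 cz))
  (differentiable_mul (differentiable_exp 3 (d2 cx)) (d2 cz2)))
  (differentiable_mul (differentiable_exp 3 (d2 cw)) (d2 cz3)))
  (differentiable_mul d1 (differentiable_mul (differentiable_mul (d2 cy) (d2 cx)) (d2 cw)))).
Qed.

Lemma family_differentiable t (v : Cn R 6) : differentiable (family t) v.
Proof.
have d2 i : differentiable (fun v : Cn R 6 => v ord0 i) v.
  exact: differentiable_coord.
have d1 : differentiable (fun=> t) v by exact: differentiable_cst.
exact: (differentiable_add (differentiable_add (differentiable_add
  (differentiable_mul (differentiable_exp 2 (d2 cy)) (d2 cz))
  (differentiable_mul (differentiable_exp 3 (d2 cx)) (d2 cz2)))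
  (differentiable_mul (differentiable_exp 3 (d2 cw)) (d2 cz3)))
  (differentiable_mul d1 (differentiable_mul (differentiable_mul (d2 cy) (d2 cx)) (d2 cw)))).
Qed.

(** All directional derivatives of g^2 h vanish at a zero of g. The last hypothesis says that the
    family is affine of slope c in the direction e, as it is in z and in z2. *)
Lemma derive_family_square_divisor t (g h : Cn R 6 -> K) (v e : Cn R 6) (c : K) :
  (\forall u \near v, family t u = g u ^+ 2 * h u) ->
  differentiable g v -> differentiable h v -> g v = 0 ->
  (forall s : K, family t (s *: e + v) = family t v + s * c) -> c = 0.
Proof.
move=> fgh dg dh gv fc.
have -> : c = 'D_e (family t) v.
  apply/esym/lim_near_cst; first exact: norm_hausdorff.
  near=> s; have s0 : s != 0 by near: s; exact: nbhs_dnbhs_neq.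
  by rewrite /= fc addrAC subrr add0r /GRing.scale /= mulrA mulVf // mul1r.
rewrite (near_eq_derive (g := (g * g * h : Cn R 6 -> K))); last first.
  by near=> u; rewrite (near fgh u) // expr2.
have dgd : derivable g v e by exact: diff_derivable.
have dhd : derivable h v e by exact: diff_derivable.
rewrite (deriveM (derivableM dgd dgd) dhd) (deriveM dgd dgd).
have gg : (g * g) v = 0 by exact: (etrans (congr2 *%R gv gv) (mul0r _)).
rewrite gg gv; move: ('D_e h v) ('D_e g v) => a b.
rewrite !scale0r.
rewrite add0r.
rewrite addr0.
exact: scaler0.
Unshelve. all: by end_near. Qed.

Lemma family_reduced t : reduced_germ (@family R t).
Proof.
split; first by near=> z; exact: family_differentiable.
- by rewrite /family !mxE !expr0n /= !mul0r !mulr0 !addr0.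
- move=> /near_rV_P[d d0 Hd].
  pose s : K := (d / 2)%:C%C.
  (* At this point only y^2 z survives, whatever t is. *)
  pose u : Cn R 6 := s *: (delta_mx ord0 cy + delta_mx ord0 cz).
  have small i : normc (u ord0 i - (0 : Cn R 6) ord0 i : R[i]) < d.
    rewrite !mxE subr0 normcM normcR gtr0_norm ?divr_gt0 //.
    apply: (@le_lt_trans _ _ (d / 2 * 1)); last by rewrite mulr1 ltr_pdivrMr // ltr_pMr // ltr1n.
    rewrite ler_wpM2l //; first by rewrite divr_ge0 // ltW.
    rewrite eqxx /=.
    have -> : ((i == cy)%:R + (i == cz)%:R : R[i]) = ((i == cy) + (i == cz))%:R.
      by rewrite natrD.
    by rewrite normc_nat lern1; case: i => -[|[|[|[|[|[|]]]]]].
  have := Hd u small; rewrite /family !mxE /= !mulr0n !mulr1n.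
  rewrite !(addr0, add0r, mulr0, mulr1, mul0r, expr0n) /= => /eqP.
  by rewrite mulf_eq0 expf_eq0 /= orbb fmorph_eq0 gt_eqF // divr_gt0.
move=> g h [gh gnz gnu girr] hh fgh.
have g0 : g 0 = 0.
  apply/eqP; apply: contrapT => /negP g0; apply: gnu.
  have gn0 : \forall z \near (0 : Cn R 6), g z != 0.
    have cg : {for 0, continuous g} by apply: differentiable_continuous; exact: nbhs_singleton gh.
    apply: (cg [set z | z != 0]); apply/nearC_P.
    exists (normc (g 0 : R[i])); first by rewrite normc_gt0.
    by move=> z; apply: contraTneq => ->; rewrite sub0r normcN' ltxx.
  exists (fun z => (g z)^-1).
    near=> z; apply: differentiableV; first exact: (near gh z).
    exact: (near gn0 z).
  by near=> z; rewrite mulfV //; exact: (near gn0 z).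
(* The factorization is needed on a neighbourhood of each v near 0, to be differentiated at v. *)
have /near_rV_P[d d0 Hd] : \forall v \near (0 : Cn R 6), [/\ differentiable g v, differentiable h v &
    \forall u \near v, family t u = g u ^+ 2 * h u].
  near=> v; split; first exact: (near gh v).
    exact: (near hh v).
  by apply: (near (near_join fgh) v).
have key (v : Cn R 6) : (forall i, normc (v ord0 i - (0 : Cn R 6) ord0 i : R[i]) < d) -> g v = 0 ->
    v ord0 cx = 0 /\ v ord0 cy = 0.
  move=> /Hd[dg dh fv] gv; split; apply/eqP.
    suff : v ord0 cx ^+ 3 == 0 by rewrite expf_eq0.
    apply/eqP.
    apply: (derive_family_square_divisor (e := delta_mx ord0 cz2) fv) => // s.
    by rewrite /family !mxE /= !mulr0n mulr1n; ring.
  suff : v ord0 cy ^+ 2 == 0 by rewrite expf_eq0.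
  apply/eqP.
  apply: (derive_family_square_divisor (e := delta_mx ord0 cz) fv) => // s.
  by rewrite /family !mxE /= !mulr0n mulr1n; ring.
have de (j : 'I_6) (i : 'I_6) : normc ((delta_mx ord0 j : Cn R 6) ord0 i : R[i]) <= 1.
  by rewrite mxE normc_nat lern1 leq_b1.
have sub0 (v : Cn R 6) i : v ord0 i - (0 : Cn R 6) ord0 i = v ord0 i.
  by rewrite [X in _ - X]mxE subr0.
move/eqP: g0; apply/negP.
apply: (@no_isolated_zero R 6 g (delta_mx ord0 cx) (delta_mx ord0 cy) (de cx) (de cy) d d0).
  by move=> v vd; have [|//] := Hd v => i; rewrite sub0.
move=> a b ad bd ab; apply/negP => /eqP gP; have [i|] := key _ _ gP.
  rewrite sub0 !mxE eqxx /=; case: eqP => [->|_] /=; first by rewrite mulr1 mulr0 addr0.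
  by rewrite mulr0 add0r; case: eqP; rewrite /= ?mulr1 // mulr0 normc0.
by rewrite !mxE /= !mulr0 !mulr1 addr0 add0r => a0 b0; move: ab; rewrite a0 b0 eqxx.
Unshelve. all: by end_near. Qed.
End FamilyHolomorphic.

(** * Topological triviality *)

Lemma ord6_ind (P : 'I_6 -> Prop) :
  P cx -> P cw -> P cy -> P cz -> P cz2 -> P cz3 -> forall i, P i.
Proof.
move=> P0 P1 P2 P3 P4 P5 [[|[|[|[|[|[|//]]]]]] i].
- by rewrite (_ : Ordinal i = cx) //; apply/val_inj.
- by rewrite (_ : Ordinal i = cw) //; apply/val_inj.
- by rewrite (_ : Ordinal i = cy) //; apply/val_inj.
- by rewrite (_ : Ordinal i = cz) //; apply/val_inj.
- by rewrite (_ : Ordinal i = cz2) //; apply/val_inj.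
- by rewrite (_ : Ordinal i = cz3) //; apply/val_inj.
Qed.

Lemma continuous_inv (K : numFieldType) (T : topologicalType) (f : T -> K) x :
  f x != 0 -> {for x, continuous f} -> {for x, continuous (fun u => (f u)^-1)}.
Proof. by move=> fx cf; apply: cvgV. Qed.

Section Trivialization.
Variable R : realType.
Local Open Scope complex_scope.
Local Notation K := (Cplx R).
Local Notation V := (Cn R 6).

Lemma continuous_rV n (T : topologicalType) (f : T -> 'rV[K]_n) (x : T) :
  (forall i, {for x, continuous (fun v => f v ord0 i)}) -> {for x, continuous f}.
Proof.
move=> cf A /near_rV_P[d d0 Hd].
have near_i i : \forall v \near x, normc (f v ord0 i - f x ord0 i : R[i]) < d.
  by apply: (cf i [set z | normc (z - f x ord0 i : R[i]) < d]); apply/nearC_P; exists d.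
have : \forall v \near x, forall i, normc (f v ord0 i - f x ord0 i : R[i]) < d.
  by apply: filter_forall.
by apply: filterS => v; exact: Hd.
Qed.

Lemma mul_conjc (z : R[i]) : z * z^* = (normc z ^+ 2)%:C.
Proof.
case: z => a b /=; rewrite sqr_sqrtr ?addr_ge0 ?sqr_ge0 //; simpc.
by apply/eqP; rewrite eq_complex /=; apply/andP; split; apply/eqP; ring.
Qed.

Lemma normc_conjc (z : R[i]) : normc z^* = normc z.
Proof. by case: z => a b /=; rewrite sqrrN. Qed.

Lemma conjc_continuous : continuous (fun z : K => (z : R[i])^* : K).
Proof.
move=> z A /nearC_P[d d0 Hd]; apply/nearC_P; exists d => // u uz; apply: Hd.
by rewrite -rmorphB normc_conjc.
Qed.

Lemma normcX (z : R[i]) n : normc (z ^+ n) = normc z ^+ n.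
Proof. by elim: n => [|n IH]; rewrite ?expr0 ?normc1 // !exprS normcM IH. Qed.

Definition slope (v : V) (k : 'I_3) : K :=
  nth (0 : K) [:: v ord0 cy ^+ 2; v ord0 cx ^+ 3; v ord0 cw ^+ 3] k.

Definition slope_norm (v : V) : K := \sum_k slope v k * ((slope v k : R[i])^* : K).

Definition monomial_xyw (v : V) : K := v ord0 cy * v ord0 cx * v ord0 cw.

(** The solution c of least norm of the equation sum_k s_k c_k = x y w. Where the slopes all vanish,
    the default value of the quotient is 0, which is also its limit. *)
Definition shear_coef (v : V) (k : 'I_3) : K :=
  monomial_xyw v * ((slope v k : R[i])^* : K) / slope_norm v.

Lemma slope_normE v : slope_norm v = (\sum_k normc (slope v k) ^+ 2)%:C.
Proof. by rewrite rmorph_sum; apply: eq_bigr => k _; rewrite mul_conjc. Qed.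

Lemma slope_norm_eq0 v : (slope_norm v == 0) = [forall k, slope v k == 0].
Proof.
rewrite slope_normE fmorph_eq0 psumr_eq0; last by move=> k _; rewrite sqr_ge0.
apply/idP/idP => [/allP H|/forallP H].
  by apply/forallP => k; have := H k (mem_index_enum k); rewrite sqrf_eq0 normc_eq0.
by apply/allP => k _; rewrite (eqP (H k)) normc0 expr0n /= eqxx.
Qed.

Lemma slope_norm0 v : slope_norm v = 0 ->
  [/\ v ord0 cx = 0, v ord0 cw = 0 & v ord0 cy = 0].
Proof.
move/eqP; rewrite slope_norm_eq0 => /forallP H; split; apply/eqP.
- by have := H (@Ordinal 3 1 isT); rewrite /slope /= expf_eq0.
- by have := H (@Ordinal 3 2 isT); rewrite /slope /= expf_eq0.
- by have := H (@Ordinal 3 0 isT); rewrite /slope /= expf_eq0.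
Qed.

Lemma sum_slope_shear v : \sum_k slope v k * shear_coef v k = monomial_xyw v.
Proof.
have -> : \sum_k slope v k * shear_coef v k = monomial_xyw v * (slope_norm v / slope_norm v).
  rewrite mulrA mulr_sumr mulr_suml; apply: eq_bigr => k _.
  by rewrite /shear_coef; ring.
have [S0|S0] := eqVneq (slope_norm v) 0; last by rewrite divff // mulr1.
by have [x0 w0 y0] := slope_norm0 S0; rewrite /monomial_xyw x0 mulr0 !mul0r.
Qed.

(* [(X * W * Y) ^ 6 <= m ^ 7]: the shear coefficients tend to 0 at the points
   where they are not given by a quotient with nonzero denominator. *)
Lemma shear_bound (X W Y B S m e : R) : 0 <= X -> 0 <= W -> 0 <= Y -> 0 <= B ->
  0 < e -> Y ^+ 2 <= m -> X ^+ 3 <= m -> W ^+ 3 <= m -> B <= m -> m ^+ 2 <= S ->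
  m < e ^+ 6 -> Y * X * W * B / S < e.
Proof.
move=> X0 W0 Y0 B0 e0 Ym Xm Wm Bm mS me.
have m0 : 0 <= m by apply: le_trans Bm.
have [mz|mp] := eqVneq m 0.
  have -> : B = 0 by apply/eqP; rewrite eq_le B0 -mz Bm.
  by rewrite mulr0 mul0r.
have {mp}mp : 0 < m by rewrite lt0r mp.
have S0 : 0 < S by apply: lt_le_trans mS; rewrite exprn_gt0.
have P0 : 0 <= Y * X * W by rewrite !mulr_ge0.
have key : Y * X * W < e * m.
  rewrite ltNge; apply/negP => H.
  have : (e * m) ^+ 6 <= m ^+ 7.
    apply: le_trans (_ : (Y * X * W) ^+ 6 <= _).
      by rewrite lerXn2r // nnegrE // mulr_ge0 // ltW.
    have -> : (Y * X * W) ^+ 6 = (Y ^+ 2) ^+ 3 * (X ^+ 3) ^+ 2 * (W ^+ 3) ^+ 2 by ring.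
    have -> : m ^+ 7 = m ^+ 3 * m ^+ 2 * m ^+ 2 by ring.
    by rewrite !ler_pM ?mulr_ge0 ?exprn_ge0 // lerXn2r ?nnegrE ?exprn_ge0.
  have -> : m ^+ 7 = m * m ^+ 6 by ring.
  by rewrite exprMn ler_pM2r ?exprn_gt0 // leNgt me.
rewrite ltr_pdivrMr //; apply: (@le_lt_trans _ _ (Y * X * W * m)).
  by rewrite ler_wpM2l.
apply: (@lt_le_trans _ _ (e * m * m)); first by rewrite ltr_pM2r.
by rewrite -mulrA ler_pM2l // -expr2.
Qed.

Lemma shear_coef_small (v : V) k (e : R) : 0 < e <= 1 ->
  normc (v ord0 cx : R[i]) < e ^+ 6 -> normc (v ord0 cw : R[i]) < e ^+ 6 ->
  normc (v ord0 cy : R[i]) < e ^+ 6 -> normc (shear_coef v k) < e.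
Proof.
move=> /andP[e0 e1]; set X := normc _; set W := normc _; set Y := normc _ => Xe We Ye.
have X0 : 0 <= X by exact: normc_ge0.
have W0 : 0 <= W by exact: normc_ge0.
have Y0 : 0 <= Y by exact: normc_ge0.
have e6 : e ^+ 6 <= 1 by rewrite exprn_ile1 // ltW.
pose m := Num.max (Y ^+ 2) (Num.max (X ^+ 3) (W ^+ 3)).
have m0 : 0 <= m by rewrite le_max sqr_ge0.
have bk j : normc (slope v j) <= m.
  case: j => -[|[|[|//]]] j; rewrite /slope /= normcX !le_max ?lexx ?orbT //.
rewrite /shear_coef slope_normE -fmorphV normcM normcR normcM normc_conjc.
rewrite /monomial_xyw !normcM -/X -/W -/Y ger0_norm; last first.
  by rewrite invr_ge0; apply: sumr_ge0 => j _; rewrite sqr_ge0.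
apply: (@shear_bound _ _ _ _ _ m) => //; rewrite ?normc_ge0 ?le_max ?lexx ?orbT //.
- have sm j : normc (slope v j) ^+ 2 <= \sum_k normc (slope v k) ^+ 2.
    by rewrite (bigD1 j) //= lerDl sumr_ge0 // => i _; rewrite sqr_ge0.
  have := sm (@Ordinal 3 0 isT); have := sm (@Ordinal 3 1 isT); have := sm (@Ordinal 3 2 isT).
  rewrite /slope /= !normcX -/X -/W -/Y => s1 s2 s3.
  rewrite /m; case: (leP (X ^+ 3) (W ^+ 3)) => _.
    by case: (leP (Y ^+ 2) (W ^+ 3)).
  by case: (leP (Y ^+ 2) (X ^+ 3)).
have pw (x : R) j : 0 <= x -> x < e ^+ 6 -> x ^+ j.+1 < e ^+ 6.
  move=> x0 xe; apply: (le_lt_trans _ xe).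
  by rewrite exprS ler_piMr // exprn_ile1 // (le_trans (ltW xe)).
by rewrite !gt_max !pw.
Qed.

Lemma shear_coef_continuous k : continuous (fun v : V => shear_coef v k : K).
Proof.
move=> v.
have co i : {for v, continuous (fun v : V => v ord0 i)} by exact: coord_continuous.
have cs j : {for v, continuous (fun u : V => slope u j : K)}.
  case: j => -[|[|[|//]]] j; rewrite /slope /=; apply: differentiable_continuous;
    apply: differentiable_exp; exact: differentiable_coord.
have cc j : {for v, continuous (fun u : V => (slope u j : R[i])^* : K)}.
  by apply: continuous_comp; [exact: cs|exact: conjc_continuous].
have cN : {for v, continuous (fun u : V => slope_norm u : K)}.
  have -> : (fun u : V => slope_norm u) = (fun u : V =>
      slope u ord0 * ((slope u ord0 : R[i])^* : K) +
      (slope u (lift ord0 ord0) * ((slope u (lift ord0 ord0) : R[i])^* : K) +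
       slope u (lift ord0 (lift ord0 ord0)) *
         ((slope u (lift ord0 (lift ord0 ord0)) : R[i])^* : K))).
    by apply/funext => u; rewrite /slope_norm !big_ord_recl big_ord0 addr0.
  have cM j : {for v, continuous (fun u : V => slope u j * ((slope u j : R[i])^* : K))}.
    by apply: continuousM; [exact: cs|exact: cc].
  apply: continuousD; first exact: cM.
  by apply: continuousD; exact: cM.
have [S0|S0] := eqVneq (slope_norm v) 0; last first.
  have cm : {for v, continuous monomial_xyw}.
    apply: continuousM; last exact: co.
    by apply: continuousM; exact: co.
  have ci : {for v, continuous (fun u : V => (slope_norm u)^-1)}.
    exact: (continuous_inv S0 cN).
  have cmc : {for v, continuous (fun u : V => monomial_xyw u * ((slope u k : R[i])^* : K))}.
    by apply: continuousM; [exact: cm|exact: cc].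
  exact: (continuousM cmc ci).
have [x0 w0 y0] := slope_norm0 S0.
move=> A /nearC_P[d d0 Hd]; apply/near_rV_P.
pose e := Num.min d 1; have e0 : 0 < e by rewrite lt_min d0 ltr01.
exists (e ^+ 6) => [|u uv]; first by rewrite exprn_gt0.
apply: Hd; have -> : shear_coef v k = 0 by rewrite /shear_coef S0 invr0 mulr0.
rewrite subr0; apply: (@lt_le_trans _ _ e); last by rewrite ge_min lexx.
apply: shear_coef_small; first by rewrite e0 ge_min lexx orbT.
- by have := uv cx; rewrite x0 subr0.
- by have := uv cw; rewrite w0 subr0.
- by have := uv cy; rewrite y0 subr0.
Qed.

Definition shear (s : K) (v : V) : V := v + \row_(i < 6)
  nth (0 : K) [:: 0; 0; 0; s * shear_coef v (@Ordinal 3 0 isT);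
    s * shear_coef v (@Ordinal 3 1 isT); s * shear_coef v (@Ordinal 3 2 isT)] i.

(** The coefficients involve only x, w and y, which the shear fixes; hence the shears of parameters
    s and - s are inverse to each other. *)
Lemma shear_coef_shear s v k : shear_coef (shear s v) k = shear_coef v k.
Proof.
by rewrite /shear_coef /slope_norm /monomial_xyw /slope /shear !mxE /= !addr0.
Qed.

Lemma shearK s : cancel (shear s) (shear (- s)).
Proof.
move=> v; apply/rowP => i; rewrite /shear mxE [in X in _ + X]mxE -/(shear s v).
rewrite !shear_coef_shear !mxE -addrA -[RHS]addr0; congr (_ + _).
by case: i => -[|[|[|[|[|[|]]]]]] //= ?; rewrite ?addr0 // mulNr subrr.
Qed.

Lemma shear_continuous s : continuous (shear s).
Proof.
move=> v; apply: continuous_rV => i.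
pose c (u : V) : K := nth (0 : K) [:: 0; 0; 0; s * shear_coef u (@Ordinal 3 0 isT);
  s * shear_coef u (@Ordinal 3 1 isT); s * shear_coef u (@Ordinal 3 2 isT)] i.
have E : (fun u : V => shear s u ord0 i) = (fun u : V => u ord0 i + c u).
  by apply/funext => u; rewrite !mxE.
apply: (eq_ind_r (fun F => {for v, continuous F}) _ E).
apply: continuousD; first exact: coord_continuous.
have sk k : {for v, continuous (fun u : V => s * shear_coef u k)}.
  have c0 : {for v, continuous (fun=> s)} by exact: (@cst_continuous V K s v).
  exact: (continuousM c0 (@shear_coef_continuous k v)).
have c0 : {for v, continuous (fun=> 0 : K)} by exact: (@cst_continuous V K 0 v).
rewrite /c {c E}; move: i; apply: ord6_ind.
- exact: c0.
- exact: c0.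
- exact: c0.
- exact: (sk (@Ordinal 3 0 isT)).
- exact: (sk (@Ordinal 3 1 isT)).
- exact: (sk (@Ordinal 3 2 isT)).
Qed.

Lemma family_shear t (v : V) : family t v = family 0 (shear t v).
Proof.
have := sum_slope_shear v; rewrite !big_ord_recl big_ord0 addr0.
have -> : lift ord0 ord0 = @Ordinal 3 1 isT by apply/val_inj.
have -> : lift ord0 (lift ord0 ord0) = @Ordinal 3 2 isT by apply/val_inj.
have -> : ord0 = @Ordinal 3 0 isT by apply/val_inj.
rewrite /family /shear !mxE /= !addr0 mul0r addr0.
move: (shear_coef v _) (shear_coef v _) (shear_coef v _) => a b c.
rewrite /slope /= /monomial_xyw => <-.
by ring.
Qed.

Lemma family_equisingular t : exists2 phi : V -> V,
  homeo_germ phi & germ_eq (@family R t) (@family R 0 \o phi).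
Proof.
exists (shear t); last by near=> v; exact: family_shear.
split.
  apply/rowP => i; rewrite /shear add0r !mxE /shear_coef /monomial_xyw !mxE !mul0r.
  by rewrite mulr0; case: i => -[|[|[|[|[|[|]]]]]].
exists setT, setT, (shear (- t)); split=> //; try exact: openT.
split=> //; try (by apply: continuous_subspaceT; exact: shear_continuous).
split=> v _; first exact: shearK.
by have := shearK (- t) v; rewrite opprK.
Unshelve. all: by end_near. Qed.
End Trivialization.

(** * The initial form *)

Lemma digits_inj n D (f g : nat -> nat) :
  (forall i, f i < D)%N -> (forall i, g i < D)%N ->
  (\sum_(i < n) f i * D ^ i = \sum_(i < n) g i * D ^ i)%N ->
  forall i, (i < n)%N -> f i = g i.
Proof.
move=> fD gD.
have small (h : nat -> nat) k : (forall i, h i < D)%N -> (\sum_(i < k) h i * D ^ i < D ^ k)%N.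
  move=> hD; elim: k => [|k IH]; first by rewrite big_ord0.
  rewrite big_ord_recr /= expnS; have := hD k.
  by move: IH; move: (\sum_(_ < _) _)%N (D ^ k)%N (h k) => a b c; nia.
elim: n => // n IH; rewrite !big_ord_recr /= => E.
have D0 : (0 < D ^ n)%N by rewrite expn_gt0; have := fD 0%N; case: (D).
have fg : f n = g n.
  have := congr1 (fun k => k %/ D ^ n)%N E.
  rewrite addnC divnMDl // [in RHS]addnC divnMDl // !divn_small ?addn0 //; exact: small.
move: E; rewrite fg => /addIn/IH{}IH i; rewrite ltnS leq_eqVlt => /orP[/eqP ->//|].
exact: IH.
Qed.

(* Kronecker substitution [x_i = s ^ (D ^ i)] reduces to one variable. *)
Lemma mpoly_eq0_box (R : realType) n (p : {mpoly (Cplx R)[n]}) (d : R) : 0 < d ->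
  (forall v : 'rV[Cplx R]_n, (forall i, normc (v ord0 i : R[i]) < d) -> peval p v = 0) ->
  p = 0.
Proof.
move=> d0 pd; pose K := Cplx R.
pose D := (\max_(m <- msupp p) mdeg m).+1.
have mD m i : m \in msupp p -> (m i < D)%N.
  move=> mp; rewrite ltnS; apply: leq_trans (leq_bigmax_seq _ mp isT).
  by rewrite mdegE (bigD1 i) //= leq_addr.
pose kappa (m : 'X_{1..n}) := (\sum_(i < n) m i * D ^ i)%N.
have kI m m' : m \in msupp p -> m' \in msupp p -> kappa m = kappa m' -> m = m'.
  move=> mp m'p kk; apply/mnmP => i.
  pose f (m : 'X_{1..n}) j := if insub j is Some k then m (k : 'I_n) else 0%N.
  have fE (m0 : 'X_{1..n}) (j : 'I_n) : f m0 j = m0 j by rewrite /f valK.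
  rewrite -!fE; apply: (@digits_inj n D _ _ _ _ _ i (ltn_ord i)).
  - by move=> j; rewrite /f; case: insubP => // k _ _; exact: mD.
  - by move=> j; rewrite /f; case: insubP => // k _ _; exact: mD.
  - by under eq_bigr do rewrite fE; under [RHS]eq_bigr do rewrite fE.
pose Q : {poly K} := \sum_(m <- msupp p) p@_m *: 'X^(kappa m).
have QE s : Q.[s] = p.@[fun i => s ^+ (D ^ i)].
  rewrite mevalE horner_sum; apply: eq_bigr => m _.
  rewrite hornerZ hornerXn; congr (_ * _); rewrite /kappa expr_sum.
  by apply: eq_bigr => i _; rewrite mulnC exprM.
have Q0 : Q = 0.
  apply/eqP; apply: contrapT => /negP Qn0.
  pose e := Num.min d 1; have e0 : 0 < e by rewrite lt_min d0 ltr01.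
  (* An unlimited supply of distinct roots of Q: these points and all their positive powers have
     modulus below d. *)
  pose r (j : nat) : K := (e / j.+2%:R)%:C%C.
  have rI : injective r.
    move=> i j /complexI /(mulfI (lt0r_neq0 e0)) /invr_inj /eqP.
    by rewrite eqr_nat => /eqP[].
  have := max_poly_roots Qn0 (_ : all (root Q) (map r (iota 0 (size Q)))) _.
  rewrite map_inj_uniq // iota_uniq size_map size_iota ltnn.
  suff H : all (root Q) [seq r i | i <- iota 0 (size Q)] by move=> /(_ H isT).
  apply/allP => _ /mapP[j _ ->]; rewrite /root QE.
  have := pd (\row_i (r j) ^+ (D ^ i)) => /(_ _)/eqP.
  have -> : peval p (\row_i (r j) ^+ (D ^ i)) = p.@[fun i => (r j) ^+ (D ^ i)].
    by apply: meval_eq => i; rewrite mxE.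
  apply=> i; rewrite mxE normcX normcR ger0_norm; last by rewrite divr_ge0 // ltW.
  have r1 : e / j.+2%:R < e by rewrite ltr_pdivrMr // ltr_pMr // ltr1n.
  have rp : 0 <= e / j.+2%:R by rewrite divr_ge0 // ltW.
  apply: (@le_lt_trans _ _ (e / j.+2%:R)); last by apply: lt_le_trans r1 _; rewrite ge_min lexx.
  have : (0 < D ^ i)%N by rewrite expn_gt0.
  case: (D ^ i)%N => // k _; rewrite exprS ler_piMr // exprn_ile1 //.
  by apply: le_trans (ltW r1) _; rewrite ge_min lexx orbT.
apply/mpolyP => m; rewrite mcoeff0.
have [mp|mp] := boolP (m \in msupp p); last exact: memN_msupp_eq0.
have := congr1 (fun q : {poly K} => q`_(kappa m)) Q0.
rewrite coef0 coef_sum (bigD1_seq m) ?msupp_uniq //= coefZ coefXn eqxx mulr1.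
rewrite big_seq_cond big1 ?addr0 // => m' /andP[m'p m'm].
rewrite coefZ coefXn; case: eqP => [/kI kk|_]; last by rewrite mulr0.
by rewrite (kk mp m'p) eqxx in m'm.
Qed.

(** Convergence at s = 1 bounds the coefficients by some M. If a m is the first nonzero one, the
    terms after it add up to at most 2 M s^(m + 1), which is negligible against s^m |a m| for small
    s. *)
Lemma power_series_eq0 (R : realType) (a : nat -> Cplx R) :
  (forall s : R, 0 < s <= 1 ->
    series (fun k => (s%:C%C : Cplx R) ^+ k * a k) @ \oo --> (0 : Cplx R)) ->
  forall k, a k = 0.
Proof.
move=> cvs.
have lim s (e : R) N : 0 < s <= 1 -> 0 < e -> exists2 n, (N <= n)%N &
    normc (series (fun k => (s%:C%C : Cplx R) ^+ k * a k) n : R[i]) < e.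
  move=> s01 e0; have [n0 _ H] : \forall n \near \oo,
      normc (series (fun k => (s%:C%C : Cplx R) ^+ k * a k) n : R[i]) < e.
    apply: (cvs s s01 [set z | normc (z : R[i]) < e]); apply/nearC_P.
    by exists e => // z; rewrite subr0.
  by exists (N + n0)%N; [rewrite leq_addr|apply: H; rewrite /= leq_addl].
have I1 : 0 < (1 : R) <= 1 by rewrite ltr01 lexx.
have [M M0 HM] : exists2 M : R, 0 <= M & forall k, normc (a k : R[i]) <= M.
  have [n0 _ H] : \forall n \near \oo,
      normc (series (fun k => (1%:C%C : Cplx R) ^+ k * a k) n : R[i]) < 1.
    apply: (cvs 1 I1 [set z | normc (z : R[i]) < 1]); apply/nearC_P.
    by exists 1 => // z; rewrite subr0.
  exists (2 + \sum_(k < n0) normc (a k : R[i])) => [|k].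
    by rewrite addr_ge0 // sumr_ge0 // => k _; rewrite normc_ge0.
  have [kn|nk] := ltnP k n0.
    rewrite (bigD1 (Ordinal kn)) //= addrCA lerDl addr_ge0 // sumr_ge0 // => i _.
    exact: normc_ge0.
  have h1 := H k nk; have h2 := H k.+1 (leqW nk).
  apply: (@le_trans _ _ 2); last by rewrite lerDl sumr_ge0 // => i _; rewrite normc_ge0.
  have := normcB (series (fun k => (1%:C%C : Cplx R) ^+ k * a k) k.+1 : R[i])
    (series (fun k => (1%:C%C : Cplx R) ^+ k * a k) k).
  rewrite {1}/series /= big_nat_recr //= -/(series _ _) addrAC subrr add0r expr1n mul1r.
  by move=> h3; apply: le_trans h3 _; rewrite -[2]/(1 + 1); apply: lerD; exact: ltW.
apply: ltn_ind => m IH.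
apply/eqP; rewrite -normc_eq0 eq_le normc_ge0 andbT leNgt; apply/negP => am.
pose s := Num.min (1 / 2) (normc (a m : R[i]) / (2 * M + 2)).
have M2 : 0 < 2 * M + 2 by lra.
have s0 : 0 < s by rewrite lt_min !divr_gt0.
have s2 : s <= 1 / 2 by rewrite ge_min lexx.
have sM : s * (2 * M + 2) <= normc (a m : R[i]).
  by rewrite -ler_pdivlMr // ge_min lexx orbT.
have s01 : 0 < s <= 1 by rewrite s0; lra.
(* The bound telescopes, because s <= 1/2 gives s^k <= 2 s^k - 2 s^(k + 1). *)
have tail N : normc (series (fun k => (s%:C%C : Cplx R) ^+ k * a k) (m.+1 + N)%N
    - (s%:C%C : Cplx R) ^+ m * a m : R[i]) <= M * (2 * s ^+ m.+1 - 2 * s ^+ (m.+1 + N)).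
  elim: N => [|N IHN].
    rewrite addn0 subrr mulr0 /series /= big_nat_recr //= big_nat big1 ?add0r ?subrr ?normc0 //.
    by move=> i /andP[_ im]; rewrite IH // mulr0.
  rewrite addnS {1}/series /= big_nat_recr //= -/(series _ _) addrAC.
  apply: le_trans (normcD _ _) _; apply: le_trans (lerD IHN (lexx _)) _.
  rewrite normcM normcX normcR ger0_norm ?(ltW s0) //.
  have p0 : 0 <= s ^+ (m.+1 + N) by rewrite exprn_ge0 // ltW.
  have h1 : s ^+ (m.+1 + N) * normc (a (m.+1 + N)%N : R[i]) <= s ^+ (m.+1 + N) * M.
    by rewrite ler_wpM2l.
  have h2 : s * (s ^+ (m.+1 + N) * M) <= 1 / 2 * (s ^+ (m.+1 + N) * M).
    by rewrite ler_wpM2r // mulr_ge0.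
  by rewrite [s ^+ (_ + N).+1]exprS; lra.
have e0 : 0 < s ^+ m.+1 by rewrite exprn_gt0.
have [n mn] := lim s _ m.+1 s01 e0; rewrite -(subnKC mn) => h1.
have h2 := tail (n - m.+1)%N.
set S : R[i] := series _ _ in h1 h2.
have h3 := normcB S (S - (s%:C%C : Cplx R) ^+ m * a m).
have E : S - (S - (s%:C%C : Cplx R) ^+ m * a m) = (s%:C%C) ^+ m * a m :> R[i] by ring.
rewrite E normcM normcX normcR ger0_norm ?(ltW s0) // in h3.
have p0 : 0 <= M * s ^+ (m.+1 + (n - m.+1)) by rewrite mulr_ge0 // exprn_ge0 // ltW.
have h4 : s ^+ m * normc (a m : R[i]) < s ^+ m * (s * (2 * M + 1)).
  apply: le_lt_trans h3 _; rewrite exprS in h1 h2 *; lra.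
have sm : 0 < s ^+ m by rewrite exprn_gt0.
rewrite ltr_pM2l // in h4.
lra.
Qed.

Lemma cvg_eventually_cst (T : topologicalType) (u : nat -> T) (l : T) N :
  (forall n, (N <= n)%N -> u n = l) -> u @ \oo --> l.
Proof. by move=> H; apply: cvg_near_cst; exists N => // n; exact: H. Qed.

Section InitialForm.
Variable R : realType.
Local Notation K := (Cplx R).

Lemma peval_scale n (p : {mpoly K[n]}) d (s : K) (v : 'rV[K]_n) :
  p \is d.-homog -> peval p (s *: v) = s ^+ d * peval p v.
Proof.
move=> /dhomogP hp; rewrite /peval !mevalE mulr_sumr; apply: eq_big_seq => m mp.
rewrite mulrCA; congr (_ * _); rewrite -(hp m mp) /= mdegE expr_sum -big_split /=.
by apply: eq_bigr => i _; rewrite mxE exprMn.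
Qed.

Lemma initial_form_unique n (f : 'rV[K]_n -> K) p q :
  is_initial_form f p -> is_initial_form f q -> p = q.
Proof.
suff main P P' k : homogeneous_expansion f P -> homogeneous_expansion f P' -> P k = P' k.
  move=> [P [m [eP Plow Pm ->]]] [P' [m' [eP' P'low P'm' ->]]].
  have PP' k : P k = P' k := main P P' k eP eP'.
  have [mm'|m'm|<-] := ltngtP m m'; last exact: PP'.
    by rewrite PP' P'low // eqxx in Pm.
  by rewrite -PP' Plow // eqxx in P'm'.
move=> [hP cP] [hP' cP'].
have /near_rV_P[d d0 Hd] : \forall z \near (0 : 'rV[K]_n),
    series (fun k => peval (P k) z) @ \oo --> f z /\
    series (fun k => peval (P' k) z) @ \oo --> f z.
  by near=> z; split; [exact: (near cP z)|exact: (near cP' z)].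
apply/eqP; rewrite -subr_eq0; apply/eqP; apply: (mpoly_eq0_box d0) => v vd.
have := @power_series_eq0 R (fun k => peval (P k - P' k) v) _ k; apply=> s /andP[s0 s1].
have [|c1 c2] := Hd ((s%:C%C : K) *: v).
  move=> i; rewrite !mxE subr0 normcM normcR ger0_norm ?(ltW s0) //.
  by apply: le_lt_trans (vd i); rewrite ler_piMl // normc_ge0.
have c := @cvgB _ _ _ \oo _ _ _ _ _ c1 c2; rewrite subrr in c.
have c' := c (@eventually_filter : Filter \oo).
apply: (eq_ind _ (fun F : nat -> K => F @ \oo --> (0 : K)) c').
apply/funext => N; rewrite -[LHS]/(series (fun k => peval (P k) _) N - series (fun k => peval (P' k) _) N).
rewrite /series /= -sumrB; apply: eq_bigr => j _.
rewrite !(peval_scale _ _ (hP _)) !(peval_scale _ _ (hP' _)) -mulrBr.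
by rewrite /peval mevalB.
Unshelve. all: by end_near. Qed.

Definition cone_poly (t : K) : {mpoly K[6]} :=
  'X_cy ^+ 2 * 'X_cz + t *: ('X_cy * 'X_cx * 'X_cw).

Definition tail_poly : {mpoly K[6]} := 'X_cx ^+ 3 * 'X_cz2 + 'X_cw ^+ 3 * 'X_cz3.

Lemma peval_cone t v : peval (cone_poly t) v =
  v ord0 cy ^+ 2 * v ord0 cz + t * (v ord0 cy * v ord0 cx * v ord0 cw).
Proof. by rewrite /peval /cone_poly mevalD mevalZ !mevalM !mevalXU expr2. Qed.

Lemma family_initial_form t : initial_form (@family R t) = cone_poly t.
Proof.
suff H : is_initial_form (@family R t) (cone_poly t).
  apply: initial_form_unique (_ : is_initial_form (@family R t) _) (H).
  exact: (xgetPex 0 (ex_intro (is_initial_form (@family R t)) _ H)).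
pose P k : {mpoly K[6]} := if k == 3%N then cone_poly t else if k == 4%N then tail_poly else 0.
have hX i : ('X_i : {mpoly K[6]}) \is 1.-homog by rewrite dhomogX /= mdeg1.
exists P, 3%N; split=> //; first last.
- apply/eqP => /(congr1 (fun p => peval p (delta_mx ord0 cy + delta_mx ord0 cz))).
  rewrite /P /= peval_cone /peval meval0 !mxE /= !(addr0, add0r, mulr0, expr1n, mulr1).
  by move/eqP; rewrite oner_eq0.
- by move=> [|[|[|]]].
split=> [k|].
  rewrite /P; case: eqP => [->|_]; last case: eqP => [->|_]; last exact: dhomog0.
    rewrite /cone_poly expr2; apply: dhomogD; last apply: dhomogZ.
      exact: (dhomogM (dhomogM (hX _) (hX _)) (hX _)).
    exact: (dhomogM (dhomogM (hX _) (hX _)) (hX _)).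
  rewrite /tail_poly !exprS !expr0 !mulr1; apply: dhomogD.
    exact: (dhomogM (dhomogM (hX _) (dhomogM (hX _) (hX _))) (hX _)).
  exact: (dhomogM (dhomogM (hX _) (dhomogM (hX _) (hX _))) (hX _)).
apply: (filterE (F := nbhs (0 : 'rV[K]_6))) => z.
(* The partial sum of index 5 is the first to contain the terms of degrees 3 and 4. *)
apply: (@cvg_eventually_cst _ _ _ 5) => N N5.
rewrite -(subnKC N5); elim: (N - 5)%N => [|j IH].
  rewrite addn0 /series /= !big_nat_recr //= big_nil /P /= /peval !meval0 !add0r.
  rewrite -/(peval (cone_poly t) z) peval_cone /tail_poly mevalD !mevalM !mevalXU /family.
  by rewrite !exprS !expr0 !mulr1; ring.
rewrite addnS [LHS]/series /= big_nat_recr //= -[X in X + _]/(series (fun k => peval (P k) z) (5 + j)) IH.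
by rewrite /P /= /peval meval0 addr0.
Qed.
End InitialForm.

(** * Multiplicities *)

Definition prime_elt (A : idomainType) (y : A) : Prop :=
  [/\ y != 0, y \isn't a GRing.unit &
      forall a b c : A, a * b = y * c ->
        (exists d, a = y * d) \/ (exists d, b = y * d)].

Section PrimeElements.
Variables (A : idomainType) (y : A).
Hypothesis yp : prime_elt y.

Lemma prime_dvd_exp a k c : a ^+ k = y * c -> exists d, a = y * d.
Proof.
have [_ yU yP] := yp; elim: k c => [|k IH] c.
  rewrite expr0 => E; case/negP: yU; apply/unitrPr.
  by exists c.
by rewrite exprS => /yP[//|[d]]; exact: IH.
Qed.

Lemma prime_dvd_prod (I : finType) (P : pred I) (h : I -> A) (k : I -> nat) c :
  \prod_(i | P i) h i ^+ k i = y * c -> exists2 i, P i & exists d, h i = y * d.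
Proof.
have [_ yU yP] := yp.
elim/big_rec: _ c => [c E|i a Pi IH c]; last by move=> /yP[[d]/prime_dvd_exp|[d]/IH//]; exists i.
by case/negP: yU; apply/unitrPr; exists c.
Qed.

Lemma irreducible_dvd_prime h d :
  irreducible_elt h -> h = y * d -> d \is a GRing.unit.
Proof.
by move=> [_ _ hP] /hP/orP[] // yU; have [_ /negP] := yp.
Qed.

(** The prime y divides some [h i], which is then associated to y. If [k i] were 1, cancelling it
    would leave one factor y, which would divide another [h j], associated to [h i]. *)
Lemma square_multiplicity r (h : 'I_r -> A) k c :
  irreducible_decomposition (y ^+ 2 * c) h k -> exists i, (1 < k i)%N.
Proof.
move=> [hirr hna k0 E]; have [yn0 yU yP] := yp.
have [i _ [d hd]] : exists2 i, xpredT i & exists d, h i = y * d.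
  by apply: (@prime_dvd_prod _ xpredT h k (y * c)); rewrite -E; ring.
exists i; rewrite ltn_neqAle k0 andbT; apply/eqP => k1.
have dU := irreducible_dvd_prime (hirr i) hd.
move: E; rewrite (bigD1 i) //= -k1 expr1 hd expr2 -!mulrA => /(mulfI yn0) E.
have [j ji [e he]] : exists2 j, j != i & exists d, h j = y * d.
  apply: (@prime_dvd_prod _ (fun j => j != i) h k (d^-1 * c)).
  by rewrite mulrCA E mulKr.
apply: (hna i j); first by rewrite eq_sym.
have eU := irreducible_dvd_prime (hirr j) he.
exists (e / d); first by rewrite unitrM eU unitrV.
by rewrite he hd mulrCA divrK.
Qed.

Lemma irreducible_dvd_square h c :
  irreducible_elt h -> h * c = y ^+ 2 -> exists d, h = y * d.
Proof.
move=> hi; have [yn0 _ yP] := yp; rewrite expr2 => E.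
have [//|[d cd]] := yP _ _ _ E.
have {}E : h * d = y * 1.
  by apply: (mulfI yn0); rewrite mulr1 -E cd mulrCA.
have [//|[e de]] := yP _ _ _ E.
have [_ /negP[]] := hi; apply/unitrPr; exists e.
by apply: (mulfI yn0); rewrite -E de mulrCA.
Qed.
End PrimeElements.

Section ConeMultiplicities.
Variable K : fieldType.

(** Modulo the variable, a polynomial equals its image under the substitution of 0 for that
    variable, and this substitution is a ring morphism to a domain. *)
Lemma mpolyX_prime n (i : 'I_n) : prime_elt ('X_i : {mpoly K[n]}).
Proof.
pose lq := [tuple (if j == i then 0 else 'X_j : {mpoly K[n]}) | j < n].
have lqE j : 'X_j \mPo lq = if j == i then 0 else 'X_j.
  by rewrite comp_mpolyXU -tnth_nth tnth_mktuple.
have lqM p q : (p * q) \mPo lq = (p \mPo lq) * (q \mPo lq) by rewrite rmorphM.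
pose S (p : {mpoly K[n]}) := exists d, p = 'X_i * d + (p \mPo lq).
have SM p q : S p -> S q -> S (p * q).
  move=> [a pa] [b qb]; exists (a * q + (p \mPo lq) * b).
  rewrite lqM; move: (p \mPo lq) (q \mPo lq) pa qb => p' q' -> ->; ring.
have S1 : S 1 by exists 0; rewrite comp_mpoly1 mulr0 add0r.
have SX j : S 'X_j.
  rewrite /S lqE; case: eqP => [->|_]; first by exists 1; rewrite mulr1 addr0.
  by exists 0; rewrite mulr0 add0r.
have SP p : S p.
  elim/mpolyind: p => [|c m p _ _ [d pd]]; first by exists 0; rewrite comp_mpoly0 mulr0 add0r.
  have [e me] : S 'X_[m].
    rewrite mpolyXE_id; elim/big_ind: _ => // j _.
    by elim: (m j) => // k IH; rewrite exprS; exact: SM.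
  exists (c *: e + d); rewrite comp_mpolyD comp_mpolyZ {1}pd {1}me scalerDr -!mul_mpolyC; ring.
split=> [||a b c abc].
- apply/eqP => /(congr1 (fun p => p.@[fun=> 1])).
  by rewrite mevalXU meval0 => /eqP; rewrite oner_eq0.
- apply/negP => /unitrPr[d /(congr1 (fun p => p.@[fun=> 0]))].
  by rewrite mevalM mevalXU meval1 mul0r => /esym/eqP; rewrite oner_eq0.
have : (a \mPo lq) * (b \mPo lq) == 0 by rewrite -lqM abc lqM lqE eqxx mul0r.
by rewrite mulf_eq0 => /orP[] /eqP E; [left; have [d] := SP a|right; have [d] := SP b];
  rewrite E addr0; exists d.
Qed.
End ConeMultiplicities.

Section Multiplicities.
Variable R : realType.
Local Notation K := (Cplx R).

(** A factor [h i ^+ 2] leaves [h i] in the derivative with respect to z, which is y^2. So y divides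
    [h i], and then y divides y z + t x w, which is refuted at the point with x = w = 1 and other
    coordinates 0. *)
Lemma cone_poly_multiplicity_one (t : K) r (h : 'I_r -> {mpoly K[6]}) k : t != 0 ->
  irreducible_decomposition (cone_poly t) h k -> forall i, k i = 1%N.
Proof.
move=> t0 [hirr _ k0 E] i; apply/eqP; rewrite eqn_leq k0 andbT leqNgt; apply/negP => k1.
have yp := mpolyX_prime K cy; have [yn0 _ _] := yp.
have {E} [q E] : exists q, cone_poly t = h i ^+ 2 * q.
  rewrite E (bigD1 i) //= -(subnKC k1) exprD -mulrA.
  by eexists.
have Dz : (cone_poly t)^`M(cz) = 'X_cy ^+ 2.
  have dX j : ('X_j : {mpoly K[6]})^`M(cz) = (j == cz)%:R.
    rewrite mderivX mnmE; case: eqP => [->|_]; last by rewrite scale0r.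
    have -> : (U_(cz) - U_(cz) = 0 :> 'X_{1..6})%MM by apply/mnmP => l; rewrite mnmBE subnn mnm0E.
    by rewrite mpolyX0 scale1r.
  by rewrite /cone_poly mderivD mderivZ expr2 !mderivM !dX /= !(mul0r, mulr0, add0r, mulr1, scaler0, addr0).
have [d hd] : exists d, h i = 'X_cy * d.
  apply: (irreducible_dvd_square yp
    (c := (h i)^`M(cz) * q + (h i)^`M(cz) * q + h i * q^`M(cz)) (hirr i)).
  by rewrite -Dz E expr2 !mderivM; ring.
have {}E : 'X_cy * 'X_cz + t *: ('X_cx * 'X_cw) = 'X_cy * (d ^+ 2 * q).
  by apply: (mulfI yn0); move: E; rewrite /cone_poly hd -!mul_mpolyC => E;
    rewrite [RHS](_ : _ = ('X_cy * d) ^+ 2 * q); [rewrite -E|]; ring.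
have := congr1 (fun p => p.@[fun j => ((j == cx) || (j == cw))%:R]) E.
rewrite mevalD mevalZ !mevalM !mevalXU /= !mul0r add0r !mulr1 => /eqP.
by rewrite (negbTE t0).
Qed.

Lemma cone_multiplicities_differ (t : K) : t != 0 ->
  forall r s (X : 'I_r -> set (Cn R 6)) (kX : 'I_r -> nat)
    (Y : 'I_s -> set (Cn R 6)) (kY : 'I_s -> nat),
  tangent_cone_components (@family R t) X kX ->
  tangent_cone_components (@family R 0) Y kY ->
  ~ exists2 sigma : 'I_r -> 'I_s, bijective sigma & forall i, kX i = kY (sigma i).
Proof.
move=> t0 r s X kX Y kY [h + _] [h' + _]; rewrite !family_initial_form.
move=> /(cone_poly_multiplicity_one t0) k1; rewrite /cone_poly scale0r addr0.
move=> /(square_multiplicity (mpolyX_prime K cy)) [j kj] [sigma [tau _ tauK] E].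
by move: kj; rewrite -(tauK j) -E k1.
Qed.
End Multiplicities.

(** * Topology of the tangent cones *)

Section ComplexSeparation.
Variable R : realType.
Local Open Scope complex_scope.
Local Notation K := (Cplx R).

Definition coord_close m (d : R) (u v : 'rV[K]_m) : Prop :=
  forall i, normc (u ord0 i - v ord0 i : R[i]) < d.

Definition coord_continuous_on m n (A : set 'rV[K]_m) (F : 'rV[K]_m -> 'rV[K]_n) :=
  forall v, A v -> forall e : R, 0 < e -> exists2 d : R, 0 < d &
    forall u, A u -> coord_close d u v -> coord_close e (F u) (F v).

Lemma coord_continuous_comp m n p (A : set 'rV[K]_m) (B : set 'rV[K]_n)
    (F : 'rV[K]_m -> 'rV[K]_n) (G : 'rV[K]_n -> 'rV[K]_p) :
  coord_continuous_on A F -> coord_continuous_on B G -> (forall v, A v -> B (F v)) ->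
  coord_continuous_on A (G \o F).
Proof.
move=> cF cG FB v Av e e0; have [d d0 Hd] := cG _ (FB v Av) e e0.
have [d' d'0 Hd'] := cF v Av d d0.
by exists d' => // u Au uv; apply: Hd; [exact: FB|exact: Hd'].
Qed.

Lemma within_coord_continuous m n (A : set 'rV[K]_m) (F : 'rV[K]_m -> 'rV[K]_n) :
  {within A, continuous F} -> coord_continuous_on A F.
Proof.
move=> cF v Av e e0.
have nb : nbhs (F v) (fun w => coord_close e w (F v)) by apply/near_rV_P; exists e.
have : within A (nbhs v) (F @^-1` (fun w => coord_close e w (F v))).
  by rewrite (nbhs_subspace_in Av); exact: (cF v _ nb).
move=> /(near_rV_P v)[d d0 Hd]; exists d => // u Au uv.
exact: (Hd u uv Au).
Qed.

Lemma continuous_coord_continuous m n (A : set 'rV[K]_m) (F : 'rV[K]_m -> 'rV[K]_n) :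
  (forall v, A v -> {for v, continuous F}) -> coord_continuous_on A F.
Proof.
move=> cF v Av e e0.
have nb : nbhs (F v) (fun w => coord_close e w (F v)) by apply/near_rV_P; exists e.
have /near_rV_P[d d0 Hd] := cF v Av _ nb.
by exists d => // u _; exact: Hd.
Qed.

Definition realify m (p : 'rV[R]_(m + m)) : 'rV[K]_m :=
  \row_i (p ord0 (lshift m i) +i* p ord0 (rshift m i)).

Definition unrealify m (u : 'rV[K]_m) : 'rV[R]_(m + m) :=
  row_mx (\row_i complex.Re (u ord0 i)) (\row_i complex.Im (u ord0 i)).

Lemma unrealifyK m : cancel (@unrealify m) (@realify m).
Proof.
move=> u; apply/rowP => i; rewrite mxE row_mxEl row_mxEr !mxE.
by case: (u ord0 i).
Qed.

Lemma realifyD m (p q : 'rV[R]_(m + m)) (t : R) :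
  realify (p + t *: (q - p)) = realify p + (t%:C : K) *: (realify q - realify p).
Proof.
apply/rowP => i; rewrite !mxE; apply/eqP; rewrite eq_complex /=.
by rewrite !mul0r subr0 addr0 !eqxx.
Qed.

Lemma realify_inj m : injective (@realify m).
Proof.
move=> p q pq; apply/rowP => i; rewrite -(splitK i).
by case: (fintype.split i) => j /=; have := congr1 (fun u : 'rV[K]_m => u ord0 j) pq;
  rewrite !mxE => -[].
Qed.

Lemma realify_close m (p q : 'rV[R]_(m + m)) d :
  `|p - q| < d / 2 -> coord_close d (realify p) (realify q).
Proof.
move=> pq i; rewrite !mxE; apply: le_lt_trans (normc_le_ReIm _) _ => /=.
have h j : `|p ord0 j - q ord0 j| < d / 2.
  by apply: le_lt_trans pq; have := mx_entry_le_norm (p - q) ord0 j; rewrite !mxE.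
by rewrite (splitr d) ltrD.
Qed.

(** The zeros of |F_a| - |F_b| are sent to a space of real dimension 2 #|J| <= 2 m, whereas the
    domain has real dimension 2 m + 2; this is [convex_separation] with N = 2 m + 1. *)
Lemma complex_separation m n (Om : set 'rV[K]_m.+1) (F : 'rV[K]_m.+1 -> 'rV[K]_n)
    (a b : 'I_n) (J : {set 'I_n}) :
  (forall u, Om u -> exists2 d : R, 0 < d & forall v, coord_close d v u -> Om v) ->
  (forall u v (t : R), Om u -> Om v -> 0 <= t <= 1 -> Om (u + (t%:C : K) *: (v - u))) ->
  coord_continuous_on Om F ->
  (forall u v, Om u -> Om v -> F u = F v -> u = v) ->
  (#|J| <= m)%N ->
  (forall u, Om u -> normc (F u ord0 a : R[i]) = normc (F u ord0 b : R[i]) ->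
     forall j, j \notin J -> F u ord0 j = 0) ->
  forall u v, Om u -> Om v ->
    normc (F u ord0 a : R[i]) < normc (F u ord0 b : R[i]) ->
    normc (F v ord0 b : R[i]) < normc (F v ord0 a : R[i]) -> False.
Proof.
move=> oO cvO cF Finj Jm FJ u v Ou Ov Fu Fv.
(* The size [m.+1 + m.+1] is convertible to [(m + m.+1).+1], which exhibits the successor that
   separation requires. *)
pose rl : 'rV[R]_(m + m.+1).+1 -> 'rV[K]_m.+1 := @realify m.+1.
pose U (j : 'I_n * bool) p := let z : R[i] := F (rl p) ord0 j.1 in
  if j.2 then complex.Im z else complex.Re z.
pose s p := normc (F (rl p) ord0 a : R[i]) - normc (F (rl p) ord0 b : R[i]).
have cFr p : Om (rl p) -> forall e : R, 0 < e -> exists2 d : R, 0 < d &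
    forall q, Om (rl q) -> `|q - p| < d -> coord_close e (F (rl q)) (F (rl p)).
  move=> Op e e0; have [d d0 Hd] := cF _ Op e e0.
  exists (d / 2) => [|q Oq qp]; first by rewrite divr_gt0.
  by apply: Hd => //; exact: realify_close.
pose J' : {set 'I_n * bool} := finset.setX J (finset.setTfor bool).
have J2 : (#|J'| < m + m.+1)%N.
  by rewrite cardsX cardsT card_bool addnS ltnS muln2 -addnn leq_add.
apply: (@convex_separation R (m + m.+1) _ U (rl @^-1` Om) s
  J' _ _ _ _ _ J2 _ (unrealify u) (unrealify v)).
- rewrite openE => p Op; apply/nbhs_ballP; have [d d0 Hd] := oO _ Op.
  exists (d / 2) => /=; first by rewrite divr_gt0.
  move=> q; rewrite -ball_normE /= distrC => qp; apply: Hd; exact: realify_close.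
- move=> p q t Op Oq t01; rewrite /preimage /= /rl realifyD; exact: cvO.
- move=> j p Op e e0; have [d d0 Hd] := cFr p Op e e0.
  exists d => // q Oq qp; have := Hd q Oq qp j.1; apply: le_lt_trans.
  rewrite /U; case: j.2; move: (F _ _ _) (F _ _ _) => z w.
    by apply: le_trans (Im_le_normc _); case: z; case: w.
  by apply: le_trans (Re_le_normc _); case: z; case: w.
- move=> p Op e e0; have e2 : 0 < e / 2 by rewrite divr_gt0.
  have [d d0 Hd] := cFr p Op _ e2; exists d => // q Oq qp.
  have ha := Hd q Oq qp a; have hb := Hd q Oq qp b.
  have dist (z w : R[i]) : `|normc z - normc w| <= normc (z - w).
    have h1 := normcD (z - w) w; have h2 := normcD (w - z) z.
    by rewrite !subrK in h1 h2; rewrite normc_dist in h2; rewrite ler_norml; lra.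
  have := dist (F (rl q) ord0 a) (F (rl p) ord0 a).
  have := dist (F (rl q) ord0 b) (F (rl p) ord0 b).
  rewrite /s; rewrite ltr_norml !ler_norml => /andP[h1 h2] /andP[h3 h4].
  lra.
- move=> p q Op Oq pq; apply: (@realify_inj m.+1); apply: Finj => //.
  apply/rowP => j; have := pq (j, true); have := pq (j, false); rewrite /U /=.
  by move: (F _ _ _) (F _ _ _) => [z1 z2] [w1 w2] /= -> ->.
- move=> p Op /eqP; rewrite subr_eq0 => /eqP sp [j c]; rewrite finset.in_setX finset.in_setT andbT => jJ.
  by rewrite /U /= (FJ _ Op sp _ jJ); case: c {jJ}.
- by rewrite /preimage /= /rl unrealifyK.
- by rewrite /preimage /= /rl unrealifyK.
- by rewrite /s /rl unrealifyK subr_lt0.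
- by rewrite /s /rl unrealifyK subr_gt0.
Qed.
End ComplexSeparation.

(** * Constancy of the sign on each component of the cone *)

Section Cones.
Variable R : realType.
Local Open Scope complex_scope.
Local Notation K := (Cplx R).
Local Notation V := (Cn R 6).

Definition vec6 (x w y z z2 z3 : K) : V :=
  \row_(i < 6) nth (0 : K) [:: x; w; y; z; z2; z3] i.

Lemma vec6E (v : V) : v = vec6 (v ord0 cx) (v ord0 cw) (v ord0 cy) (v ord0 cz)
  (v ord0 cz2) (v ord0 cz3).
Proof. by apply/rowP; apply: ord6_ind; rewrite !mxE. Qed.

Lemma vec6_continuous (T : topologicalType) (x w y z z2 z3 : T -> K) (p : T) :
  {for p, continuous x} -> {for p, continuous w} -> {for p, continuous y} ->
  {for p, continuous z} -> {for p, continuous z2} -> {for p, continuous z3} ->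
  {for p, continuous (fun q => vec6 (x q) (w q) (y q) (z q) (z2 q) (z3 q))}.
Proof.
move=> cx' cw' cy' cz' cz2' cz3'; apply: continuous_rV.
have E i : (fun q => vec6 (x q) (w q) (y q) (z q) (z2 q) (z3 q) ord0 i) =
    (fun q => nth (0 : K) [:: x q; w q; y q; z q; z2 q; z3 q] i).
  by apply/funext => q; rewrite mxE.
move=> i; apply: (eq_ind_r (fun F => {for p, continuous F}) _ (E i)).
move: i {E}; apply: ord6_ind.
- exact: cx'.
- exact: cw'.
- exact: cy'.
- exact: cz'.
- exact: cz2'.
- exact: cz3'.
Qed.

Definition quadric (t : K) (v : V) : K :=
  v ord0 cy * v ord0 cz + t * (v ord0 cx * v ord0 cw).

Lemma quadric_continuous t (v : V) : {for v, continuous (quadric t)}.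
Proof.
apply: differentiable_continuous.
have d2 i : differentiable (fun v : V => v ord0 i) v by exact: differentiable_coord.
have d1 : differentiable (fun _ : V => t) v by exact: differentiable_cst.
exact: (differentiable_add (differentiable_mul (d2 cy) (d2 cz))
  (differentiable_mul d1 (differentiable_mul (d2 cx) (d2 cw)))).
Qed.

Lemma tangent_coneP t (v : V) :
  tangent_cone (@family R t) v <-> v ord0 cy = 0 \/ quadric t v = 0.
Proof.
rewrite /tangent_cone family_initial_form /zero_set /= peval_cone.
have -> : v ord0 cy ^+ 2 * v ord0 cz + t * (v ord0 cy * v ord0 cx * v ord0 cw) =
  v ord0 cy * quadric t v by rewrite /quadric; ring.
split=> [/eqP|[->|->]]; rewrite ?mul0r ?mulr0 //.
by rewrite mulf_eq0 => /orP[/eqP|/eqP]; [left|right].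
Qed.

(** The chart of Q covers only y != 0, and this extends its conclusion to all of Q. When x or w is
    nonzero, a line contained in Q leaves y = 0; when x = w = y = 0, a first move along the w axis
    stays in Q. *)
Lemma quadric_perturb (t : K) (P : set V) : t != 0 ->
  (forall v, quadric t v = 0 -> P v -> exists2 d : R, 0 < d &
     forall u, quadric t u = 0 -> coord_close d u v -> P u) ->
  forall v, quadric t v = 0 -> P v ->
  exists u, [/\ quadric t u = 0, P u & u ord0 cy != 0].
Proof.
move=> t0 oP.
have step v e : quadric t v = 0 -> P v -> (forall s : K, quadric t (v + s *: e) = 0) ->
    exists2 s : K, s != 0 & P (v + s *: e).
  move=> Qv Pv Qe; have [d d0 Hd] := oP v Qv Pv.
  pose M : R := 1 + \sum_i normc (e ord0 i : R[i]).
  have M0 : 0 < M by rewrite ltr_wpDr // sumr_ge0 // => i _; exact: normc_ge0.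
  have eM i : normc (e ord0 i : R[i]) < M.
    rewrite /M (bigD1 i) //= addrCA ltrDl ltr_wpDr // sumr_ge0 // => j _.
    exact: normc_ge0.
  have s0 : 0 < d / M by rewrite divr_gt0.
  exists (d / M)%:C; first by rewrite fmorph_eq0 lt0r_neq0.
  apply: Hd => // i; rewrite !mxE addrAC subrr add0r normcM normcR gtr0_norm //.
  by rewrite -[ltRHS](divfK (lt0r_neq0 M0)) ltr_pM2l.
have case_xw v : quadric t v = 0 -> P v -> (v ord0 cx != 0) || (v ord0 cw != 0) ->
    exists u, [/\ quadric t u = 0, P u & u ord0 cy != 0].
  move=> Qv Pv; have [y0|yn0] := eqVneq (v ord0 cy) 0; last by exists v.
  move=> /orP[xn0|wn0].
    have Qe s : quadric t (v + s *: vec6 0 (v ord0 cz) (- (t * v ord0 cx)) 0 0 0) = 0.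
      by rewrite -[RHS]Qv /quadric !mxE /=; ring.
    have [s sn0 Ps] := step v _ Qv Pv Qe.
    exists (v + s *: vec6 0 (v ord0 cz) (- (t * v ord0 cx)) 0 0 0); split=> //.
    by rewrite !mxE /= y0 add0r mulrN oppr_eq0 !mulf_neq0.
  have Qe s : quadric t (v + s *: vec6 (v ord0 cz) 0 (- (t * v ord0 cw)) 0 0 0) = 0.
    by rewrite -[RHS]Qv /quadric !mxE /=; ring.
  have [s sn0 Ps] := step v _ Qv Pv Qe.
  exists (v + s *: vec6 (v ord0 cz) 0 (- (t * v ord0 cw)) 0 0 0); split=> //.
  by rewrite !mxE /= y0 add0r mulrN oppr_eq0 !mulf_neq0.
move=> v Qv Pv; have [y0|yn0] := eqVneq (v ord0 cy) 0; last by exists v.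
have [x0|xn0] := eqVneq (v ord0 cx) 0; last by apply: (case_xw v) => //; rewrite xn0.
have Qe s : quadric t (v + s *: vec6 0 1 0 0 0 0) = 0.
  by rewrite /quadric !mxE /= y0 x0; ring.
have [s sn0 Ps] := step v _ Qv Pv Qe.
have [wn0|wn0] := eqVneq (v ord0 cw) 0; last by apply: (case_xw v) => //; rewrite wn0 orbT.
apply: (case_xw _ (Qe s) Ps); apply/orP; right.
by rewrite !mxE /= wn0 add0r mulr1.
Qed.

Section SignOnCharts.
Variables (X : set V) (f : V -> V).
Hypothesis cf : coord_continuous_on X f.
Hypothesis finj : forall u v, X u -> X v -> f u = f v -> u = v.
Hypothesis fX : forall v, X v -> f v ord0 cy = 0 \/ f v ord0 cz = 0.

(** Where y or z vanishes, |y| = |z| forces y = z = 0. So in a chart of complex dimension 5, the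
    zeros of the pulled-back function are sent to a space of dimension 4, and [complex_separation]
    applies. *)
Lemma chart_same_sign (Om : set 'rV[K]_5) (c : 'rV[K]_5 -> V) :
  (forall u, Om u -> exists2 d : R, 0 < d & forall v, coord_close d v u -> Om v) ->
  (forall u v (t : R), Om u -> Om v -> 0 <= t <= 1 -> Om (u + (t%:C : K) *: (v - u))) ->
  coord_continuous_on Om c ->
  (forall u v, Om u -> Om v -> c u = c v -> u = v) ->
  (forall u, Om u -> X (c u)) ->
  forall u v, Om u -> Om v ->
    normc (f (c u) ord0 cy : R[i]) < normc (f (c u) ord0 cz : R[i]) ->
    normc (f (c v) ord0 cz : R[i]) < normc (f (c v) ord0 cy : R[i]) -> False.
Proof.
move=> oO cvO cc cinj cX u v Ou Ov.
pose J : {set 'I_6} := finset.setC [set cy; cz]%SET.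
have J4 : (#|J| <= 4)%N by rewrite cardsCs finset.setCK cards2 card_ord.
apply: (complex_separation oO cvO (coord_continuous_comp cc cf cX) _ J4 _ Ou Ov).
  move=> a b Oa Ob /finj E; apply: cinj => //; apply: E; exact: cX.
move=> a Oa E j; rewrite finset.in_setC negbK finset.in_set2.
have n0 (z : R[i]) : z = 0 -> normc z = 0 by move=> ->; rewrite normc0.
have [y0 z0] : f (c a) ord0 cy = 0 /\ f (c a) ord0 cz = 0.
  have [E0|E0] := fX (cX _ Oa); split=> //.
    exact: (eq0_normc (etrans (esym E) (n0 _ E0))).
  exact: (eq0_normc (etrans E (n0 _ E0))).
by case/orP => /eqP ->; [exact: y0|exact: z0].
Qed.

Definition hyperplane_chart (u : 'rV[K]_5) : V :=
  vec6 (u ord0 (@Ordinal 5 0 isT)) (u ord0 (@Ordinal 5 1 isT)) 0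
    (u ord0 (@Ordinal 5 2 isT)) (u ord0 (@Ordinal 5 3 isT)) (u ord0 (@Ordinal 5 4 isT)).

Lemma hyperplane_same_sign : (forall v : V, v ord0 cy = 0 -> X v) ->
  forall u v : V, u ord0 cy = 0 -> v ord0 cy = 0 ->
    normc (f u ord0 cy : R[i]) < normc (f u ord0 cz : R[i]) ->
    normc (f v ord0 cz : R[i]) < normc (f v ord0 cy : R[i]) -> False.
Proof.
move=> HX u v u0 v0.
pose p (w : V) : 'rV[K]_5 := \row_i nth (0 : K)
  [:: w ord0 cx; w ord0 cw; w ord0 cz; w ord0 cz2; w ord0 cz3] i.
have pE (w : V) : w ord0 cy = 0 -> w = hyperplane_chart (p w).
  by move=> w0; rewrite [LHS]vec6E /hyperplane_chart !mxE /= w0.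
rewrite (pE u u0) (pE v v0); apply: (@chart_same_sign setT) => //.
- by move=> *; exists 1.
- move=> w _ e e0; exists e => // w' _ ww'; apply: ord6_ind; rewrite !mxE //=.
  by rewrite subrr !expr0n /= addr0 sqrtr0.
- move=> a b _ _ E; apply/rowP => i.
  have := fun j => congr1 (fun w : V => w ord0 j) E.
  move=> {}E; have := E cx; have := E cw; have := E cz; have := E cz2; have := E cz3.
  rewrite !mxE /=; case: i => -[|[|[|[|[|//]]]]] i; rewrite (bool_irrelevance i isT).
  + by move=> _ _ _ _ ->.
  + by move=> _ _ _ -> _.
  + by move=> _ _ -> _ _.
  + by move=> _ -> _ _ _.
  + by move=> -> _ _ _ _.
- by move=> a _; apply: HX; rewrite !mxE.
Qed.

Definition quadric_chart (t : K) (u : 'rV[K]_5) : V :=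
  vec6 (u ord0 (@Ordinal 5 1 isT)) (u ord0 (@Ordinal 5 2 isT)) (u ord0 (@Ordinal 5 0 isT) ^+ 2)
    (- t * (u ord0 (@Ordinal 5 1 isT) * u ord0 (@Ordinal 5 2 isT)) *
       (u ord0 (@Ordinal 5 0 isT) ^+ 2)^-1)
    (u ord0 (@Ordinal 5 3 isT)) (u ord0 (@Ordinal 5 4 isT)).

Lemma quadric_chart_continuous t (u : 'rV[K]_5) : u ord0 (@Ordinal 5 0 isT) != 0 ->
  {for u, continuous (quadric_chart t)}.
Proof.
move=> u0.
have d2 i : differentiable (fun v : 'rV[K]_5 => v ord0 i) u by exact: differentiable_coord.
have c2 i : {for u, continuous (fun v : 'rV[K]_5 => v ord0 i)} by exact: coord_continuous.
have d1 : differentiable (fun _ : 'rV[K]_5 => - t) u by exact: differentiable_cst.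
have dsq := differentiable_exp 2 (d2 (@Ordinal 5 0 isT)).
apply: vec6_continuous.
- exact: c2.
- exact: c2.
- exact: (differentiable_continuous dsq).
- have c1 := differentiable_continuous (differentiable_mul d1
    (differentiable_mul (d2 (@Ordinal 5 1 isT)) (d2 (@Ordinal 5 2 isT)))).
  have cv : {for u, continuous (fun v : 'rV[K]_5 => (v ord0 (@Ordinal 5 0 isT) ^+ 2)^-1)}.
    apply: continuous_inv; first by rewrite expf_neq0.
    exact: (differentiable_continuous dsq).
  exact: (continuousM c1 cv).
- exact: c2.
- exact: c2.
Qed.

(* [y = v ^ 2] with [v] in an open half plane: any two nonzero values of [y]
   have square roots in a common half plane. *)
Lemma quadric_chart_same_sign t : (forall v : V, quadric t v = 0 -> X v) ->
  forall u v : V, quadric t u = 0 -> quadric t v = 0 ->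
    u ord0 cy != 0 -> v ord0 cy != 0 ->
    normc (f u ord0 cy : R[i]) < normc (f u ord0 cz : R[i]) ->
    normc (f v ord0 cz : R[i]) < normc (f v ord0 cy : R[i]) -> False.
Proof.
move=> QX u v Qu Qv yu yv.
pose dot (z w : R[i]) := complex.Re z * complex.Re w + complex.Im z * complex.Im w.
have dot_gt0 z : z != 0 -> 0 < dot z z.
  case: z => a b; rewrite eq_complex /= negb_and /dot /= -!expr2 => /orP[] h.
    by rewrite ltr_pwDl ?sqr_ge0 // lt0r sqr_ge0 expf_neq0.
  by rewrite ltr_wpDl ?sqr_ge0 // lt0r sqr_ge0 expf_neq0.
have dotDl z z' w : dot (z + z') w = dot z w + dot z' w.
  by case: z z' w => [? ?] [? ?] [? ?]; rewrite /dot /=; ring.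
have dotC z w : dot z w = dot w z by rewrite /dot mulrC [X in _ + X]mulrC.
have dotNl z w : dot (- z) w = - dot z w.
  by case: z w => [? ?] [? ?]; rewrite /dot /=; ring.
have [a [b [aE bE ab]]] : exists a b : K, [/\ a ^+ 2 = u ord0 cy, b ^+ 2 = v ord0 cy & 0 <= dot a b].
  pose a : K := sqrtC (u ord0 cy); pose b : K := sqrtC (v ord0 cy).
  have aE : a ^+ 2 = u ord0 cy by exact: sqrtCK.
  have bE : b ^+ 2 = v ord0 cy by exact: sqrtCK.
  have [ab|ab] := leP 0 (dot a b); first by exists a, b.
  exists (- a), b; split=> //; first by rewrite sqrrN.
  by rewrite dotNl oppr_ge0 ltW.
have a0 : (a : R[i]) != 0 by apply: contraNneq yu => a0; rewrite -aE a0 expr0n.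
have b0 : (b : R[i]) != 0 by apply: contraNneq yv => b0; rewrite -bE b0 expr0n.
(* The inner normal of the half plane: both roots have a positive scalar product with a + b, as
   [dot a b] is nonnegative. *)
pose c : R[i] := a + b.
pose Om : set 'rV[K]_5 := [set q | 0 < dot c (q ord0 (@Ordinal 5 0 isT))].
pose p (w : V) (r : K) : 'rV[K]_5 := \row_i nth (0 : K)
  [:: r; w ord0 cx; w ord0 cw; w ord0 cz2; w ord0 cz3] i.
have pE (w : V) r : quadric t w = 0 -> w ord0 cy != 0 -> r ^+ 2 = w ord0 cy ->
    w = quadric_chart t (p w r).
  move=> Qw yw rw; rewrite [LHS]vec6E /quadric_chart !mxE /= rw; congr (vec6 _ _ _ _ _ _).
  by apply: (mulIf yw); rewrite mulfVK //; apply/eqP; rewrite mulNr -addr_eq0 mulrC; apply/eqP.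
have On0 q : Om q -> q ord0 (@Ordinal 5 0 isT) != 0.
  by rewrite /Om /=; apply: contraTneq => ->; rewrite /dot /= !mulr0 addr0 ltxx.
rewrite (pE u a Qu yu aE) (pE v b Qv yv bE).
apply: (@chart_same_sign Om (quadric_chart t)).
- move=> q Oq; pose M := `|complex.Re c| + `|complex.Im c| + 1.
  have M0 : 0 < M by rewrite ltr_wpDl // addr_ge0.
  exists (dot c (q ord0 (@Ordinal 5 0 isT)) / M) => [|w wq]; first by rewrite divr_gt0.
  have := wq (@Ordinal 5 0 isT); rewrite ltr_pdivlMr //.
  rewrite /Om /=; move: (w _ _) (q _ _) => w0 q0 H.
  have h : `|dot c (w0 - q0)| <= normc (w0 - q0 : R[i]) * M.
    apply: le_trans (ler_normD _ _) _; rewrite !normrM /M.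
    have h1 := Re_le_normc (w0 - q0); have h2 := Im_le_normc (w0 - q0).
    have h3 := normc_ge0 (w0 - q0).
    have h4 := ler_wpM2l (normr_ge0 (complex.Re c)) h1.
    have h5 := ler_wpM2l (normr_ge0 (complex.Im c)) h2.
    by rewrite mulrDr mulr1 mulrDr; lra.
  have E : dot c w0 = dot c (w0 - q0) + dot c q0.
    by rewrite dotC [dot c (_ - _)]dotC [dot c q0]dotC -dotDl subrK.
  by move: (le_lt_trans h H); rewrite ltr_norml E => /andP[]; lra.
- move=> q w s; rewrite /Om /= !mxE; move: (q _ _) (w _ _) => q0 w0 h1 h2 /andP[s0 s1].
  have -> : dot c (q0 + s%:C * (w0 - q0)) = (1 - s) * dot c q0 + s * dot c w0.
    by case: q0 w0 {h1 h2} => [? ?] [? ?]; rewrite /dot /=; ring.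
  have [->|sn0] := eqVneq s 0; first by rewrite subr0 mul1r mul0r addr0.
  rewrite ltr_wpDl //; first by rewrite mulr_ge0 ?subr_ge0 // ltW.
  by rewrite mulr_gt0 // lt0r sn0.
- by apply: continuous_coord_continuous => w Ow; apply: quadric_chart_continuous; exact: On0.
- move=> q w Oq Ow E; apply/rowP => i.
  have := fun j => congr1 (fun w : V => w ord0 j) E.
  move=> {}E; have := E cx; have := E cw; have := E cy; have := E cz2; have := E cz3.
  rewrite !mxE /=; case: i => -[|[|[|[|[|//]]]]] i; rewrite (bool_irrelevance i isT).
  (* Squaring is injective on an open half plane, which contains no two opposite points. *)
  + move=> _ _ /eqP + _ _; rewrite eqf_sqr => /orP[/eqP//|/eqP qw].
    have h : dot c (w ord0 (@Ordinal 5 0 isT)) < 0.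
      by move: Oq; rewrite /Om /= qw dotC dotNl dotC oppr_gt0.
    by have := lt_trans h Ow; rewrite ltxx.
  + by move=> _ _ _ _ ->.
  + by move=> _ _ _ -> _.
  + by move=> _ -> _ _ _.
  + by move=> -> _ _ _ _.
- move=> q /On0 q0; apply: QX; rewrite /quadric !mxE /= mulrC divfK ?expf_neq0 //.
  by rewrite mulNr addNr.
- by rewrite /Om /= mxE /= dotDl ltr_pwDl ?dot_gt0 // dotC.
- by rewrite /Om /= mxE /= dotDl ltr_wpDl ?dot_gt0.
Qed.

Lemma sign_open (a b : 'I_6) v : X v ->
  normc (f v ord0 a : R[i]) < normc (f v ord0 b : R[i]) ->
  exists2 d : R, 0 < d & forall u, X u -> coord_close d u v ->
    normc (f u ord0 a : R[i]) < normc (f u ord0 b : R[i]).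
Proof.
move=> Xv ab.
have e0 : 0 < (normc (f v ord0 b : R[i]) - normc (f v ord0 a : R[i])) / 2.
  by rewrite divr_gt0 // subr_gt0.
have [d d0 Hd] := cf Xv e0; exists d => // u Xu uv.
have ha := Hd u Xu uv a; have hb := Hd u Xu uv b.
have h1 := normcD (f u ord0 a - f v ord0 a : R[i]) (f v ord0 a).
have h2 := normcD (f v ord0 b - f u ord0 b : R[i]) (f u ord0 b).
rewrite !subrK in h1 h2; rewrite normc_dist in h2.
by lra.
Qed.

Lemma quadric_same_sign t : t != 0 -> (forall v : V, quadric t v = 0 -> X v) ->
  forall u v : V, quadric t u = 0 -> quadric t v = 0 ->
    normc (f u ord0 cy : R[i]) < normc (f u ord0 cz : R[i]) ->
    normc (f v ord0 cz : R[i]) < normc (f v ord0 cy : R[i]) -> False.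
Proof.
move=> t0 QX u v Qu Qv Pu Pv.
have [u' [Qu' Pu' yu']] := @quadric_perturb t
  (fun v => normc (f v ord0 cy : R[i]) < normc (f v ord0 cz : R[i])) t0
  (fun v Qv Pv => let: ex_intro2 d d0 Hd := sign_open (QX v Qv) Pv in
    ex_intro2 _ _ d d0 (fun u Qu => Hd u (QX u Qu))) u Qu Pu.
have [v' [Qv' Pv' yv']] := @quadric_perturb t
  (fun v => normc (f v ord0 cz : R[i]) < normc (f v ord0 cy : R[i])) t0
  (fun v Qv Pv => let: ex_intro2 d d0 Hd := sign_open (QX v Qv) Pv in
    ex_intro2 _ _ d d0 (fun u Qu => Hd u (QX u Qu))) v Qv Pv.
exact: (quadric_chart_same_sign QX Qu' Qv' yu' yv' Pu' Pv').
Qed.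
End SignOnCharts.
End Cones.

(** * Comparison of the two cones *)

Section NotHomeomorphic.
Variable R : realType.
Local Open Scope complex_scope.
Local Notation K := (Cplx R).
Local Notation V := (Cn R 6).

Lemma zero_cone (v : V) : tangent_cone (@family R 0) v <-> v ord0 cy = 0 \/ v ord0 cz = 0.
Proof.
rewrite tangent_coneP /quadric mul0r addr0; split=> [[->|/eqP]|[->|->]].
- by left.
- by rewrite mulf_eq0 => /orP[] /eqP ->; [left|right].
- by left.
- by right; rewrite mulr0.
Qed.

Lemma nonzero_near (q : V -> K) (X : set V) (g : V -> V) (p e : V) :
  coord_continuous_on X g -> (forall s : K, X (p + s *: e)) ->
  {for g p, continuous q} -> q (g p) != 0 ->
  exists2 d : R, 0 < d & forall s : R, 0 < s < d -> q (g (p + (s%:C : K) *: e)) != 0.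
Proof.
move=> cg Xe cq qp.
have q0 : 0 < normc (q (g p) : R[i]) by rewrite normc_gt0.
have [d d0 Hd] := cvg_rV_P cq q0.
have Xp : X p by have := Xe 0; rewrite scale0r addr0.
have [d' d'0 Hd'] := cg p Xp d d0.
pose M : R := 1 + \sum_i normc (e ord0 i : R[i]).
have M0 : 0 < M by rewrite ltr_wpDr // sumr_ge0 // => i _; exact: normc_ge0.
have eM i : normc (e ord0 i : R[i]) < M.
  rewrite /M (bigD1 i) //= addrCA ltrDl ltr_wpDr // sumr_ge0 // => j _.
  exact: normc_ge0.
exists (d' / M) => [|s /andP[s0 sd]]; first by rewrite divr_gt0.
have h := Hd _ (Hd' _ (Xe (s%:C : K)) _); apply/negP => /eqP E.
have : normc (q (g (p + (s%:C : K) *: e)) - q (g p) : R[i]) < normc (q (g p) : R[i]).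
  apply: h => i; rewrite !mxE addrAC subrr add0r normcM normcR gtr0_norm //.
  rewrite ltr_pdivlMr // in sd; apply: le_lt_trans sd.
  by rewrite ler_pM2l // ltW.
by rewrite E sub0r normcN' ltxx.
Qed.

Lemma tangent_cones_not_homeomorphic (t : K) : t != 0 ->
  ~ homeomorphic (tangent_cone (@family R t)) (tangent_cone (@family R 0)).
Proof.
move=> t0 [f [g [[fAB gBA] [fK gK] /within_coord_continuous cf /within_coord_continuous cg]]].
set X := tangent_cone _ in fAB gBA fK cf; set Y := tangent_cone _ in fAB gBA gK cg.
have HX (v : V) : v ord0 cy = 0 -> X v by move=> v0; apply/tangent_coneP; left.
have QX (v : V) : quadric t v = 0 -> X v by move=> v0; apply/tangent_coneP; right.
have finj u v : X u -> X v -> f u = f v -> u = v.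
  by move=> Xu Xv E; rewrite -(fK u Xu) -(fK v Xv) E.
have ginj u v : Y u -> Y v -> g u = g v -> u = v.
  by move=> Yu Yv E; rewrite -(gK u Yu) -(gK v Yv) E.
have fX v : X v -> f v ord0 cy = 0 \/ f v ord0 cz = 0 by move=> /fAB/zero_cone.
have hH := hyperplane_same_sign cf finj fX HX.
have hQ := quadric_same_sign cf finj fX t0 QX.
have yY (p : V) : p ord0 cz = 0 -> Y p by move=> ?; apply/zero_cone; right.
have zY (p : V) : p ord0 cy = 0 -> Y p by move=> ?; apply/zero_cone; left.
pose ey : V := delta_mx ord0 cy; pose ez : V := delta_mx ord0 cz.
have eyE : ey ord0 cy = 1 /\ ey ord0 cz = 0 by rewrite !mxE.
have ezE : ez ord0 cy = 0 /\ ez ord0 cz = 1 by rewrite !mxE.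
(* A nonzero sign at a point of both H and Q would be the only one on H and on Q, hence on the whole
   cone; but [g ey] and [g ez] have opposite signs. *)
have meet (v : V) : v ord0 cy = 0 -> quadric t v = 0 ->
    f v ord0 cy = 0 /\ f v ord0 cz = 0.
  move=> Hv Qv; have Xv := HX v Hv.
  have n0 (z : R[i]) : z = 0 -> normc z = 0 by move=> ->; rewrite normc0.
  have n1 (z : R[i]) : z != 0 -> 0 < normc z by rewrite normc_gt0.
  have [E|E] := fX v Xv; split=> //; apply/eqP; apply: contrapT => /negP/n1 E'.
    have Yb : Y ey by apply: yY; case: eyE.
    have Xb : X (g ey) by exact: gBA.
    have lb : normc (f (g ey) ord0 cz : R[i]) < normc (f (g ey) ord0 cy : R[i]).
      by rewrite gK // eyE.1 eyE.2 normc0 normc_gt0 oner_eq0.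
    have lv : normc (f v ord0 cy : R[i]) < normc (f v ord0 cz : R[i]).
      by rewrite (n0 _ E).
    by have /tangent_coneP[Hb|Qb] := Xb; [exact: (hH v (g ey))|exact: (hQ v (g ey))].
  have Yb : Y ez by apply: zY; case: ezE.
  have Xb : X (g ez) by exact: gBA.
  have lb : normc (f (g ez) ord0 cy : R[i]) < normc (f (g ez) ord0 cz : R[i]).
    by rewrite gK // ezE.1 ezE.2 normc0 normc_gt0 oner_eq0.
  have lv : normc (f v ord0 cz : R[i]) < normc (f v ord0 cy : R[i]).
    by rewrite (n0 _ E).
  by have /tangent_coneP[Hb|Qb] := Xb; [exact: (hH (g ez) v)|exact: (hQ (g ez) v)].
(* Points of both signs accumulate at p, along the y axis and along the z axis. If [g p] were off H,
   their images near [g p] would lie in Q, and if it were off Q, in H; either way one component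
   would carry both signs. *)
have gmeet (p : V) : p ord0 cy = 0 -> p ord0 cz = 0 ->
    g p ord0 cy = 0 /\ quadric t (g p) = 0.
  move=> py pz.
  have Yey (s : K) : Y (p + s *: ey) by apply: yY; rewrite !mxE /= pz mulr0 addr0.
  have Yez (s : K) : Y (p + s *: ez) by apply: zY; rewrite !mxE /= py mulr0 addr0.
  have ly (s : R) : 0 < s -> normc (f (g (p + (s%:C : K) *: ey)) ord0 cz : R[i]) <
      normc (f (g (p + (s%:C : K) *: ey)) ord0 cy : R[i]).
    move=> s0; rewrite gK // !mxE /= py pz mulr0 mulr1 addr0 add0r normc0.
    by rewrite normc_gt0 fmorph_eq0 lt0r_neq0.
  have lz (s : R) : 0 < s -> normc (f (g (p + (s%:C : K) *: ez)) ord0 cy : R[i]) <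
      normc (f (g (p + (s%:C : K) *: ez)) ord0 cz : R[i]).
    move=> s0; rewrite gK // !mxE /= py pz mulr0 mulr1 addr0 add0r normc0.
    by rewrite normc_gt0 fmorph_eq0 lt0r_neq0.
  have both (q : V -> K) : {for g p, continuous q} -> q (g p) != 0 -> exists a b : V,
      [/\ X a, q a != 0, X b & q b != 0] /\
      normc (f a ord0 cy : R[i]) < normc (f a ord0 cz : R[i]) /\
      normc (f b ord0 cz : R[i]) < normc (f b ord0 cy : R[i]).
    move=> cq qp.
    have [d d0 Hd] := nonzero_near cg Yez cq qp.
    have [d' d'0 Hd'] := nonzero_near cg Yey cq qp.
    have d2 : 0 < d / 2 < d by rewrite divr_gt0 // ltr_pdivrMr // ltr_pMr // ltr1n.
    have d'2 : 0 < d' / 2 < d' by rewrite divr_gt0 // ltr_pdivrMr // ltr_pMr // ltr1n.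
    exists (g (p + ((d / 2)%:C : K) *: ez)), (g (p + ((d' / 2)%:C : K) *: ey)).
    split; first by split; [exact: gBA|exact: Hd|exact: gBA|exact: Hd'].
    by split; [apply: lz; case/andP: d2|apply: ly; case/andP: d'2].
  split; apply/eqP; apply: contrapT => /negP gp.
    have cyc : {for g p, continuous (fun v : V => v ord0 cy)} by exact: coord_continuous.
    have [a [b [[/tangent_coneP Xa ya /tangent_coneP Xb yb] [la lb]]]] := both _ cyc gp.
    have Qa : quadric t a = 0 by case: Xa => // E; rewrite E eqxx in ya.
    have Qb : quadric t b = 0 by case: Xb => // E; rewrite E eqxx in yb.
    exact: (hQ a b).
  have [a [b [[/tangent_coneP Xa ya /tangent_coneP Xb yb] [la lb]]]] :=
    both _ (@quadric_continuous R t (g p)) gp.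
  have Ha : a ord0 cy = 0 by case: Xa => // E; rewrite E eqxx in ya.
  have Hb : b ord0 cy = 0 by case: Xb => // E; rewrite E eqxx in yb.
  exact: (hH a b).
pose c (u : 'rV[K]_4) : V := vec6 (u ord0 (@Ordinal 4 0 isT)) (u ord0 (@Ordinal 4 1 isT))
  0 0 (u ord0 (@Ordinal 4 2 isT)) (u ord0 (@Ordinal 4 3 isT)).
have cc : coord_continuous_on setT c.
  move=> w _ e e0; exists e => // w' _ ww'; apply: ord6_ind; rewrite !mxE //=;
    by rewrite subrr !expr0n /= addr0 sqrtr0.
(* On the image of S0, y = 0 and x w = 0; where moreover |x| = |w|, both x and w vanish, so that
   only three coordinates remain. *)
pose J : {set 'I_6} := finset.setC (cx |: [set cw; cy])%SET.
have J3 : (#|J| <= 3)%N.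
  by rewrite cardsCs finset.setCK cardsU1 cards2 card_ord finset.in_set2.
have c_onto (v : V) : v ord0 cy = 0 -> v ord0 cz = 0 -> exists u, c u = v.
  move=> v0 v1; exists (\row_i nth (0 : K) [:: v ord0 cx; v ord0 cw; v ord0 cz2; v ord0 cz3] i).
  by rewrite [RHS]vec6E /c !mxE /= v0 v1.
have zE (x w : K) : x * w = 0 -> f (vec6 x w 0 0 0 0) ord0 cy = 0 /\
    f (vec6 x w 0 0 0 0) ord0 cz = 0.
  by move=> xw; apply: meet; rewrite /quadric !mxE //= mul0r xw mulr0 addr0.
have [u uE] : exists u, c u = f (vec6 0 1 0 0 0 0).
  by have [h1 h2] := zE 0 1 (mul0r _); exact: c_onto.
have [v vE] : exists v, c v = f (vec6 1 0 0 0 0 0).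
  by have [h1 h2] := zE 1 0 (mulr0 _); exact: c_onto.
have gu : g (c u) = vec6 0 1 0 0 0 0 by rewrite uE fK //; apply: HX; rewrite mxE.
have gv : g (c v) = vec6 1 0 0 0 0 0 by rewrite vE fK //; apply: HX; rewrite mxE.
apply: (@complex_separation R 3 6 setT (g \o c) cx cw J _ _ _ _ J3 _ u v) => //.
- by move=> *; exists 1.
- apply: (coord_continuous_comp cc cg) => w _; apply: yY; exact: mxE.
- move=> a b _ _ /= /ginj E.
  have {}E : c a = c b by apply: E; apply: yY; exact: mxE.
  apply/rowP => i; have := fun j => congr1 (fun w : V => w ord0 j) E.
  move=> {}E; have := E cx; have := E cw; have := E cz2; have := E cz3.
  rewrite !mxE /=; case: i => -[|[|[|[|//]]]] i; rewrite (bool_irrelevance i isT).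
  + by move=> _ _ _ ->.
  + by move=> _ _ -> _.
  + by move=> _ -> _ _.
  + by move=> -> _ _ _.
- move=> w _ /= E j; rewrite finset.in_setC negbK.
  have [y0 Q0] : g (c w) ord0 cy = 0 /\ quadric t (g (c w)) = 0.
    by apply: gmeet; rewrite mxE.
  have n0 (z : R[i]) : z = 0 -> normc z = 0 by move=> ->; rewrite normc0.
  have [x0 w0] : g (c w) ord0 cx = 0 /\ g (c w) ord0 cw = 0.
    move: Q0; rewrite /quadric y0 mul0r add0r => /eqP.
    rewrite !mulf_eq0 (negbTE t0) /= => /orP[/eqP E0|/eqP E0]; split=> //.
      exact: (eq0_normc (etrans (esym E) (n0 _ E0))).
    exact: (eq0_normc (etrans E (n0 _ E0))).
  rewrite finset.in_setU1 finset.in_set2 => /or3P[] /eqP ->.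
  + exact: x0.
  + exact: w0.
  + exact: y0.
- by rewrite /= gu !mxE /= !expr0n expr1n /= !addr0 sqrtr0 sqrtr1.
- by rewrite /= gv !mxE /= !expr0n expr1n /= !addr0 sqrtr0 sqrtr1.
Qed.
End NotHomeomorphic.

Theorem proposition2p8 (R : realType) :
  exists (n : nat) (D : set (Cplx R)) (f : Cplx R -> Cn R n -> Cplx R),
    [/\ (1 <= n)%N, open D /\ D 0,
        holomorphic_family D f /\ (forall t, D t -> reduced_germ (f t)) &
        [/\ forall t, D t ->
              exists2 phi : Cn R n -> Cn R n,
                homeo_germ phi & germ_eq (f t) (f 0 \o phi),
            forall t, D t -> t != 0 ->
              ~ homeomorphic (tangent_cone (f t)) (tangent_cone (f 0)) &
            forall t, D t -> t != 0 ->
              forall (r s : nat)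
                (X : 'I_r -> set (Cn R n)) (kX : 'I_r -> nat)
                (Y : 'I_s -> set (Cn R n)) (kY : 'I_s -> nat),
                tangent_cone_components (f t) X kX ->
                tangent_cone_components (f 0) Y kY ->
                ~ exists2 sigma : 'I_r -> 'I_s,
                    bijective sigma & forall i, kX i = kY (sigma i)]].
Proof.
exists 6%N, setT, (@family R); split=> //; first by split; first exact: openT.
  split=> [t _|t _]; last exact: family_reduced.
  by apply: (filterE (F := nbhs ((t, 0) : Cplx R * Cn R 6))) => p; exact: family_holomorphic.
split=> [t _|t _ t0|t _ t0].
- exact: family_equisingular.
- exact: tangent_cones_not_homeomorphic.
- exact: cone_multiplicities_differ.
Qed.
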